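(* Let $\mathbb{A}=L_a\mathbb{I}+D_a\mathbf{A}$, $\mathbb{B}=L_b\mathbb{I}+D_b\mathbf{B}$, $\mathbb{Q}=L_q\mathbb{I}+D_q\mathbf{Q}$ and $\mathbb{Q}_T=L_{q_T}\mathbb{I}+D_{q_T}\mathbf{Q}_T$, where $L_a,D_a,L_b,D_b,L_q,D_q,L_{q_T},D_{q_T}\in\mathbb{R}^{n\times n}$ and $\mathbf{A},\mathbf{B},\mathbf{Q},\mathbf{Q}_T\in\mathcal{W}_c$. Assume: (1) $\mathbb{Q}$ and $\mathbb{Q}_T$ are self-adjoint and non-negative on $(L^2[0,1])^n$; (2) there is a finite-dimensional subspace $\mathcal{S}\subset L^2[0,1]$ that is invariant under each of $\mathbf{A},\mathbf{B},\mathbf{Q},\mathbf{Q}_T$; (3) $\mathbf{A}\mathbf{v}=\mathbf{B}\mathbf{v}=\mathbf{Q}\mathbf{v}=\mathbf{Q}_T\mathbf{v}=0$ for all $\mathbf{v}\in\mathcal{S}^\perp$. Let $d=\dim\mathcal{S}$, let $\mathbf{f}_1,\dots,\mathbf{f}_d$ be an orthonormal basis of $\mathcal{S}$, and let $A,B,Q,Q_T\in\mathbb{R}^{d\times d}$ be the matrices with entries $A_{\ell k}=\langle\mathbf{A}\mathbf{f}_\ell,\mathbf{f}_k\rangle$, $B_{\ell k}=\langle\mathbf{B}\mathbf{f}_\ell,\mathbf{f}_k\rangle$, $Q_{\ell k}=\langle\mathbf{Q}\mathbf{f}_\ell,\mathbf{f}_k\rangle$, $(Q_T)_{\ell k}=\langle\mathbf{Q}_T\mathbf{f}_\ell,\mathbf{f}_k\rangle$.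 Then for every initial state $\mathbf{x}_0\in(L^2[0,1])^n$, the problem of minimizing $$J(\mathbf{u})=\int_0^T\big(\langle\mathbf{x}_t,\mathbb{Q}\mathbf{x}_t\rangle+\langle\mathbf{u}_t,\mathbf{u}_t\rangle\big)dt+\langle\mathbf{x}_T,\mathbb{Q}_T\mathbf{x}_T\rangle$$ over $\mathbf{u}\in L^2([0,T];(L^2[0,1])^n)$ subject to $\dot{\mathbf{x}}_t=\mathbb{A}\mathbf{x}_t+\mathbb{B}\mathbf{u}_t$, $t\in[0,T]$, has a unique optimal control $\mathbf{u}^o$, and, with $\mathbf{x}^o$ the corresponding optimal state, it is given by $$\mathbf{u}^o_t=\breve{\mathbf{u}}^o_t+\sum_{\ell=1}^d u_t^{op\ell}\,\mathbf{f}_\ell ,$$ where $u_t^{op}=[(u_t^{op1})^\top,\dots,(u_t^{opd})^\top]^\top\in\mathbb{R}^{nd}$ (each $u_t^{op\ell}\in\mathbb{R}^n$) is given by $$u_t^{op}=-(I\otimes L_b+B\otimes D_b)^\top\Pi_t\,x_t^{op},\qquad x_t^{op}=\mathrm{Proj}_{\mathbf{f}}(\mathbf{x}^o_t),$$ $$\begin{aligned}-\dot\Pi_t=\;&(I\otimes L_a+A\otimes D_a)^\top\Pi_t+\Pi_t(I\otimes L_a+A\otimes D_a)\\&-\Pi_t(I\otimes L_b+B\otimes D_b)(I\otimes L_b+B\otimes D_b)^\top\Pi_t+(I\otimes L_q+Q\otimes D_q),\end{aligned}$$ $$\Pi_T=I\otimes L_{q_T}+Q_T\otimes D_{q_T},$$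 and, for almost all $\gamma\in[0,1]$, $$\breve{\mathbf{u}}_t^{o\gamma}=-L_b^\top\pi_t\,\breve{\mathbf{x}}_t^{\gamma},\qquad -\dot\pi_t=L_a^\top\pi_t+\pi_tL_a-\pi_tL_bL_b^\top\pi_t+L_q,\qquad \pi_T=L_{q_T},$$ where $\breve{\mathbf{x}}_t$ is the $(\mathcal{S}^\perp)^n$-component of the optimal state $\mathbf{x}^o_t$, $\breve{\mathbf{x}}_t^\gamma=\breve{\mathbf{x}}_t(\gamma)\in\mathbb{R}^n$ and $\breve{\mathbf{u}}_t^{o\gamma}=\breve{\mathbf{u}}_t^{o}(\gamma)\in\mathbb{R}^n$.
   Context: Fix $T>0$, $c>0$, $n\ge1$. $\mathcal{W}_c$ is the set of symmetric measurable functions $[0,1]^2\to[-c,c]$ (''graphons''). Each $\mathbf{A}\in\mathcal{W}_c$ also denotes the integral operator $(\mathbf{A}\mathbf{v})(\alpha)=\int_0^1\mathbf{A}(\alpha,\beta)\mathbf{v}(\beta)d\beta$ on $L^2[0,1]$. $(L^2[0,1])^n$ is the Hilbert space of real vector functions $\mathbf{v}=(\mathbf{v}_1,\dots,\mathbf{v}_n)$ with inner product $\langle\mathbf{u},\mathbf{v}\rangle=\sum_{i=1}^n\langle\mathbf{u}_i,\mathbf{v}_i\rangle_{L^2[0,1]}$. For $D\in\mathbb{R}^{n\times n}$, $D\mathbf{A}$ and $D\mathbb{I}$ are the bounded operators on $(L^2[0,1])^n$ given by $([D\mathbf{A}]\mathbf{v})(\alpha)=D\int_0^1\mathbf{A}(\alpha,\beta)\mathbf{v}(\beta)d\beta$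 and $([D\mathbb{I}]\mathbf{v})(\alpha)=D\mathbf{v}(\alpha)$. The dynamics $\dot{\mathbf{x}}_t=\mathbb{A}\mathbf{x}_t+\mathbb{B}\mathbf{u}_t$ are understood in the mild sense: $\mathbf{x}_t=e^{(t-a)\mathbb{A}}\mathbf{x}_a+\int_a^te^{(t-s)\mathbb{A}}\mathbb{B}\mathbf{u}_s\,ds$ for all $0\le a\le t\le T$. A subspace $\mathcal{S}$ is invariant under $\mathbf{A}$ if $\mathbf{A}\mathbf{v}\in\mathcal{S}$ for all $\mathbf{v}\in\mathcal{S}$. $(\mathcal{S})^n=\mathcal{S}\times\cdots\times\mathcal{S}$ ($n$ factors), and likewise $(\mathcal{S}^\perp)^n$. Every $\mathbf{v}\in(L^2[0,1])^n$ is decomposed uniquely, component by component, as $\mathbf{v}=\mathbf{v}^{\mathbf{f}}+\breve{\mathbf{v}}$ with $\mathbf{v}^{\mathbf{f}}\in(\mathcal{S})^n$, $\breve{\mathbf{v}}\in(\mathcal{S}^\perp)^n$. For $\mathbf{x}\in(L^2[0,1])^n$, $\mathrm{Proj}_{\mathbf{f}}(\mathbf{x})=[(x^{p1})^\top,\dots,(x^{pd})^\top]^\top\in\mathbb{R}^{nd}$, where $x^{p\ell}\in\mathbb{R}^n$ has $i$-th entry $\langle\mathbf{x}_i,\mathbf{f}_\ell\rangle$. For $v\in\mathbb{R}^n$ and $\mathbf{z}\in L^2[0,1]$, $v\mathbf{z}\in(L^2[0,1])^n$ is $(v\mathbf{z})(\alpha)=v\,\mathbf{z}(\alpha)$. $\otimes$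 is the Kronecker product $M\otimes D=[m_{ij}D]_{ij}$, and $I$ is the $d\times d$ identity matrix. *)

(* Defs.v *)
From mathcomp Require Import all_boot all_order all_algebra.
From mathcomp Require Import all_classical all_reals all_analysis.
From mathcomp Require Import mxtens.
Set Implicit Arguments.
Unset Strict Implicit.
Unset Printing Implicit Defensive.
Import Order.TTheory GRing.Theory Num.Theory.
Import numFieldNormedType.Exports.
Local Open Scope classical_set_scope.
Local Open Scope ring_scope.

(* Elements of L^2[0,1] are represented by functions on the whole line of which
   only the values on [0,1] matter, and equality in L^2[0,1] is almost
   everywhere equality on [0,1].  Measurability is Borel measurability, which
   loses no class of functions modulo almost everywhere equality. *)
Definition I01 (R : realType) : set R := `[0, 1]%classic.
Arguments I01 {R}.

Definition L2 (R : realType) (f : R -> R) : Prop :=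
  f \_ I01 \in Lfun (@lebesgue_measure R) 2%:E.

Definition ip (R : realType) (f g : R -> R) : R :=
  \int[lebesgue_measure]_(a in I01) (f a * g a).

(* Equality in L^2[0,1] (V = R) and in (L^2[0,1])^n (V = 'cV[R]_n). *)
Definition eqL2 (R : realType) (V : Type) (f g : R -> V) : Prop :=
  ae_eq (@lebesgue_measure R) I01 f g.

Definition graphon (R : realType) (c : R) (A : R * R -> R) : Prop :=
  [/\ measurable_fun (I01 `*` I01) A,
      forall a b, I01 a -> I01 b -> A (a, b) = A (b, a)
    & forall a b, I01 a -> I01 b -> - c <= A (a, b) <= c].

Definition gop (R : realType) (A : R * R -> R) (v : R -> R) : R -> R :=
  fun a => \int[lebesgue_measure]_(b in I01) (A (a, b) * v b).

(* A vector function is v : R -> 'cV[R]_n; v a is the vector v(a) in R^n. *)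
Definition coordf (R : realType) (n : nat) (v : R -> 'cV[R]_n) (i : 'I_n) :
  R -> R := fun a => v a i 0.

Definition L2n (R : realType) (n : nat) (v : R -> 'cV[R]_n) : Prop :=
  forall i, L2 (coordf v i).

Definition ipn (R : realType) (n : nat) (u v : R -> 'cV[R]_n) : R :=
  \sum_(i < n) ip (coordf u i) (coordf v i).

Definition normn (R : realType) (n : nat) (v : R -> 'cV[R]_n) : R :=
  Num.sqrt (ipn v v).

(* The operator L I + D A on (L^2[0,1])^n. *)
Definition opn (R : realType) (n : nat) (L D : 'M[R]_n) (A : R * R -> R)
    (v : R -> 'cV[R]_n) : R -> 'cV[R]_n :=
  fun a => L *m v a + D *m (\col_i gop A (coordf v i) a).

Definition self_adjoint (R : realType) (n : nat)
    (F : (R -> 'cV[R]_n) -> (R -> 'cV[R]_n)) : Prop :=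
  forall u v, L2n u -> L2n v -> ipn (F u) v = ipn u (F v).

Definition nonnegative (R : realType) (n : nat)
    (F : (R -> 'cV[R]_n) -> (R -> 'cV[R]_n)) : Prop :=
  forall v, L2n v -> 0 <= ipn v (F v).

(* Representatives: a subspace of L^2[0,1] is a set of functions that is
   saturated for almost everywhere equality. *)
Definition linear_subspace (R : realType) (S : set (R -> R)) : Prop :=
  [/\ forall f, S f -> L2 f,
      S (fun=> 0),
      forall (k : R) f g, S f -> S g -> S (fun a => k * f a + g a)
    & forall f g, S f -> L2 g -> eqL2 f g -> S g].

Definition orth (R : realType) (S : set (R -> R)) : set (R -> R) :=
  [set v | L2 v /\ forall s, S s -> ip v s = 0].

(* An orthonormal basis with d elements: in particular S has dimension d. *)
Definition orthonormal_basis (R : realType) (d : nat) (S : set (R -> R))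
    (f : 'I_d -> R -> R) : Prop :=
  [/\ forall l, S (f l),
      forall l k, ip (f l) (f k) = (l == k)%:R
    & forall v, S v -> exists k : 'I_d -> R,
        eqL2 v (fun a => \sum_(l < d) k l * f l a)].

Definition invariant_under (R : realType) (S : set (R -> R))
    (A : R * R -> R) : Prop := forall v, S v -> S (gop A v).

Definition vanishes_on_orth (R : realType) (S : set (R -> R))
    (A : R * R -> R) : Prop := forall v, orth S v -> eqL2 (gop A v) (fun=> 0).

(* v = vf + vb with vf in S^n and vb in (S^perp)^n. *)
Definition decomposition (R : realType) (n : nat) (S : set (R -> R))
    (v vf vb : R -> 'cV[R]_n) : Prop :=
  [/\ forall i, S (coordf vf i), forall i, orth S (coordf vb i)
    & eqL2 v (vf + vb)].

Definition gmatrix (R : realType) (d : nat) (f : 'I_d -> R -> R)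
    (A : R * R -> R) : 'M[R]_d :=
  \matrix_(l, k) ip (gop A (f l)) (f k).

(* mxtens_index (l, i) is the position l * n + i of the i-th entry of the l-th
   block of a vector of R^{dn}; this is also the indexing used by the Kronecker
   product M *t D. *)
Definition Projf (R : realType) (d n : nat) (f : 'I_d -> R -> R)
    (x : R -> 'cV[R]_n) : 'cV[R]_(d * n) :=
  \col_k ip (coordf x (mxtens_unindex k).2) (f (mxtens_unindex k).1).

Definition block (R : realType) (d n : nat) (v : 'cV[R]_(d * n)) (l : 'I_d) :
  'cV[R]_n := \col_i v (mxtens_index (l, i)) 0.

Definition kron_op (R : realType) (d n : nat) (L D : 'M[R]_n) (A : 'M[R]_d) :
  'M[R]_(d * n) := 1%:M *t L + A *t D.

(* e^{tF} v: a representative of the limit in (L^2[0,1])^n of the partial sums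
   of the exponential series. *)
Definition expop (R : realType) (n : nat)
    (F : (R -> 'cV[R]_n) -> (R -> 'cV[R]_n)) (t : R) (v : R -> 'cV[R]_n) :
    R -> 'cV[R]_n :=
  xget 0 [set w | L2n w /\
    normn (w - \sum_(k < N) (t ^+ k / k`!%:R) *: iter k F v)
      @[N --> \oo] --> (0 : R)].

(* A curve in (L^2[0,1])^n is a function R -> R -> 'cV[R]_n whose first argument
   is time.  The next definitions are those of the Bochner theory: integration
   of simple curves, strong measurability (pointwise limits of simple curves)
   and integral (limit of integrals of simple curves converging in L^1). *)
Record simple_curve (R : realType) (n : nat) := SimpleCurve {
  sc_size : nat;
  sc_set : 'I_sc_size -> set R;
  sc_val : 'I_sc_size -> R -> 'cV[R]_n;
  sc_set_measurable : forall j, measurable (sc_set j);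
  sc_val_L2n : forall j, L2n (sc_val j) }.

Definition sc_fun (R : realType) (n : nat) (s : simple_curve R n) (t : R) :
    R -> 'cV[R]_n :=
  \sum_(j < sc_size s) \1_(sc_set j) t *: sc_val j.

Definition sc_int (R : realType) (n : nat) (D : set R) (s : simple_curve R n) :
    R -> 'cV[R]_n :=
  \sum_(j < sc_size s) fine (lebesgue_measure (D `&` sc_set j)) *: sc_val j.

Definition strongly_measurable (R : realType) (n : nat) (D : set R)
    (y : R -> R -> 'cV[R]_n) : Prop :=
  (forall t, D t -> L2n (y t)) /\
  exists s : nat -> simple_curve R n,
    forall t, D t -> normn (y t - sc_fun (s k) t) @[k --> \oo] --> (0 : R).

(* z is the integral of y over D (a set of finite measure); this includes the
   integrability of y. *)
Definition is_bochner_integral (R : realType) (n : nat) (D : set R)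
    (y : R -> R -> 'cV[R]_n) (z : R -> 'cV[R]_n) : Prop :=
  [/\ L2n z, strongly_measurable D y
    & exists s : nat -> simple_curve R n,
        (\int[lebesgue_measure]_(t in D) (normn (y t - sc_fun (s k) t))%:E)%E
          @[k --> \oo] --> 0%E /\
        normn (z - sc_int D (s k)) @[k --> \oo] --> (0 : R)].

(* u is in L^2([0,T]; (L^2[0,1])^n). *)
Definition admissible (R : realType) (n : nat) (T : R)
    (u : R -> R -> 'cV[R]_n) : Prop :=
  strongly_measurable `[0, T] u /\
  (\int[lebesgue_measure]_(t in `[0%R, T]) (normn (u t) ^+ 2)%:E < +oo)%E.

(* x is the mild solution of x' = FA x + FB u with initial state x0. *)
Definition mild_solution (R : realType) (n : nat) (T : R)
    (FA FB : (R -> 'cV[R]_n) -> (R -> 'cV[R]_n)) (x0 : R -> 'cV[R]_n)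
    (u x : R -> R -> 'cV[R]_n) : Prop :=
  [/\ forall t : R, 0 <= t <= T -> L2n (x t),
      eqL2 (x 0) x0
    & forall a t : R, 0 <= a -> a <= t -> t <= T ->
        exists2 z,
          is_bochner_integral `[a, t]
            (fun s => expop FA (t - s) (FB (u s))) z
        & eqL2 (x t) (expop FA (t - a) (x a) + z)].

Definition cost (R : realType) (n : nat) (T : R)
    (FQ FQT : (R -> 'cV[R]_n) -> (R -> 'cV[R]_n))
    (x u : R -> R -> 'cV[R]_n) : \bar R :=
  (\int[lebesgue_measure]_(t in `[0%R, T])
     (ipn (x t) (FQ (x t)) + ipn (u t) (u t))%:E
   + (ipn (x T) (FQT (x T)))%:E)%E.

Definition optimal_control (R : realType) (n : nat) (T : R)
    (FA FB FQ FQT : (R -> 'cV[R]_n) -> (R -> 'cV[R]_n)) (x0 : R -> 'cV[R]_n)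
    (u : R -> R -> 'cV[R]_n) : Prop :=
  admissible T u /\
  exists2 x, mild_solution T FA FB x0 u x
    & forall v y, admissible T v -> mild_solution T FA FB x0 v y ->
        (cost T FQ FQT x u <= cost T FQ FQT y v)%E.

(* Classical solution on [0,T] of the matrix equation
   - P' = A^T P + P A - P B B^T P + Q,  P(T) = QT. *)
Definition riccati_solution (R : realType) (m : nat) (T : R)
    (A B Q QT : 'M[R]_m) (P : R -> 'M[R]_m) : Prop :=
  [/\ {within `[0, T], continuous P},
      forall t : R, 0 < t < T ->
        is_derive t 1 P
          (- (A^T *m P t + P t *m A - P t *m B *m B^T *m P t + Q))
    & P T = QT].

(* Main.v *)
Require Import Defs.
From mathcomp Require Import all_boot all_order all_algebra.
From mathcomp Require Import all_classical all_reals all_analysis.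
From mathcomp Require Import measurable_realfun mxtens.
From mathcomp Require Import ring lra.
Set Implicit Arguments.
Unset Strict Implicit.
Unset Printing Implicit Defensive.
Import Order.TTheory GRing.Theory Num.Theory.
Import numFieldNormedType.Exports.
Local Open Scope classical_set_scope.
Local Open Scope ring_scope.

(* By hypotheses (2) and (3) the dynamics and the cost leave S^n and (S^perp)^n
   invariant: on S^n they are given by the Kronecker matrices, on (S^perp)^n by
   the local matrices L_a, L_b, L_q, L_qT.  For a fixed initial state everything
   takes place in the finite-dimensional families Sum_l f_l N_l (N in R^{nd}) and
   N v(.) (N an n x n matrix, v the (S^perp)^n-component of x_0), so the operator
   exponential reduces to matrix exponentials.  The matrix Hamiltonian system
   X' = A X - B B^T Y, Y' = - Q X - A^T Y, X(T) = I, Y(T) = Q_T has X invertible on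
   ]-oo, T] because Q and Q_T are nonnegative, which gives the Riccati solutions
   P = Y X^-1 and the candidate control u = - B^T Y.
   Optimality and uniqueness come from convexity, J(v) >= J(u) + |v - u|^2: the
   first variation of J at u vanishes, by integration by parts of the pairing of
   the adjoint state Y with the difference of the two mild solutions. *)

(** * Matrix-valued curves and the Riccati equation *)

(** Competing controls are arbitrary elements of L^2, so their trajectories are never computed, only
    tested against the two finite families. This is why a matrix that represents an operator on a
    family must also represent its adjoint through its transpose: the exponential then moves from an
    unknown vector to the test vector. Bounding the quadratic state costs by their linearization
    drops only nonnegative terms, while the exact expansion of the control cost leaves |v - u|^2;
    that term gives minimality and uniqueness together. Nonnegativity of L_q and L_qT is not given:
    it comes from testing the operators on e(.)x with a nonzero e in S^perp, which exists because S
    is finite-dimensional. Elements of L^2 are representatives and [expop] picks one by choice, so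
    identities are mostly modulo null sets and limits have to be exhibited before [expop] can be
    used. The theorem quantifies over every solution of the Riccati equations; the identity Y = P X,
    proved for an arbitrary solution P, ties each of them to the Hamiltonian flow. *)

Section MatrixCalculus.
Context {R : realType}.

Lemma is_derive_mxP m n (M : R -> 'M[R]_(m, n)) (t : R) (dM : 'M[R]_(m, n)) :
  is_derive t 1 M dM <->
  forall i j, is_derive t 1 (fun s => M s i j) (dM i j).
Proof.
split=> [[dM1 dM2] i j|h].
- split; first by move/derivable_mxP : dM1; exact.
  by have := derive_mx dM1; rewrite dM2 => ->; rewrite mxE.
- have d : derivable M t 1.
    by apply/derivable_mxP => i j; have [] := h i j.
  split=> //; rewrite derive_mx //; apply/matrixP => i j; rewrite mxE.
  by have [_ ->] := h i j.
Qed.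

Lemma is_derive_sumf (I : Type) (r : seq I) (P : pred I) (f : I -> R -> R)
    (df : I -> R) (t : R) :
  (forall i, P i -> is_derive t 1 (f i) (df i)) ->
  is_derive t 1 (fun s => \sum_(i <- r | P i) f i s) (\sum_(i <- r | P i) df i).
Proof.
move=> h; elim: r => [|i r IH].
  under eq_fun do rewrite big_nil.
  by rewrite big_nil; exact: is_derive_cst.
under eq_fun do rewrite big_cons.
rewrite big_cons; case: ifPn => Pi //.
by apply: is_deriveD => //; exact: h.
Qed.

Lemma is_derive_mul (f g : R -> R) (df dg t : R) :
  is_derive t 1 f df -> is_derive t 1 g dg ->
  is_derive t 1 (fun s => f s * g s) (df * g t + f t * dg).
Proof.
move=> hf hg; apply: is_derive_eq (is_deriveM hf hg) _.
by rewrite addrC /GRing.scale /= mulrC.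
Qed.

Lemma is_derive_mulmx m n p (M : R -> 'M[R]_(m, n)) (N : R -> 'M[R]_(n, p))
    (t : R) dM dN :
  is_derive t 1 M dM -> is_derive t 1 N dN ->
  is_derive t 1 (fun s => M s *m N s) (dM *m N t + M t *m dN).
Proof.
move=> /is_derive_mxP hM /is_derive_mxP hN; apply/is_derive_mxP => i j.
under eq_fun do rewrite mxE.
rewrite !mxE -big_split /=.
by apply: is_derive_sumf => k _; exact: is_derive_mul.
Qed.

Lemma is_derive_cst_mulmx m n p (M : 'M[R]_(m, n)) (N : R -> 'M[R]_(n, p))
    (t : R) dN :
  is_derive t 1 N dN -> is_derive t 1 (fun s => M *m N s) (M *m dN).
Proof.
move=> hN; have := is_derive_mulmx (is_derive_cst M t 1) hN.
by rewrite mul0mx add0r.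
Qed.

Lemma is_derive_mulmx_cst m n p (M : R -> 'M[R]_(m, n)) (N : 'M[R]_(n, p))
    (t : R) dM :
  is_derive t 1 M dM -> is_derive t 1 (fun s => M s *m N) (dM *m N).
Proof.
move=> hM; have := is_derive_mulmx hM (is_derive_cst N t 1).
by rewrite mulmx0 addr0.
Qed.

Lemma is_derive_mx_cst m n (M : R -> 'M[R]_(m, n)) (t s : R) :
  (forall x : R, is_derive x 1 M 0) -> M t = M s.
Proof.
move=> h; apply/matrixP => i j.
apply: (@is_derive_0_is_cst _ (fun x => M x i j)) => x.
by have /is_derive_mxP/(_ i j) := h x; rewrite mxE.
Qed.

Lemma is_derive_trmx m n (M : R -> 'M[R]_(m, n)) (t : R) dM :
  is_derive t 1 M dM -> is_derive t 1 (fun s => (M s)^T) dM^T.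
Proof.
move=> /is_derive_mxP h; apply/is_derive_mxP => i j.
by under eq_fun do rewrite mxE; rewrite mxE.
Qed.

End MatrixCalculus.

Lemma cvg_sumf {R : realType} (I T : Type) (F : set_system T) {FF : Filter F}
    (r : seq I) (P : pred I) (f : I -> T -> R) (l : I -> R) :
  (forall i, P i -> f i @ F --> l i) ->
  (fun x => \sum_(i <- r | P i) f i x) @ F --> \sum_(i <- r | P i) l i.
Proof.
move=> h; elim: r => [|i r IH].
  under eq_fun do rewrite big_nil.
  by rewrite big_nil; exact: cvg_cst.
under eq_fun do rewrite big_cons.
rewrite big_cons; case: ifPn => Pi //.
by apply: cvgD => //; exact: h.
Qed.

(** * The matrix exponential *)

Section MatrixExponential.
Context {R : realType} {p : nat}.
Implicit Types K : 'M[R]_p.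

Definition mexp_coef K (i j : 'I_p) (k : nat) : R := (K ^+ k) i j / k`!%:R.

(** Defined entry by entry, so that convergence and differentiation come from the theory of scalar
    power series. *)
Definition mexp K (t : R) : 'M[R]_p :=
  \matrix_(i, j) limn (pseries (mexp_coef K i j) t).

(** Passing from K^k to K^(k+1) multiplies the bound by a row sum of absolute values, and the sum
    over all entries dominates every row sum. The geometric bound makes a scalar exponential series
    a majorant of each entry. *)
Lemma mx_pow_bound K :
  exists2 C : R, 0 <= C & forall k i j, `|(K ^+ k) i j| <= C ^+ k.
Proof.
pose c := \sum_(i < p) \sum_(j < p) `|K i j|.
have c0 : 0 <= c by apply: sumr_ge0 => i _; apply: sumr_ge0.
exists (1 + c); first exact: addr_ge0.
elim=> [|k IH] i j.
  rewrite !expr0 mxE.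
  by case: eqP => _; rewrite ?mulr1n ?mulr0n ?normr1 ?normr0.
rewrite exprS mxE (le_trans (ler_norm_sum _ _ _))//.
apply: (@le_trans _ _ (\sum_(l < p) `|K i l| * (1 + c) ^+ k)).
  by apply: ler_sum => l _; rewrite normrM ler_wpM2l.
rewrite -mulr_suml exprS ler_wpM2r ?exprn_ge0 ?addr_ge0//.
rewrite (@le_trans _ _ c) ?lerDr//.
by rewrite /c [leRHS](bigD1 i)//= lerDl sumr_ge0// => ? _; exact: sumr_ge0.
Qed.

Lemma mexp_coef_diffs K i j :
  pseries_diffs (mexp_coef K i j) =
  (fun k => (K ^+ k.+1) i j / k`!%:R).
Proof.
apply/funext => k; rewrite /pseries_diffs /mexp_coef factS natrM invfM.
by rewrite mulrCA mulrA mulrA mulfK ?pnatr_eq0//.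
Qed.

(** The m-th formal derivative of the entry series has its coefficients taken from K^(k+m).
    Term-by-term differentiation asks for convergence with m = 0, 1 and 2; the majorant is C^m times
    the exponential series of C|x|. *)
Lemma is_cvg_mexp_shift K i j m (x : R) :
  cvgn (pseries (fun k => (K ^+ (k + m)) i j / k`!%:R) x).
Proof.
have [C C0 hC] := mx_pow_bound K.
apply: normed_cvg.
apply: (@series_le_cvg _ _ (fun k => C ^+ m * exp_coeff (C * `|x|) k)).
- by move=> k; rewrite /=.
- by move=> k; rewrite /exp_coeff /= mulr_ge0 ?exprn_ge0// divr_ge0// exprn_ge0// mulr_ge0.
- move=> k /=; rewrite /exp_coeff /= !normrM normrX normfV (ger0_norm (ler0n _ _)).
  rewrite exprMn [leRHS]mulrA mulrA -exprD addnC.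
  rewrite [leLHS]mulrAC ler_wpM2r ?invr_ge0// ler_wpM2r ?exprn_ge0//.
- have -> : (fun k => C ^+ m * exp_coeff (C * `|x|) k) =
      C ^+ m *: exp_coeff (C * `|x|) by [].
  by apply: is_cvg_seriesZ; exact: is_cvg_series_exp_coeff.
Qed.

Lemma is_cvg_mexp K i j (x : R) : cvgn (pseries (mexp_coef K i j) x).
Proof.
have := @is_cvg_mexp_shift K i j 0 x.
by under eq_fun do rewrite addn0.
Qed.

Lemma mexp_cvg K (t : R) i j :
  (fun N => (\sum_(k < N) (t ^+ k / k`!%:R) *: K ^+ k) i j) @ \oo -->
  mexp K t i j.
Proof.
rewrite mxE.
suff -> : (fun N => (\sum_(k < N) (t ^+ k / k`!%:R) *: K ^+ k) i j) =
    pseries (mexp_coef K i j) t by exact: is_cvg_mexp.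
apply/funext => N; rewrite /pseries /series /= big_mkord summxE.
by apply: eq_bigr => k _; rewrite mxE /mexp_coef; ring.
Qed.

Lemma is_derive_mexp K (t : R) : is_derive t 1 (mexp K) (K *m mexp K t).
Proof.
apply/is_derive_mxP => i j.
have dK (k : nat) : (fun l => (K ^+ (l + k)) i j / l`!%:R) =
    iter k (fun c : R^nat => pseries_diffs c) (mexp_coef K i j).
  elim: k => [|k IH]; first by under eq_fun do rewrite addn0.
  rewrite iterS -IH /pseries_diffs; apply/funext => l.
  rewrite addSnnS factS natrM invfM mulrCA mulrA mulrA mulfK ?pnatr_eq0//.
have h : is_derive t 1 (fun x : R => limn (pseries (mexp_coef K i j) x))
    (limn (pseries (pseries_diffs (mexp_coef K i j)) t)).
  (* |t| + 1 is a point strictly beyond |t| at which the series and its first two formal derivatives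
     converge. *)
  apply: (@pseries_snd_diffs _ _ (`|t| + 1)).
  - exact: is_cvg_mexp.
  - by have := @is_cvg_mexp_shift K i j 1 (`|t| + 1); rewrite dK.
  - by have := @is_cvg_mexp_shift K i j 2 (`|t| + 1); rewrite dK.
  - by rewrite [ltRHS]ger0_norm ?addr_ge0// ltrDl.
have -> : (fun s => mexp K s i j) = (fun x : R => limn (pseries (mexp_coef K i j) x)).
  by apply/funext => s; rewrite mxE.
apply: is_derive_eq h _.
apply/cvg_lim => //.
have -> : (K *m mexp K t) i j = \sum_l K i l * mexp K t l j by rewrite mxE.
have -> : pseries (pseries_diffs (mexp_coef K i j)) t =
    (fun N => \sum_l K i l * (\sum_(k < N) (t ^+ k / k`!%:R) *: K ^+ k) l j).
  apply/funext => N; rewrite mexp_coef_diffs /pseries /series /= big_mkord.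
  under [RHS]eq_bigr do rewrite summxE mulr_sumr.
  rewrite exchange_big /=; apply: eq_bigr => k _.
  rewrite exprS mxE !mulr_suml; apply: eq_bigr => l _.
  by rewrite mxE; ring.
apply: cvg_sumf => l _; apply: cvgM; [exact: cvg_cst|exact: mexp_cvg].
Qed.

End MatrixExponential.

Lemma cvgn_unique {R : realType} (u : R^nat) (a b : R) :
  u @ \oo --> a -> u @ \oo --> b -> a = b.
Proof. by move=> /(cvg_lim (@Rhausdorff R)) <- /(cvg_lim (@Rhausdorff R)) <-. Qed.
Arguments cvgn_unique {R u a b}.

Section MatrixExponentialGroup.
Context {R : realType} {p : nat}.
Implicit Types K : 'M[R]_p.

Lemma mexp0 K : mexp K 0 = 1%:M.
Proof.
apply/matrixP => i j.
refine (cvgn_unique (@mexp_cvg _ _ K 0 i j) _).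
(* The empty partial sum is skipped; from one term on, the partial sums at 0 are constantly the
   identity. *)
rewrite -(cvg_shiftS _).
suff -> : (fun N => (\sum_(k < N.+1) ((0 : R) ^+ k / k`!%:R) *: K ^+ k) i j) =
    cst ((1%:M : 'M[R]_p) i j) by exact: cvg_cst.
apply/funext => N /=; rewrite big_ord_recl /= big1 ?addr0.
  by rewrite expr0 divr1 scale1r.
by move=> k _; rewrite expr0n /= mul0r scale0r.
Qed.

Lemma mexp_tr K (t : R) : (mexp K t)^T = mexp K^T t.
Proof.
apply/matrixP => i j; rewrite !mxE; congr (limn (pseries _ t)).
apply/funext => k; rewrite /mexp_coef; congr (_ / _).
by elim: k i j => [|k IH] i j; rewrite ?expr0 ?mxE 1?eq_sym// exprSr mxE exprS mxE;
  apply: eq_bigr => l _; rewrite IH mxE mulrC.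
Qed.

Lemma mexp_comm K (t : R) : K *m mexp K t = mexp K t *m K.
Proof.
apply/matrixP => i j.
pose S N := \sum_(k < N) (t ^+ k / k`!%:R) *: K ^+ k.
have h1 : (fun N => (K *m S N) i j) @ \oo --> (K *m mexp K t) i j.
  under eq_fun do rewrite mxE; rewrite mxE.
  by apply: cvg_sumf => l _; apply: cvgM; [exact: cvg_cst|exact: mexp_cvg].
have h2 : (fun N => (S N *m K) i j) @ \oo --> (mexp K t *m K) i j.
  under eq_fun do rewrite mxE; rewrite mxE.
  by apply: cvg_sumf => l _; apply: cvgM; [exact: mexp_cvg|exact: cvg_cst].
refine (cvgn_unique h1 _).
suff -> : (fun N => (K *m S N) i j) = (fun N => (S N *m K) i j) by [].
apply/funext => N; suff -> : K *m S N = S N *m K by [].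
rewrite /S mulmx_sumr mulmx_suml; apply: eq_bigr => k _.
by rewrite -scalemxAr -scalemxAl; congr (_ *: _); exact: (commrX k (erefl _)).
Qed.

(** The product has zero derivative because K commutes with its exponential, so it keeps its value
    at 0. *)
Lemma mexpK K (t : R) : mexp (- K) t *m mexp K t = 1%:M.
Proof.
rewrite -[RHS]mulmx1 -{1}(mexp0 (- K)) -(mexp0 K).
apply: (is_derive_mx_cst (M := fun s => mexp (- K) s *m mexp K s)) => s.
apply: is_derive_eq.
  by apply: is_derive_mulmx; exact: is_derive_mexp.
by rewrite mexp_comm mulmxN mulNmx !mulmxA addNr.
Qed.

Lemma mexpVK K (t : R) : mexp K t *m mexp (- K) t = 1%:M.
Proof. by have := mexpK (- K) t; rewrite opprK. Qed.

Lemma is_derive_mexpB K (t s : R) :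
  is_derive t 1 (fun x => mexp K (x - s)) (K *m mexp K (t - s)).
Proof.
apply/is_derive_mxP => i j.
have /is_derive_mxP/(_ i j) h := is_derive_mexp K (t - s).
have := @is_derive1_comp _ (fun x => mexp K x i j) (shift (- s)) t _ _ h
  (is_derive_shift t 1 (- s)).
by rewrite mulr1.
Qed.

(** exp(-xK) exp((x - s)K) does not depend on x; comparing x = t with x = s gives the formula
    without multiplying two series. *)
Lemma mexpB K (t s : R) : mexp K (t - s) = mexp K t *m mexp (- K) s.
Proof.
have : mexp (- K) t *m mexp K (t - s) = mexp (- K) s *m mexp K (s - s).
  apply: (is_derive_mx_cst (M := fun x => mexp (- K) x *m mexp K (x - s))) => x.
  apply: is_derive_eq.
    by apply: is_derive_mulmx; [exact: is_derive_mexp|exact: is_derive_mexpB].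
  by rewrite mexp_comm mulmxN mulNmx !mulmxA addNr.
rewrite subrr mexp0 mulmx1 => /(congr1 (mulmx (mexp K t))).
by rewrite mulmxA mexpVK mul1mx.
Qed.

End MatrixExponentialGroup.

(** * Uniqueness for linear differential equations *)

Section LinearODE.
Context {R : realType}.

Lemma continuous_itv_bounded (f : R -> R) (a b : R) :
  {within `[a, b], continuous f} ->
  exists2 k : R, 0 <= k & forall t, a <= t <= b -> `|f t| <= k.
Proof.
move=> cf; case: (leP a b) => ab; last first.
  by exists 0 => // t /andP[at_ tb]; have := le_trans at_ tb; rewrite leNgt ab.
have cnf : {within `[a, b], continuous (fun x => `|f x|)}.
  by move=> x; apply: continuous_comp; [exact: cf|exact: norm_continuous].
have [c _ hc] := EVT_max ab cnf.
by exists `|f c| => // t tab; apply: hc; rewrite in_itv.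
Qed.

Lemma within_continuous_mx m n (M : R -> 'M[R]_(m, n)) (A : set R) i j :
  {within A, continuous M} -> {within A, continuous (fun t => M t i j)}.
Proof.
move=> cM x.
apply: (@continuous_comp (subspace A) _ _ M (fun N : 'M[R]_(m, n) => N i j)).
  exact: cM.
exact: coord_continuous.
Qed.

(* Gronwall: [expR (2kpt) |Z t|^2] is nondecreasing when [k] bounds the entries
   of [C]. *)
Lemma linear_ode_uniq p q (a b k : R) (C : R -> 'M[R]_p) (Z : R -> 'M[R]_(p, q)) :
  (forall i j, {within `[a, b], continuous (fun t => Z t i j)}) ->
  (forall t, a < t < b -> is_derive t 1 Z (C t *m Z t)) ->
  (forall t i j, a < t < b -> `|C t i j| <= k) ->
  Z b = 0 -> forall t, a <= t <= b -> Z t = 0.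
Proof.
move=> cZ dZ Ck Zb t /[dup] tab /andP[at_ tb].
pose g s := \sum_i \sum_j Z s i j * Z s i j.
pose c := 2 * k * p%:R.
pose h s := expR (c * s) * g s.
have g0 s : 0 <= g s by apply: sumr_ge0 => i _; apply: sumr_ge0 => j _; rewrite -expr2 sqr_ge0.
have dg s : a < s < b -> is_derive s 1 g
    (\sum_i \sum_j ((C s *m Z s) i j * Z s i j + Z s i j * (C s *m Z s) i j)).
  move=> sab; have /is_derive_mxP hZ := dZ _ sab.
  by do 2! (apply: is_derive_sumf => ? _); exact: is_derive_mul.
have dE (s : R) : is_derive s 1 (fun s => expR (c * s)) (expR (c * s) * c).
  have h1 : is_derive s 1 (fun s : R => c * s) c.
    apply: is_derive_eq (is_derive_mul (is_derive_cst c s 1) (is_derive_id s 1)) _.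
    by rewrite mul0r add0r mulr1.
  exact: (is_derive1_comp (is_derive_expR (c * s)) h1).
have dh s (sab : a < s < b) := is_derive_mul (dE s) (dg s sab).
have ch : {within `[a, b], continuous h}.
  move=> x; apply: cvgM.
    have : {within `[a, b], continuous (fun s => expR (c * s))}.
      apply: continuous_subspaceT => s; have [/derivable1_diffP d _] := dE s.
      exact: differentiable_continuous.
    exact.
  apply: cvg_sumf => i _; apply: cvg_sumf => j _.
  by apply: cvgM; exact: cZ.
have hg s : a < s < b -> 0 <= derive1 h s.
  move=> sab; have [_ e] := dh s sab; rewrite derive1E e.
  rewrite -mulrA -mulrDr mulr_ge0 ?expR_ge0//.
  (* Each term 2 z C w is at least -k (z^2 + w^2). Summed over the three indices, each of the two
     squares contributes p |Z|^2, whence the rate 2 k p. *)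
  have : - (c * g s) <= \sum_i \sum_j
     ((C s *m Z s) i j * Z s i j + Z s i j * (C s *m Z s) i j).
    have -> : \sum_i \sum_j
        ((C s *m Z s) i j * Z s i j + Z s i j * (C s *m Z s) i j) =
        \sum_i \sum_j \sum_l 2 * (Z s i j * (C s i l * Z s l j)).
      apply: eq_bigr => i _; apply: eq_bigr => j _.
      by rewrite mxE mulr_suml mulr_sumr -big_split; apply: eq_bigr => l _ /=; ring.
    have -> : - (c * g s) = \sum_i \sum_j \sum_l
         - (k * (Z s i j * Z s i j + Z s l j * Z s l j)).
      have e1 : \sum_(i < p) \sum_(j < q) \sum_(l < p) Z s i j * Z s i j = p%:R * g s.
        rewrite /g mulr_sumr; apply: eq_bigr => i _; rewrite mulr_sumr.
        by apply: eq_bigr => j _; rewrite sumr_const card_ord mulr_natl.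
      have e2 : \sum_(i < p) \sum_(j < q) \sum_(l < p) Z s l j * Z s l j = p%:R * g s.
        by rewrite sumr_const card_ord mulr_natl exchange_big.
      have -> : c * g s = k * (p%:R * g s + p%:R * g s) by rewrite /c; ring.
      rewrite -{1}e1 -e2 -big_split /= mulr_sumr -sumrN; apply: eq_bigr => i _.
      rewrite -big_split /= mulr_sumr -sumrN; apply: eq_bigr => j _.
      by rewrite -big_split /= mulr_sumr -sumrN.
    apply: ler_sum => i _; apply: ler_sum => j _; apply: ler_sum => l _.
    rewrite lerNl; set z := Z s i j; set w := Z s l j.
    apply: le_trans (ler_norm _) _; rewrite normrN !normrM (ger0_norm (ler0n _ 2)).
    have hC := Ck s i l sab.
    have z2 : z * z = `|z| * `|z| by rewrite -expr2 -real_normK ?num_real// expr2.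
    have w2 : w * w = `|w| * `|w| by rewrite -expr2 -real_normK ?num_real// expr2.
    have := normr_ge0 z; have := normr_ge0 w; have := normr_ge0 (C s i l).
    rewrite z2 w2; move: `|z| `|w| `|C s i l| hC => x y d dk d0 y0 x0.
    have : 0 <= (x - y) ^+ 2 by exact: sqr_ge0.
    have : 0 <= (k - d) * (x * y) by rewrite mulr_ge0 ?subr_ge0 ?mulr_ge0.
    have k0 : 0 <= k by exact: le_trans dk.
    move=> h1 h2; have : 0 <= k * (x - y) ^+ 2 by rewrite mulr_ge0.
    nra.
  lra.
have ab : a <= b by exact: le_trans tb.
have : h t <= h b.
  apply: (@ger0_derive1_le_cc _ h a b) => //.
  - by move=> x xab; have [] := dh x xab.
  - by rewrite in_itv /= ab lexx.
have -> : h b = 0.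
  by rewrite /h /g big1 ?mulr0// => i _; rewrite big1// => j _; rewrite Zb mxE mul0r.
move=> ht; have : g t <= 0 by move: ht; rewrite /h pmulr_rle0 ?expR_gt0.
move=> gt0; have {gt0} : g t = 0 by apply/eqP; rewrite eq_le gt0 g0.
move/eqP; rewrite psumr_eq0; last first.
  by move=> i _; apply: sumr_ge0 => j _; rewrite -expr2 sqr_ge0.
move=> /allP gi; apply/matrixP => i j; rewrite mxE.
have := gi i (mem_index_enum i); rewrite /= psumr_eq0; last first.
  by move=> ? _; rewrite -expr2 sqr_ge0.
by move=> /allP/(_ j (mem_index_enum j)) /=; rewrite mulf_eq0 orbb => /eqP.
Qed.

End LinearODE.

(** * Differentiation of the inverse matrix *)

Section MatrixInverse.
Context {R : realType}.

Lemma derivable_sumf (I : Type) (r : seq I) (P : pred I) (f : I -> R -> R) (t : R) :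
  (forall i, P i -> derivable (f i) t 1) ->
  derivable (fun s => \sum_(i <- r | P i) f i s) t 1.
Proof.
move=> h; have [] := @is_derive_sumf _ _ r P f (fun i => 'D_1 (f i) t) t => //.
by move=> i Pi; apply/derivableP; exact: h.
Qed.

Lemma derivable_prodf (I : Type) (r : seq I) (P : pred I) (f : I -> R -> R) (t : R) :
  (forall i, P i -> derivable (f i) t 1) ->
  derivable (fun s => \prod_(i <- r | P i) f i s) t 1.
Proof.
move=> h; elim: r => [|i r IH].
  under eq_fun do rewrite big_nil.
  exact: derivable_cst.
under eq_fun do rewrite big_cons.
by case: ifPn => Pi //; apply: derivableM => //; exact: h.
Qed.

Lemma derivable_det p (X : R -> 'M[R]_p) (t : R) :
  derivable X t 1 -> derivable (fun s => \det (X s)) t 1.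
Proof.
move=> /derivable_mxP dX; apply: derivable_sumf => s _.
apply: derivableM; first exact: derivable_cst.
by apply: derivable_prodf => i _.
Qed.

Lemma derivable_adj p (X : R -> 'M[R]_p) (t : R) :
  derivable X t 1 -> derivable (fun s => \adj (X s)) t 1.
Proof.
move=> /derivable_mxP dX; apply/derivable_mxP => i j.
under eq_fun do rewrite mxE.
apply: derivableM; first exact: derivable_cst.
apply: derivable_det; apply/derivable_mxP => k l.
by under eq_fun do rewrite !mxE; exact: dX.
Qed.

Lemma is_derive_scale m n (f : R -> R) (M : R -> 'M[R]_(m, n)) (t : R) df dM :
  is_derive t 1 f df -> is_derive t 1 M dM ->
  is_derive t 1 (fun s => f s *: M s) (df *: M t + f t *: dM).
Proof.
move=> hf /is_derive_mxP hM; apply/is_derive_mxP => i j.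
under eq_fun do rewrite mxE.
by rewrite !mxE; exact: is_derive_mul.
Qed.

Lemma unitmx_adjE p (A : 'M[R]_p) : A \in unitmx ->
  (\det A)^-1 *: \adj A = invmx A.
Proof. by rewrite /invmx => ->. Qed.

(** The derivatives of det and adj enter only through the relation obtained by differentiating X adj
    X = det X I. Multiplying the claim by the invertible X t on the left reduces it to that
    relation. *)
Lemma is_derive_adj_inv p (X : R -> 'M[R]_p) (t : R) dX :
  is_derive t 1 X dX -> X t \in unitmx ->
  is_derive t 1 (fun s => (\det (X s))^-1 *: \adj (X s))
    (- (invmx (X t) *m dX *m invmx (X t))).
Proof.
move=> [X1 X2] uX.
have dX' : is_derive t 1 X dX by split.
have /derivableP := derivable_det X1; set d' := 'D_1 _ t => hd.
have /derivableP := derivable_adj X1; set a' := 'D_1 _ t => ha.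
have d0 : \det (X t) != 0 by move: uX; rewrite unitmxE unitfE.
have e : dX *m \adj (X t) + X t *m a' = d'%:M.
  have h1 := is_derive_mulmx dX' ha.
  have h2 : is_derive t 1 (fun s => (\det (X s))%:M : 'M[R]_p) d'%:M.
    apply/is_derive_mxP => i j; under eq_fun do rewrite mxE.
    rewrite mxE; case: eqP => _; first by rewrite !mulr1n.
    by rewrite mulr0n; exact: is_derive_cst.
  case: h1 => _ <-; case: h2 => _ <-.
  by congr ('D_1 _ t); apply/funext => s; rewrite mul_mx_adj.
have hi : is_derive t 1 (fun s => (\det (X s))^-1) (- (\det (X t)) ^- 2 *: d').
  exact: is_deriveV d0 hd.
apply: is_derive_eq (is_derive_scale hi ha) _.
apply: (@can_inj _ _ _ _ (mulKmx uX)).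
have -> : X t *m - (invmx (X t) *m dX *m invmx (X t)) = - (dX *m invmx (X t)).
  by rewrite mulmxN !mulmxA mulmxV// mul1mx.
rewrite mulmxDr -!scalemxAr mul_mx_adj.
have -> : X t *m a' = d'%:M - dX *m \adj (X t) by rewrite -e addrAC subrr add0r.
rewrite -(unitmx_adjE uX) -scalemxAr.
move: (\det (X t)) d0 (dX *m \adj (X t)) => x x0 N.
have e1 : (- x ^- 2 *: d') *: x%:M = - (x^-1 * d')%:M :> 'M[R]_p.
  rewrite scale_scalar_mx -raddfN /=; congr _%:M.
  by rewrite /GRing.scale /=; field.
by rewrite e1 scalerBr scale_scalar_mx addKr.
Qed.

End MatrixInverse.

(** * The Hamiltonian flow and the Riccati equation *)

Section Riccati.
Context {R : realType} {p : nat}.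
Implicit Types A B Q QT : 'M[R]_p.

Definition psdmx (M : 'M[R]_p) := forall v : 'cV[R]_p, 0 <= (v^T *m M *m v) 0 0.

(* [Y = Pi X] linearises the Riccati equation [- Pi' = A^T Pi + Pi A - Pi B B^T Pi + Q]. *)
Definition hamiltonian_flow A B Q QT (T : R) (X Y : R -> 'M[R]_p) :=
  [/\ forall t : R, is_derive t 1 X (A *m X t - B *m B^T *m Y t),
      forall t : R, is_derive t 1 Y (- (Q *m X t) - A^T *m Y t),
      X T = 1%:M & Y T = QT].

(** The system is linear and autonomous: the exponential of its block coefficient matrix, centred at
    T, propagates the final data (I, QT). *)
Lemma hamiltonian_flow_exists A B Q QT (T : R) :
  exists X Y, hamiltonian_flow A B Q QT T X Y.
Proof.
pose H := block_mx A (- (B *m B^T)) (- Q) (- A^T).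
pose W (t : R) := mexp H (t - T) *m col_mx 1%:M QT.
have dW (t : R) : is_derive t 1 W (H *m W t).
  rewrite /W mulmxA; apply: is_derive_mulmx_cst; exact: is_derive_mexpB.
have HW t : H *m W t = col_mx (A *m usubmx (W t) - B *m B^T *m dsubmx (W t))
    (- (Q *m usubmx (W t)) - A^T *m dsubmx (W t)).
  by rewrite -{1}[W t]vsubmxK mul_block_col !mulNmx.
exists (fun t => usubmx (W t)), (fun t => dsubmx (W t)); split.
- move=> t; apply/is_derive_mxP => i j; under eq_fun do rewrite mxE.
  have /is_derive_mxP/(_ (lshift p i) j) := dW t.
  by rewrite HW col_mxEu.
- move=> t; apply/is_derive_mxP => i j; under eq_fun do rewrite mxE.
  have /is_derive_mxP/(_ (rshift p i) j) := dW t.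
  by rewrite HW col_mxEd.
- by rewrite /W subrr mexp0 mul1mx col_mxKu.
- by rewrite /W subrr mexp0 mul1mx col_mxKd.
Qed.

Lemma is_derive_continuous (V : normedModType R) (f : R -> V) (t : R) df :
  is_derive t 1 f df -> {for t, continuous f}.
Proof. by move=> [/derivable1_diffP d _]; exact: differentiable_continuous. Qed.

Lemma is_derive_continuous_within (V : normedModType R) (f : R -> V) df (A : set R) :
  (forall t : R, is_derive t 1 f (df t)) -> {within A, continuous f}.
Proof.
by move=> h; apply: continuous_subspaceT => t; exact: is_derive_continuous (h t).
Qed.

Lemma sqnorm_eq0 m (v : 'cV[R]_m) : ((v^T *m v) 0 0 = 0) -> v = 0.
Proof.
rewrite mxE => /eqP; rewrite psumr_eq0; last by move=> i _; rewrite mxE -expr2 sqr_ge0.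
move=> /allP h; apply/matrixP => i j; rewrite ord1 !mxE.
by have := h i (mem_index_enum i); rewrite /= mxE mulf_eq0 orbb => /eqP.
Qed.

Lemma sqnorm_ge0 m (v : 'cV[R]_m) : 0 <= (v^T *m v) 0 0.
Proof. by rewrite mxE sumr_ge0// => i _; rewrite mxE -expr2 sqr_ge0. Qed.

Lemma unitmx_ker m (M : 'M[R]_m) :
  (forall v : 'cV[R]_m, M *m v = 0 -> v = 0) -> M \in unitmx.
Proof.
move=> h; rewrite -unitmx_tr -row_free_unit -kermx_eq0.
apply/eqP/row_matrixP => i; rewrite row0; apply: trmx_inj; rewrite trmx0.
apply: h; apply: trmx_inj; rewrite trmx_mul trmxK trmx0 -row_mul mulmx_ker.
by rewrite row0.
Qed.

Lemma is_derive0_itv (f : R -> R) (a b : R) : a <= b ->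
  {within `[a, b], continuous f} ->
  (forall t : R, a < t < b -> is_derive t 1 f 0) -> f a = f b.
Proof.
move=> ab cf df.
have h (x : R) : x \in `]a, b[ -> is_derive x 1 f 0.
  by rewrite in_itv /=; exact: df.
have [c _] := @MVT_segment _ f (fun=> 0) a b ab h cf.
by rewrite mul0r => /eqP; rewrite subr_eq0 => /eqP.
Qed.

(* If [X t v = 0] then [<Y v, X v>] vanishes at [t], is nonincreasing and is
   nonnegative at [T]; so it is constant on [[t, T]], its derivative
   [- |B^T Y v|^2 - <X v, Q X v>] vanishes, and [X v] solves [x' = A x]. *)
Lemma hamiltonian_flow_unit A B Q QT (T : R) X Y :
  psdmx Q -> psdmx QT -> hamiltonian_flow A B Q QT T X Y ->
  forall t, t <= T -> X t \in unitmx.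
Proof.
move=> Q0 QT0 [dX dY XT YT] t tT; apply: unitmx_ker => v Xv.
pose x s := X s *m v; pose y s := Y s *m v.
have dx (s : R) : is_derive s 1 x (A *m x s - B *m B^T *m y s).
  apply: is_derive_eq; first exact: is_derive_mulmx_cst.
  by rewrite mulmxBl !mulmxA.
have dy (s : R) : is_derive s 1 y (- (Q *m x s) - A^T *m y s).
  apply: is_derive_eq; first exact: is_derive_mulmx_cst.
  by rewrite mulmxBl mulNmx !mulmxA.
pose phi (s : R) : R := ((x s)^T *m y s) 0 0.
pose w s := B^T *m y s.
have dphi (s : R) : is_derive s 1 phi
    (- (((w s)^T *m w s) 0 0 + ((x s)^T *m Q *m x s) 0 0)).
  have h := is_derive_mulmx (is_derive_trmx (dx s)) (dy s).
  have /is_derive_mxP/(_ 0 0) := h.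
  set z := (X in X 0 0); suff -> : z = - ((w s)^T *m w s + (x s)^T *m Q *m x s).
    by rewrite !mxE.
  have e1 : (A *m x s - B *m B^T *m y s)^T = (x s)^T *m A^T - (y s)^T *m B *m B^T.
    by rewrite linearB /= !trmx_mul trmxK mulmxA.
  have e2 : (w s)^T = (y s)^T *m B by rewrite /w trmx_mul trmxK.
  rewrite /z e1 e2 /w mulmxBl mulmxBr mulmxN !mulmxA opprD.
  by rewrite addrACA [X in X + _]addrC addrACA subrr addr0 addrC.
have ddphi s : ((w s)^T *m w s) 0 0 + ((x s)^T *m Q *m x s) 0 0 >= 0.
  by rewrite addr_ge0 ?sqnorm_ge0// Q0.
have cphi (A' : set R) : {within A', continuous phi} by exact: is_derive_continuous_within dphi.
have mono a b : a <= b -> phi b <= phi a.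
  move=> ab; apply: (@ler0_derive1_nincr _ phi a b) => //.
  by move=> s _; rewrite derive1E; have [_ ->] := dphi s; rewrite oppr_le0.
have phit : phi t = 0 by rewrite /phi /x Xv trmx0 mul0mx mxE.
have phiT : 0 <= phi T.
  by rewrite /phi /x /y XT YT mul1mx mulmxA; exact: QT0.
have phi0 s : t <= s <= T -> phi s = 0.
  move=> /andP[ts sT]; apply/eqP; rewrite eq_le -{1}phit mono//=.
  exact: le_trans phiT (mono _ _ sT).
(* [phi] vanishes near an interior s, hence so does its derivative, which is minus a sum of two
   nonnegative terms, one of them |w s|^2. *)
have w0 s : t < s < T -> w s = 0.
  move=> /andP[ts sT]; apply: sqnorm_eq0.
  have nphi : \near s, phi s = cst (0 : R) s.
    near=> r; apply: phi0; apply/andP; split; apply: ltW; near: r.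
      exact: lt_nbhsr.
    exact: lt_nbhsl.
  have := near_eq_derive (1 : R) nphi; rewrite derive_cst; have [_ ->] := dphi s.
  move/eqP; rewrite oppr_eq0 paddr_eq0 ?sqnorm_ge0 ?Q0//.
  by move=> /andP[/eqP].
(* In these moving coordinates the drift A disappears and the derivative is linear in [w], so [z] is
   constant on [t, T]. It vanishes at t, hence at T, where [x] equals v. *)
pose z s := mexp (- A) s *m x s.
have dz (s : R) : is_derive s 1 z (mexp (- A) s *m (- B *m w s)).
  apply: is_derive_eq (is_derive_mulmx (is_derive_mexp (- A) s) (dx s)) _.
  rewrite mexp_comm -(mulmxA _ (- A)) -mulmxDr; congr (_ *m _).
  by rewrite !mulNmx addKr /w !mulmxA.
have zT : z T = 0.
  have <- : z t = z T.
    apply/matrixP => i j; apply: (is_derive0_itv (f := fun s => z s i j)) => //.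
      apply: within_continuous_mx; exact: is_derive_continuous_within dz.
    move=> s sT; have /is_derive_mxP/(_ i j) := dz s.
    by rewrite w0// !mulmx0 mxE.
  by rewrite /z /x Xv mulmx0.
have := congr1 (mulmx (mexp A T)) zT.
by rewrite /z mulmxA mexpVK mul1mx mulmx0 /x XT mul1mx.
Unshelve. all: by end_near. Qed.

(* [Y X^-1], where [X^-1] is written with the adjugate in order to be
   differentiated entry by entry. *)
Definition riccati_sol (X Y : R -> 'M[R]_p) (s : R) :=
  Y s *m ((\det (X s))^-1 *: \adj (X s)).

Lemma riccati_exists A B Q QT (T : R) : psdmx Q -> psdmx QT ->
  exists P, riccati_solution T A B Q QT P.
Proof.
move=> Q0 QT0; have [X [Y F]] := hamiltonian_flow_exists A B Q QT T.
have u := hamiltonian_flow_unit Q0 QT0 F.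
case: F => dX dY XT YT.
(* Valid up to and including T, so continuity on the closed interval is a consequence of
   differentiability. *)
have d (t : R) : t <= T -> is_derive t 1 (riccati_sol X Y)
    (- (A^T *m riccati_sol X Y t + riccati_sol X Y t *m A
     - riccati_sol X Y t *m B *m B^T *m riccati_sol X Y t + Q)).
  move=> tT; have h := is_derive_mulmx (dY t) (is_derive_adj_inv (dX t) (u t tT)).
  apply: is_derive_eq h _.
  have ut := u t tT.
  rewrite /riccati_sol !(unitmx_adjE ut); set V := invmx (X t).
  have XV : X t *m V = 1%:M by exact: mulmxV.
  rewrite mulmxBl (mulmxBr V) (mulmxBl _ _ V) !mulNmx opprB (mulmxBr (Y t)).
  rewrite -!mulmxA XV !mulmx1 !mulmxA.
  move: (A^T *m Y t *m V) (Y t *m V *m A) => M1 M2.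
  move: (_ *m V) => M3.
  by apply/matrixP => i j; rewrite !mxE; ring.
exists (riccati_sol X Y); split.
- apply: continuous_in_subspaceT => t.
  rewrite inE /= in_itv /= => /andP[_ tT]; exact: is_derive_continuous (d t tT).
- by move=> t /andP[_ tT]; exact: d (ltW tT).
- by rewrite /riccati_sol XT YT unitmx_adjE ?unitmx1// invmx1 mulmx1.
Qed.

(* [Y - P X] solves a linear equation and vanishes at [T]. *)
Lemma riccati_hamiltonian A B Q QT (T : R) X Y P :
  hamiltonian_flow A B Q QT T X Y -> riccati_solution T A B Q QT P ->
  forall t, 0 <= t <= T -> Y t = P t *m X t.
Proof.
move=> [dX dY XT YT] [cP dP PT] t tT.
(* Subtracting the derivative of P X from that of Y cancels the terms in Q X and P A X; what remains
   is this matrix applied to Y - P X. *)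
pose C s := - A^T + P s *m B *m B^T.
have [k hk] : exists k, forall s i j, 0 <= s <= T -> `|C s i j| <= k.
  have cC i j : {within `[0, T], continuous (fun s => C s i j)}.
    have -> : (fun s => C s i j) = fun s =>
        - A j i + \sum_l (\sum_r P s i r * B r l) * B j l.
      apply/funext => s; rewrite !mxE; congr (_ + _); apply: eq_bigr => l _.
      by rewrite !mxE.
    move=> s; apply: cvgD; first exact: cvg_cst.
    apply: cvg_sumf => l _; apply: cvgM; last exact: cvg_cst.
    apply: cvg_sumf => r _; apply: cvgM; last exact: cvg_cst.
    have : {within `[0, T], continuous (fun s => P s i r)} by exact: within_continuous_mx.
    exact.
  have h i j := continuous_itv_bounded (cC i j).
  pose K i j := projT1 (cid2 (h i j)).
  have hK i j s : 0 <= s <= T -> `|C s i j| <= K i j.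
    by rewrite /K; case: cid2 => /= r _; exact.
  have K0 i j : 0 <= K i j by rewrite /K; case: cid2.
  exists (\sum_i \sum_j K i j) => s i j /hK; move/(_ i j)/le_trans; apply.
  rewrite (bigD1 i)//= (bigD1 j)//= -addrA lerDl addr_ge0// sumr_ge0// => ? _.
  exact: sumr_ge0.
apply/eqP; rewrite -subr_eq0; apply/eqP.
apply: (@linear_ode_uniq _ _ _ 0 T k C (fun s => Y s - P s *m X s)) => //.
- move=> i j; have cX : {within `[0, T], continuous X} by exact: is_derive_continuous_within dX.
  have cY : {within `[0, T], continuous Y} by exact: is_derive_continuous_within dY.
  have -> : (fun s => (Y s - P s *m X s) i j) = fun s => Y s i j - \sum_l P s i l * X s l j.
    by apply/funext => s; rewrite !mxE.
  move=> s.
  have cYij : {within `[0, T], continuous (fun t => Y t i j)} by exact: within_continuous_mx.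
  apply: cvgB; first exact: cYij.
  apply: cvg_sumf => l _; apply: cvgM.
    have : {within `[0, T], continuous (fun t => P t i l)} by exact: within_continuous_mx.
    exact.
  have : {within `[0, T], continuous (fun t => X t l j)} by exact: within_continuous_mx.
  exact.
- move=> s sT; apply: is_derive_eq.
    exact: is_deriveB (dY s) (is_derive_mulmx (dP s sT) (dX s)).
  rewrite /C !(mulmxDl, mulmxDr, mulNmx, mulmxN) !mulmxA.
  move: (A^T *m Y s) (P s *m A *m X s) (P s *m B *m B^T *m Y s)
    (A^T *m P s *m X s) (P s *m B *m B^T *m P s *m X s) (Q *m X s) => M1 M2 M3 M4 M5 M6.
  by apply/matrixP => k' l; rewrite !mxE; ring.
- by move=> s i j /andP[s0 sT]; apply: hk; rewrite !ltW.
- by rewrite YT PT XT mulmx1 subrr.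
Qed.

End Riccati.

(** * L^2 spaces and graphon operators *)

Section L2Scalar.
Context {R : realType}.
Local Notation mu := (@lebesgue_measure R).
Implicit Types (f g h : R -> R) (k : R).

Lemma measurable_I01 : @measurable _ (measurableTypeR R) I01.
Proof. exact: measurable_itv. Qed.
Hint Resolve measurable_I01 : core.

Lemma mu_I01 : mu (@I01 R) = 1%E.
Proof.
by rewrite /I01 lebesgue_measure_itv /= lte_fin ltr01 oppr0 adde0.
Qed.

Lemma bounded_integrable (D : set R) f (c : R) : @measurable _ (measurableTypeR R) D ->
  (mu D < +oo)%E -> measurable_fun D f -> (forall x, D x -> `|f x| <= c) ->
  mu.-integrable D (EFin \o f).
Proof.
move=> mD Dfin mf fc; apply: measurable_bounded_integrable => //.
exists c; split; first exact: num_real.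
by move=> M cM x /fc /le_trans; apply; exact: ltW.
Qed.

(** Trades the L^2 norm of the function cut off outside [0,1] for measurability and integrability of
    the square on [0,1], the form in which square integrability is handled below. *)
Lemma L2P f : L2 f <->
  measurable_fun I01 f /\ mu.-integrable I01 (EFin \o (fun x => f x ^+ 2)).
Proof.
have e : EFin \o (fun x => (f \_ I01) x ^+ 2) =
    (EFin \o (fun x => f x ^+ 2)) \_ I01.
  apply/funext => x /=; rewrite !patchE; case: ifPn => //.
  by rewrite expr2 mul0r.
split.
- move=> L2f; split.
    move: L2f; rewrite /L2 inE => /andP[+ _]; rewrite inE/=.
    by move/(measurable_restrict f measurable_I01 measurableT); rewrite setTI.
  have := Lfun2_integrable_sqr L2f; rewrite [X in _.-integrable _ X]e.
  by move/(integrable_mkcond (mu := mu) (EFin \o (fun x => f x ^+ 2)) measurable_I01).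
- move=> [mf f2]; rewrite /L2 inE; apply/andP; split; rewrite inE /=.
    by apply/(measurable_restrict f measurable_I01 measurableT); rewrite setTI.
  rewrite /finite_norm unlock /=; apply: poweR_lty.
  move/(integrable_mkcond (mu := mu) (EFin \o (fun x => f x ^+ 2)) measurable_I01) : f2.
  rewrite -e => /integrableP[_].
  apply: le_lt_trans; rewrite le_eqVlt; apply/orP; left; apply/eqP.
  apply: eq_integral => x _; rewrite /=.
  by rewrite powR_mulrn// normrX.
Qed.

Lemma L2_measurable f : L2 f -> measurable_fun I01 f.
Proof. by move=> /L2P[]. Qed.

Lemma L2_mul f g : L2 f -> L2 g -> mu.-integrable I01 (EFin \o (fun x => f x * g x)).
Proof.
move=> /L2P[mf f2] /L2P[mg g2].
have i2 := integrableD measurable_I01 f2 g2.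
refine (@le_integrable _ _ _ mu _ measurable_I01 _ _ _ _ i2).
  by apply/measurable_EFinP; exact: measurable_funM.
move=> x _ /=; rewrite lee_fin.
rewrite [leRHS]ger0_norm ?addr_ge0 ?sqr_ge0//.
rewrite normrM -(real_normK (num_real (f x))) -(real_normK (num_real (g x))).
have := sqr_ge0 (`|f x| - `|g x|); have := normr_ge0 (f x); have := normr_ge0 (g x).
by nra.
Qed.

Lemma L2_ext f g : (forall x, I01 x -> f x = g x) -> L2 f -> L2 g.
Proof.
move=> e; rewrite /L2 (_ : g \_ I01 = f \_ I01)//.
by apply/funext => x; rewrite !patchE; case: ifPn => // /set_mem /e.
Qed.

Lemma L2_0 : L2 (fun=> 0 : R).
Proof.
apply/L2P; split; first exact: measurable_cst.
by under eq_fun do rewrite expr0n /=; exact: integrable0.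
Qed.

Lemma L2_lin k f g : L2 f -> L2 g -> L2 (fun x => k * f x + g x).
Proof.
move=> Lf Lg; have [mf f2] := (L2P f).1 Lf; have [mg g2] := (L2P g).1 Lg.
apply/L2P; split.
  by apply: measurable_funD => //; apply: measurable_funM => //; exact: measurable_cst.
have h := integrableD measurable_I01 (integrableD measurable_I01
  (integrableZl measurable_I01 (k ^+ 2) f2)
  (integrableZl measurable_I01 (2 * k) (L2_mul Lf Lg))) g2.
apply: eq_integrable h => // x _ /=.
by rewrite -!EFinM -!EFinD; congr EFin; ring.
Qed.

Lemma L2Z k f : L2 f -> L2 (fun x => k * f x).
Proof. by move=> Lf; apply: L2_ext (L2_lin k Lf L2_0) => x _; rewrite addr0. Qed.

Lemma L2D f g : L2 f -> L2 g -> L2 (fun x => f x + g x).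
Proof. by move=> Lf Lg; apply: L2_ext (L2_lin 1 Lf Lg) => x _; rewrite mul1r. Qed.

Lemma L2_sum (I : Type) (r : seq I) (P : pred I) (F : I -> R -> R) :
  (forall i, P i -> L2 (F i)) -> L2 (fun x => \sum_(i <- r | P i) F i x).
Proof.
move=> h; elim: r => [|i r IH].
  by under eq_fun do rewrite big_nil; exact: L2_0.
under eq_fun do rewrite big_cons.
by case Pi: (P i) => //; apply: L2D => //; exact: h.
Qed.

Lemma L2_bounded f c : measurable_fun I01 f -> (forall x, I01 x -> `|f x| <= c) -> L2 f.
Proof.
move=> mf fc; apply/L2P; split => //.
apply: (@bounded_integrable _ _ (c ^+ 2)) => //.
- by rewrite mu_I01 ltry.
- exact: measurable_funX.
move=> x Ix /=; rewrite normrX.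
by rewrite lerXn2r ?nnegrE// ?fc// (le_trans _ (fc _ Ix)).
Qed.

Lemma ipC f g : ip f g = ip g f.
Proof. by apply: eq_Rintegral => x _; rewrite mulrC. Qed.

Lemma ip_linl k f g h : L2 f -> L2 g -> L2 h ->
  ip (fun x => k * f x + g x) h = k * ip f h + ip g h.
Proof.
move=> Lf Lg Lh; rewrite /ip.
rewrite -(RintegralZl k measurable_I01 (L2_mul Lf Lh)).
rewrite -RintegralD//; last exact: L2_mul.
  by apply: eq_Rintegral => x _; ring.
exact: integrableZl (L2_mul Lf Lh).
Qed.

Lemma ip_ae f g h : L2 f -> L2 g -> L2 h -> eqL2 f g -> ip f h = ip g h.
Proof.
move=> /L2_measurable mf /L2_measurable mg /L2_measurable mh fg.
rewrite /ip /Rintegral; congr fine; apply: ae_eq_integral => //.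
- by apply/measurable_EFinP; exact: measurable_funM.
- by apply/measurable_EFinP; exact: measurable_funM.
- by apply: filterS fg => x + Ix => ->.
Qed.

Lemma ip_ext f f' g g' : (forall x, I01 x -> f x = f' x) ->
  (forall x, I01 x -> g x = g' x) -> ip f g = ip f' g'.
Proof. by move=> ef eg; apply: eq_Rintegral => x /set_mem Ix; rewrite ef ?eg. Qed.

Lemma ip_ge0 f : 0 <= ip f f.
Proof. by apply: Rintegral_ge0 => x _; rewrite -expr2 sqr_ge0. Qed.

Lemma ip_eq0 f : L2 f -> ip f f = 0 -> eqL2 f (fun=> 0).
Proof.
move=> Lf; have mf := L2_measurable Lf; have i2 := L2_mul Lf Lf.
rewrite /ip /Rintegral => /eqP; rewrite fine_eq0; last exact: integrable_fin_num.
move=> /eqP h.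
have : ae_eq mu I01 (EFin \o (fun x => f x * f x)) (cst 0%E).
  apply/(ae_eq_integral_abs mu measurable_I01); first exact: measurable_int i2.
  rewrite -[RHS]h; apply: eq_integral => x _ /=.
  by rewrite ger0_norm// -expr2 sqr_ge0.
apply: filterS => x + Ix => /(_ Ix)/= [] /eqP; rewrite mulf_eq0 orbb.
by move=> /eqP.
Qed.

End L2Scalar.
#[global] Hint Resolve measurable_I01 : core.

#[global] Instance ae_nbhs_filter (R : realType) :
  Filter (nbhs (almost_everywhere (@lebesgue_measure R))).
Proof. exact: (ae_filter_ringOfSetsType (@lebesgue_measure R)). Qed.

Section EqL2.
Context {R : realType} {V : Type}.
Implicit Types u v w : R -> V.

Lemma eqL2_refl u : eqL2 u u.
Proof. by apply: nearW. Qed.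

Lemma eqL2_pt u v : (forall x, I01 x -> u x = v x) -> eqL2 u v.
Proof. by move=> h; apply: nearW => x /h. Qed.

Lemma eqL2_sym u v : eqL2 u v -> eqL2 v u.
Proof. by apply: filterS => x h /h. Qed.

Lemma eqL2_trans u v w : eqL2 u v -> eqL2 v w -> eqL2 u w.
Proof. by apply: filterS2 => x h1 h2 Ix; rewrite h1// h2. Qed.

Lemma eqL2_comp (W : Type) (j : R -> V -> W) u v :
  eqL2 u v -> eqL2 (fun x => j x (u x)) (fun x => j x (v x)).
Proof. by apply: filterS => x h Ix; rewrite h. Qed.

Lemma eqL2_comp2 (V' W : Type) (j : R -> V -> V' -> W) u v (u' v' : R -> V') :
  eqL2 u v -> eqL2 u' v' ->
  eqL2 (fun x => j x (u x) (u' x)) (fun x => j x (v x) (v' x)).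
Proof. by apply: filterS2 => x h1 h2 Ix; rewrite h1// h2. Qed.

(** A finite union of null sets is null, so one exceptional set serves all indices. *)
Lemma eqL2_all (I : finType) (W : Type) (f g : I -> R -> W) :
  (forall i, eqL2 (f i) (g i)) ->
  {ae @lebesgue_measure R, forall x, I01 x -> forall i, f i x = g i x}.
Proof.
move=> h; have H : \forall x \near almost_everywhere (@lebesgue_measure R),
    forall i, I01 x -> f i x = g i x.
  by apply: filter_forall => i; exact: h.
by apply: filterS H => x hx Ix i; exact: hx.
Qed.

End EqL2.

Section L2Vector.
Context {R : realType} {n : nat}.
Local Notation mu := (@lebesgue_measure R).
Implicit Types (u v w : R -> 'cV[R]_n) (k : R).

Lemma coordf_lin k u v i :
  coordf (k *: u + v) i = fun a => k * coordf u i a + coordf v i a.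
Proof. by apply/funext => a; rewrite /coordf !mxE. Qed.

Lemma L2n_lin k u v : L2n u -> L2n v -> L2n (k *: u + v).
Proof. by move=> Lu Lv i; rewrite coordf_lin; exact: L2_lin. Qed.

Lemma L2n0 : L2n (0 : R -> 'cV[R]_n).
Proof. by move=> i; apply: L2_ext L2_0 => x _; rewrite /coordf mxE. Qed.

Lemma L2nD u v : L2n u -> L2n v -> L2n (u + v).
Proof. by move=> Lu Lv; rewrite -[u]scale1r; exact: L2n_lin. Qed.

Lemma L2nZ k u : L2n u -> L2n (k *: u).
Proof. by move=> Lu; rewrite -[X in L2n X]addr0; apply: L2n_lin => //; exact: L2n0. Qed.

Lemma L2nN u : L2n u -> L2n (- u).
Proof. by move=> Lu; rewrite -scaleN1r; exact: L2nZ. Qed.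

Lemma L2nB u v : L2n u -> L2n v -> L2n (u - v).
Proof. by move=> Lu Lv; apply: L2nD => //; exact: L2nN. Qed.

Lemma L2n_sum (I : Type) (r : seq I) (P : pred I) (F : I -> R -> 'cV[R]_n) :
  (forall i, P i -> L2n (F i)) -> L2n (\sum_(i <- r | P i) F i).
Proof. by move=> h; elim/big_ind : _ => //; [exact: L2n0|exact: L2nD]. Qed.

Lemma ipnC u v : ipn u v = ipn v u.
Proof. by apply: eq_bigr => i _; exact: ipC. Qed.

Lemma ipn_linl k u v w : L2n u -> L2n v -> L2n w ->
  ipn (k *: u + v) w = k * ipn u w + ipn v w.
Proof.
move=> Lu Lv Lw; rewrite /ipn mulr_sumr -big_split; apply: eq_bigr => i _ /=.
by rewrite coordf_lin ip_linl.
Qed.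

Lemma ipnDl u v w : L2n u -> L2n v -> L2n w -> ipn (u + v) w = ipn u w + ipn v w.
Proof. by move=> Lu Lv Lw; rewrite -{1}[u]scale1r ipn_linl// mul1r. Qed.

Lemma ipn0l w : ipn (0 : R -> 'cV[R]_n) w = 0.
Proof.
rewrite /ipn big1// => i _; rewrite /ip -[RHS](Rintegral_set0 mu (fun=> 0)).
rewrite Rintegral_mkcond [RHS]Rintegral_mkcond.
by apply: eq_Rintegral => x _; rewrite !patchE /coordf mxE mul0r; case: ifP; case: ifP.
Qed.

Lemma ipnZl k u w : L2n u -> L2n w -> ipn (k *: u) w = k * ipn u w.
Proof.
move=> Lu Lw; rewrite -[k *: u]addr0 ipn_linl//; last exact: L2n0.
by rewrite ipn0l addr0.
Qed.

Lemma ipnNl u w : L2n u -> L2n w -> ipn (- u) w = - ipn u w.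
Proof. by move=> Lu Lw; rewrite -scaleN1r ipnZl// mulN1r. Qed.

Lemma ipnBl u v w : L2n u -> L2n v -> L2n w -> ipn (u - v) w = ipn u w - ipn v w.
Proof. by move=> Lu Lv Lw; rewrite ipnDl ?ipnNl//; exact: L2nN. Qed.

Lemma ipn_suml (I : Type) (r : seq I) (P : pred I) (F : I -> R -> 'cV[R]_n) w :
  (forall i, P i -> L2n (F i)) -> L2n w ->
  ipn (\sum_(i <- r | P i) F i) w = \sum_(i <- r | P i) ipn (F i) w.
Proof.
move=> LF Lw.
have [] : L2n (\sum_(i <- r | P i) F i) /\
  ipn (\sum_(i <- r | P i) F i) w = \sum_(i <- r | P i) ipn (F i) w; last by [].
elim: r => [|i r [Lr IH]]; first by rewrite !big_nil ipn0l; split => //; exact: L2n0.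
rewrite !big_cons; case: ifPn => Pi //; split; first by apply: L2nD => //; exact: LF.
by rewrite ipnDl ?IH//; exact: LF.
Qed.

Lemma ipnDr u v w : L2n u -> L2n v -> L2n w -> ipn w (u + v) = ipn w u + ipn w v.
Proof. by move=> *; rewrite ipnC ipnDl// ![ipn _ w]ipnC. Qed.

Lemma ipnZr k u w : L2n u -> L2n w -> ipn w (k *: u) = k * ipn w u.
Proof. by move=> *; rewrite ipnC ipnZl// ipnC. Qed.

Lemma ipnNr u w : L2n u -> L2n w -> ipn w (- u) = - ipn w u.
Proof. by move=> *; rewrite ipnC ipnNl// ipnC. Qed.

Lemma ipnBr u v w : L2n u -> L2n v -> L2n w -> ipn w (u - v) = ipn w u - ipn w v.
Proof. by move=> *; rewrite ipnC ipnBl// ![ipn _ w]ipnC. Qed.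

Lemma ipn_sumr (I : Type) (r : seq I) (P : pred I) (F : I -> R -> 'cV[R]_n) w :
  (forall i, P i -> L2n (F i)) -> L2n w ->
  ipn w (\sum_(i <- r | P i) F i) = \sum_(i <- r | P i) ipn w (F i).
Proof. by move=> *; rewrite ipnC ipn_suml//; apply: eq_bigr => i _; rewrite ipnC. Qed.

Lemma eqL2_coordf u v i : eqL2 u v -> eqL2 (coordf u i) (coordf v i).
Proof. exact: (eqL2_comp (fun _ (z : 'cV[R]_n) => z i 0)). Qed.

Lemma coordf_eqL2 u v : (forall i, eqL2 (coordf u i) (coordf v i)) -> eqL2 u v.
Proof.
move=> /eqL2_all; apply: filterS => x h Ix.
by apply/matrixP => i j; rewrite ord1; exact: h.
Qed.

Lemma ipn_ae u u' v v' : L2n u -> L2n u' -> L2n v -> L2n v' ->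
  eqL2 u u' -> eqL2 v v' -> ipn u v = ipn u' v'.
Proof.
move=> Lu Lu' Lv Lv' eu ev; apply: eq_bigr => i _.
rewrite (ip_ae (Lu i) (Lu' i) (Lv i) (eqL2_coordf i eu)) ipC.
by rewrite (ip_ae (Lv i) (Lv' i) (Lu' i) (eqL2_coordf i ev)) ipC.
Qed.

Lemma ipn_ge0 u : 0 <= ipn u u.
Proof. by apply: sumr_ge0 => i _; exact: ip_ge0. Qed.

Lemma ipn_eq0 u : L2n u -> ipn u u = 0 -> eqL2 u 0.
Proof.
move=> Lu /eqP; rewrite psumr_eq0; last by move=> i _; exact: ip_ge0.
move=> /allP h; apply: coordf_eqL2 => i.
have -> : coordf (0 : R -> 'cV[R]_n) i = fun=> 0 by apply/funext => x; rewrite /coordf mxE.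
apply: ip_eq0 => //; apply/eqP; exact: (h i (mem_index_enum i)).
Qed.

Lemma normn_ge0 u : 0 <= normn u.
Proof. exact: sqrtr_ge0. Qed.

Lemma sqr_normn u : normn u ^+ 2 = ipn u u.
Proof. by rewrite sqr_sqrtr// ipn_ge0. Qed.

Lemma normn_ae u v : L2n u -> L2n v -> eqL2 u v -> normn u = normn v.
Proof. by move=> Lu Lv e; rewrite /normn (ipn_ae Lu Lv Lu Lv e e). Qed.

Lemma normn_eq0 u : L2n u -> normn u = 0 -> eqL2 u 0.
Proof. by move=> Lu h; apply: ipn_eq0 => //; rewrite -sqr_normn h expr0n. Qed.

Lemma normn0 : normn (0 : R -> 'cV[R]_n) = 0.
Proof. by rewrite /normn ipn0l sqrtr0. Qed.

Lemma normnZ k u : L2n u -> normn (k *: u) = `|k| * normn u.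
Proof.
move=> Lu; rewrite /normn ipnZl ?ipnZr//; last exact: L2nZ.
by rewrite mulrA -expr2 sqrtrM ?sqr_ge0// sqrtr_sqr.
Qed.

Lemma normnN u : L2n u -> normn (- u) = normn u.
Proof. by move=> Lu; rewrite -scaleN1r normnZ// normrN1 mul1r. Qed.

Lemma cauchy_schwarz u v : L2n u -> L2n v -> `|ipn u v| <= normn u * normn v.
Proof.
move=> Lu Lv.
have q k : 0 <= k ^+ 2 * ipn u u + 2 * k * ipn u v + ipn v v.
  have := ipn_ge0 (k *: u + v).
  rewrite ipn_linl//; last exact: L2n_lin.
  rewrite ![ipn _ (k *: u + v)]ipnC !ipn_linl// (ipnC v u).
  by congr (_ <= _); ring.
have a0 := ipn_ge0 u; have c0 := ipn_ge0 v.
rewrite /normn -sqrtrM// -sqrtr_sqr ler_wsqrtr//.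
move: (ipn u u) (ipn u v) (ipn v v) q a0 c0 => a b c q a0 c0.
have [a1|a1] := eqVneq a 0.
  have [->|b0] := eqVneq b 0; first by rewrite expr0n mulr_ge0.
  (* With a = 0 the quadratic is affine in k, and this k gives it the value -1. *)
  have := q (- (c + 1) / (2 * b)); rewrite a1 mulr0 add0r.
  have -> : 2 * (- (c + 1) / (2 * b)) * b = - (c + 1) by field.
  by move=> ?; exfalso; lra.
have a2 : 0 < a by rewrite lt_def a1.
(* The minimizer of the quadratic, where its value is (ac - b^2)/a. *)
have := q (- b / a).
have -> : (- b / a) ^+ 2 * a + 2 * (- b / a) * b + c = (a * c - b ^+ 2) / a by field.
by rewrite pmulr_lge0 ?invr_gt0// subr_ge0.
Qed.

Lemma normnD u v : L2n u -> L2n v -> normn (u + v) <= normn u + normn v.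
Proof.
move=> Lu Lv; rewrite -ler_sqr ?nnegrE ?addr_ge0 ?normn_ge0//.
rewrite sqr_normn ipnDl ?ipnDr//; last exact: L2nD.
rewrite sqrrD !sqr_normn (ipnC v u).
have := le_trans (ler_norm _) (cauchy_schwarz Lu Lv).
by rewrite mulr2n; lra.
Qed.

Lemma normnB u v : L2n u -> L2n v -> normn (u - v) <= normn u + normn v.
Proof. by move=> Lu Lv; rewrite -(normnN Lv); apply: normnD => //; exact: L2nN. Qed.

Lemma normn_sum (I : Type) (r : seq I) (P : pred I) (F : I -> R -> 'cV[R]_n) :
  (forall i, P i -> L2n (F i)) ->
  normn (\sum_(i <- r | P i) F i) <= \sum_(i <- r | P i) normn (F i).
Proof.
move=> LF.
have [] : L2n (\sum_(i <- r | P i) F i) /\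
  normn (\sum_(i <- r | P i) F i) <= \sum_(i <- r | P i) normn (F i); last by [].
elim: r => [|i r [Lr IH]]; first by rewrite !big_nil normn0; split => //; exact: L2n0.
rewrite !big_cons; case: ifPn => Pi //; split; first by apply: L2nD => //; exact: LF.
by rewrite (le_trans (normnD (LF _ Pi) Lr))// lerD2l.
Qed.

Lemma ler_normn_dist u v : L2n u -> L2n v -> `|normn u - normn v| <= normn (u - v).
Proof.
move=> Lu Lv; have Luv := L2nB Lu Lv.
have h1 := normnD Luv Lv; have h2 := normnD (L2nN Luv) Lu.
move: h1 h2; rewrite subrK normnN// opprB subrK => h1 h2.
by rewrite ler_norml; apply/andP; split; lra.
Qed.

End L2Vector.

(** * Fubini's theorem for bounded kernels *)

Section KernelFubini.
Context {R : realType}.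
Local Notation mu := (@lebesgue_measure R).
Local Notation TR := (measurableTypeR R).

Lemma measurable_prod_mk (k : TR * TR -> R) (f g : TR -> R) :
  measurable_fun setT k -> measurable_fun setT f -> measurable_fun setT g ->
  measurable_fun [set: TR * TR] (fun z => f z.1 * k z * g z.2).
Proof.
move=> mk mf mg; apply: measurable_funM; last first.
  exact: (measurableT_comp mg measurable_snd).
apply: measurable_funM => //.
exact: (measurableT_comp mf measurable_fst).
Qed.

Lemma measurable_patch (D : set TR) (f : TR -> R) :
  measurable D -> measurable_fun D f -> measurable_fun setT (f \_ D).
Proof.
by move=> mD mf; apply/(measurable_restrict f mD measurableT); rewrite setTI.
Qed.

(** The integral is [fine] of a difference of two nonnegative integrals, each measurable in x by
    Tonelli; points where one of them is infinite are thereby covered. *)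
Lemma measurable_kernel_int (k : TR * TR -> R) (E : set TR) (g : TR -> R) :
  measurable E -> measurable_fun setT k -> measurable_fun E g ->
  measurable_fun setT (fun x : TR => \int[mu]_(y in E) (k (x, y) * g y)).
Proof.
move=> mE mk mg.
have mG : measurable_fun [set: TR * TR] (fun z => (cst 1 z.1 * k z * (g \_ E) z.2)%:E).
  by apply/measurable_EFinP; apply: measurable_prod_mk => //; exact: measurable_patch.
set G := (fun z => _%:E) in mG.
have -> : (fun x : TR => \int[mu]_(y in E) (k (x, y) * g y)) =
    fine \o (fun x => (fubini_F mu G^\+ x - fubini_F mu G^\- x)%E).
  apply/funext => x; rewrite /= /Rintegral; congr fine.
  rewrite integral_mkcond integralE /fubini_F; congr (_ - _)%E.
    apply: eq_integral => y _; rewrite !funeposE /G /=.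
    by congr maxe; rewrite !patchE; case: ifPn => _; rewrite ?mulr0// mul1r.
  apply: eq_integral => y _; rewrite !funenegE /G /=.
  by congr maxe; rewrite !patchE; case: ifPn => _; rewrite ?mulr0// mul1r.
apply: measurableT_comp => //; apply: emeasurable_funB.
  apply: measurable_fun_fubini_tonelli_F => //.
  exact: measurable_funepos.
apply: measurable_fun_fubini_tonelli_F => //.
exact: measurable_funeneg.
Qed.

(** Extended by zero, the integrand on the plane is dominated by c |f| |g|. The lemma is applied to
    graphons, for the symmetry of their operators, and to the indicator of the triangle s <= t, for
    integration by parts. *)
Lemma kernel_fubini (k : TR * TR -> R) (c : R) (D E : set TR) (f g : TR -> R) :
  measurable D -> measurable E -> measurable_fun setT k ->
  (forall z, `|k z| <= c) ->
  mu.-integrable D (EFin \o f) -> mu.-integrable E (EFin \o g) ->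
  \int[mu]_(x in D) (f x * \int[mu]_(y in E) (k (x, y) * g y)) =
  \int[mu]_(y in E) (g y * \int[mu]_(x in D) (k (x, y) * f x)).
Proof.
move=> mD mE mk kc fi gi.
have mf : measurable_fun D f by apply/measurable_EFinP; exact: measurable_int fi.
have mg : measurable_fun E g by apply/measurable_EFinP; exact: measurable_int gi.
pose F (z : TR * TR) : \bar R := ((f \_ D) z.1 * k z * (g \_ E) z.2)%:E.
have mF : measurable_fun setT F.
  by apply/measurable_EFinP; apply: measurable_prod_mk => //; exact: measurable_patch.
have kgi x : mu.-integrable E (EFin \o (fun y => k (x, y) * g y)).
  have ci := integrableZl mE c gi.
  apply: (le_integrable mE _ _ ci).
    apply/measurable_EFinP; apply: measurable_funM => //.
    apply: measurable_funTS; exact: measurable_fun_pair2.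
  move=> y _ /=; rewrite lee_fin !normrM ler_wpM2r//.
  exact: le_trans (kc _) (ler_norm _).
have kfi y : mu.-integrable D (EFin \o (fun x => k (x, y) * f x)).
  have ci := integrableZl mD c fi.
  apply: (le_integrable mD _ _ ci).
    apply/measurable_EFinP; apply: measurable_funM => //.
    apply: measurable_funTS; exact: measurable_fun_pair1.
  move=> x _ /=; rewrite lee_fin !normrM ler_wpM2r//.
  exact: le_trans (kc _) (ler_norm _).
have Fi : (mu \x mu)%E.-integrable setT F.
  apply/(integrable12ltyP _ _ mF).
  have fDi : mu.-integrable setT (EFin \o (f \_ D)).
    have /(integrable_mkcond (mu := mu) _ mD) := fi.
    by rewrite restrict_EFin.
  have gEi : mu.-integrable setT (EFin \o (g \_ E)).
    have /(integrable_mkcond (mu := mu) _ mE) := gi.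
    by rewrite restrict_EFin.
  have /integrableP[mfD fDy] := fDi; have /integrableP[mgE gEy] := gEi.
  pose Mg := (\int[mu]_y `|(g \_ E) y|%:E)%E.
  have c0 : 0 <= c by apply: le_trans (kc (0, 0)).
  have Mg_ge0 : (0 <= Mg)%E by apply: integral_ge0 => y _; rewrite lee_fin.
  have Mg_fin : Mg \is a fin_num by rewrite ge0_fin_numE.
  have mgA : measurable_fun setT (fun y : TR => `|(g \_ E) y|%:E).
    by apply/measurable_EFinP; apply: measurableT_comp => //; exact: measurable_patch.
  have mfA : measurable_fun setT (fun y : TR => `|(f \_ D) y|%:E).
    by apply/measurable_EFinP; apply: measurableT_comp => //; exact: measurable_patch.
  have mAF : measurable_fun setT (fun z => `|F z|%E) by exact: measurableT_comp.
  have mFx x : measurable_fun setT (fun y : TR => `|F (x, y)|%E).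
    exact: (measurable_fun_pair2 x mAF).
  have le1 x : (\int[mu]_y `|F (x, y)| <= (c * fine Mg)%:E * `|(f \_ D) x|%:E)%E.
    apply: (@le_trans _ _ (\int[mu]_y ((c * `|(f \_ D) x|)%:E * `|(g \_ E) y|%:E))%E).
      apply: ge0_le_integral => //; first exact: measurable_funeM.
      move=> y _; rewrite /F /= -EFinM lee_fin !normrM ler_wpM2r// mulrC ler_wpM2r//.
    rewrite ge0_integralZl//; last by rewrite lee_fin mulr_ge0.
    by rewrite -/Mg -(fineK Mg_fin) -!EFinM lee_fin /= mulrAC.
  apply: (@le_lt_trans _ _ (\int[mu]_x ((c * fine Mg)%:E * `|(f \_ D) x|%:E))%E).
    apply: ge0_le_integral => //.
    - by move=> x _; exact: integral_ge0.
    - exact: (measurable_fun_fubini_tonelli_F (fun z => `|F z|%E)).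
    - exact: measurable_funeM.
  rewrite ge0_integralZl//; last by rewrite lee_fin mulr_ge0 ?fine_ge0.
  by apply: lte_mul_pinfty => //; rewrite lee_fin mulr_ge0 ?fine_ge0.
have e1 : (\int[mu]_x \int[mu]_y F (x, y))%E =
    (\int[mu]_(x in D) (f x * \int[mu]_(y in E) (k (x, y) * g y))%:E)%E.
  rewrite [RHS]integral_mkcond; apply: eq_integral => x _; rewrite !patchE.
  rewrite /F /=; case: ifPn => xD; last first.
    rewrite integral0_eq// => y _; rewrite patchE (negbTE xD).
    by rewrite !mul0r.
  rewrite EFinM fineK; last exact: integrable_fin_num (kgi x).
  rewrite -integralZl//; last exact: (kgi x).
  rewrite [RHS]integral_mkcond; apply: eq_integral => y _; rewrite !patchE xD.
  by case: ifPn => _; rewrite ?mulr0// -EFinM mulrA.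
have e2 : (\int[mu]_y \int[mu]_x F (x, y))%E =
    (\int[mu]_(y in E) (g y * \int[mu]_(x in D) (k (x, y) * f x))%:E)%E.
  rewrite [RHS]integral_mkcond; apply: eq_integral => y _; rewrite !patchE.
  rewrite /F /=; case: ifPn => yE; last first.
    rewrite integral0_eq// => z _; rewrite [(g \_ E) y]patchE (negbTE yE).
    by rewrite !mulr0.
  rewrite EFinM fineK; last exact: integrable_fin_num (kfi y).
  rewrite -integralZl//; last exact: (kfi y).
  rewrite [RHS]integral_mkcond; apply: eq_integral => z _; rewrite !patchE yE.
  by case: ifPn => _; rewrite ?mul0r// -EFinM; congr EFin; ring.
exact: (congr1 fine (etrans (esym e1) (etrans (Fubini Fi) e2))).
Qed.

End KernelFubini.

Section GraphonOperator.
Context {R : realType}.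
Local Notation mu := (@lebesgue_measure R).
Local Notation TR := (measurableTypeR R).
Implicit Types (u v w : R -> R) (k : R).

Lemma ip_linr k u v w : L2 u -> L2 v -> L2 w ->
  ip w (fun x => k * u x + v x) = k * ip w u + ip w v.
Proof. by move=> *; rewrite ipC ip_linl// ![ip _ w]ipC. Qed.

Lemma ip0l v : ip (fun=> 0) v = 0.
Proof.
by rewrite /ip; under eq_Rintegral do rewrite mul0r; rewrite /Rintegral integral0.
Qed.

Lemma ipZl k u w : L2 u -> L2 w -> ip (fun x => k * u x) w = k * ip u w.
Proof.
move=> Lu Lw; rewrite -[RHS]addr0 -(ip0l w) -ip_linl//; last exact: L2_0.
by apply: ip_ext => // x _; rewrite addr0.
Qed.

Lemma ipDl u v w : L2 u -> L2 v -> L2 w -> ip (fun x => u x + v x) w = ip u w + ip v w.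
Proof.
move=> Lu Lv Lw; rewrite -(mul1r (ip u w)) -ip_linl//.
by apply: ip_ext => // x _; rewrite mul1r.
Qed.

Lemma ip_suml (I : Type) (r : seq I) (P : pred I) (F : I -> R -> R) w :
  (forall i, P i -> L2 (F i)) -> L2 w ->
  ip (fun x => \sum_(i <- r | P i) F i x) w = \sum_(i <- r | P i) ip (F i) w.
Proof.
move=> LF Lw; elim: r => [|i r IH].
  by rewrite big_nil -[RHS](ip0l w); apply: ip_ext => // x _; rewrite big_nil.
rewrite big_cons; case Pi : (P i); last first.
  by rewrite -IH; apply: ip_ext => // x _; rewrite big_cons Pi.
rewrite -IH -ipDl//; [|exact: LF|exact: L2_sum].
by apply: ip_ext => // x _; rewrite big_cons Pi.
Qed.

Variables (c : R) (A : R * R -> R).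
Hypothesis gA : graphon c A.

(** Extended by zero off the unit square, the kernel is measurable and bounded on the whole plane,
    as Fubini's theorem above asks, and defines the same operator on [0,1]. *)
Let kA : R * R -> R := A \_ (I01 `*` I01).

Let kAE a b : I01 a -> I01 b -> kA (a, b) = A (a, b).
Proof. by move=> Ia Ib; rewrite /kA patchE ifT// inE. Qed.

Let mkA : @measurable_fun _ _ (TR * TR)%type TR setT kA.
Proof.
case: gA => mA _ _.
have mI : measurable ((I01 : set TR) `*` (I01 : set TR)) by exact: measurableX.
by apply/(measurable_restrict A mI measurableT); rewrite setTI; exact: mA.
Qed.

Let kA_le z : `|kA z| <= `|c|.
Proof.
rewrite /kA patchE; case: ifPn => [|_]; last by rewrite normr0.
case: z => a b; rewrite inE => -[/= Ia Ib].
case: gA => _ _ /(_ a b Ia Ib) cA.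
have c0 : 0 <= c by case/andP: cA => h1 h2; lra.
by rewrite ler_norml (ger0_norm c0).
Qed.

Let gopE v a : I01 a -> gop A v a = \int[mu]_(b in I01) (kA (a, b) * v b).
Proof. by move=> Ia; apply: eq_Rintegral => b /set_mem Ib; rewrite kAE. Qed.

Let L2_kA a : I01 a -> L2 (fun b => kA (a, b)).
Proof.
move=> Ia; apply: (@L2_bounded _ _ `|c|) => [|b _]; last exact: kA_le.
exact: (measurable_funTS (measurable_fun_pair2 (a : TR) mkA)).
Qed.

(** The image is bounded on [0,1] by |c| times the L^1 norm of v, which is finite because the
    constant 1 is in L^2. *)
Lemma L2_gop v : L2 v -> L2 (gop A v).
Proof.
move=> Lv; apply: L2_ext (_ : L2 (fun a => \int[mu]_(b in I01) (kA (a, b) * v b))).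
  by move=> a Ia; rewrite gopE.
have iv : mu.-integrable I01 (EFin \o v).
  have L1 : L2 (fun=> 1 : R).
    by apply: (@L2_bounded _ _ 1) => // x _; rewrite normr1.
  by have := L2_mul Lv L1; under eq_fun do rewrite mulr1.
apply: (@L2_bounded _ _ (`|c| * \int[mu]_(b in I01) `|v b|)).
  apply: measurable_funTS; apply: measurable_kernel_int => //.
  exact: L2_measurable.
move=> a Ia; have ikv := L2_mul (L2_kA Ia) Lv.
rewrite (le_trans (le_normr_Rintegral _ ikv))// -RintegralZl//; last first.
  exact: integrable_norm.
apply: le_Rintegral => //.
- exact: integrable_norm.
- exact: (integrableZl measurable_I01 `|c| (integrable_norm iv)).
- by move=> b _; rewrite normrM ler_wpM2r.
Qed.

Lemma gop_ip v a : I01 a -> gop A v a = ip (fun b => kA (a, b)) v.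
Proof. exact: gopE. Qed.

Lemma gop_lin k u v a : L2 u -> L2 v -> I01 a ->
  gop A (fun x => k * u x + v x) a = k * gop A u a + gop A v a.
Proof. by move=> Lu Lv Ia; rewrite !gop_ip// ip_linr//; exact: L2_kA. Qed.

Lemma gop_ae u v a : L2 u -> L2 v -> eqL2 u v -> I01 a -> gop A u a = gop A v a.
Proof.
by move=> Lu Lv e Ia; rewrite !gop_ip// ipC (ip_ae Lu Lv _ e) 1?ipC//; exact: L2_kA.
Qed.

Lemma ip_gop u v : L2 u -> L2 v -> ip (gop A u) v = ip u (gop A v).
Proof.
move=> Lu Lv.
have L1 : L2 (fun=> 1 : R).
  by apply: (@L2_bounded _ _ 1) => // x _; rewrite normr1.
have i1 w : L2 w -> mu.-integrable I01 (EFin \o w).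
  by move=> Lw; have := L2_mul Lw L1; under eq_fun do rewrite mulr1.
have sym a b : I01 a -> I01 b -> kA (a, b) = kA (b, a).
  by move=> Ia Ib; rewrite !kAE//; case: gA => _ + _; apply.
rewrite ipC /ip.
transitivity (\int[mu]_(x in I01) (v x * \int[mu]_(y in I01) (kA (x, y) * u y))).
  by apply: eq_Rintegral => x /set_mem Ix; rewrite gopE.
rewrite (kernel_fubini (c := `|c|))//; [|exact: i1|exact: i1].
apply: eq_Rintegral => y /set_mem Iy; rewrite gopE//; congr (_ * _).
by apply: eq_Rintegral => x /set_mem Ix; rewrite sym.
Qed.

End GraphonOperator.

Section VectorOperator.
Context {R : realType} {n : nat} (c : R) (A : R * R -> R).
Hypothesis gA : graphon c A.
Implicit Types (u v w : R -> 'cV[R]_n) (k : R) (L D : 'M[R]_n).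

Lemma coordf_opn L D v i : coordf (opn L D A v) i =
  fun a => \sum_j L i j * coordf v j a + \sum_j D i j * gop A (coordf v j) a.
Proof.
apply/funext => a; rewrite /coordf /opn !mxE; congr (_ + _).
by apply: eq_bigr => j _; rewrite !mxE.
Qed.

Lemma L2n_opn L D v : L2n v -> L2n (opn L D A v).
Proof.
move=> Lv i; rewrite coordf_opn.
by apply: L2D; apply: L2_sum => j _; apply: L2Z => //; exact: L2_gop gA _ _.
Qed.

Lemma opn_lin L D k u v a : L2n u -> L2n v -> I01 a ->
  opn L D A (k *: u + v) a = k *: opn L D A u a + opn L D A v a.
Proof.
move=> Lu Lv Ia; rewrite /opn.
have -> : (\col_i gop A (coordf (k *: u + v) i) a) =
    k *: (\col_i gop A (coordf u i) a) + (\col_i gop A (coordf v i) a).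
  by apply/matrixP => i j; rewrite !mxE coordf_lin (gop_lin gA).
rewrite (_ : (k *: u + v) a = k *: u a + v a)// !mulmxDr -!scalemxAr scalerDr.
by rewrite addrACA.
Qed.

Lemma opn_ae L D u v : L2n u -> L2n v -> eqL2 u v ->
  eqL2 (opn L D A u) (opn L D A v).
Proof.
move=> Lu Lv e; apply: filterS (e) => a h Ia; rewrite /opn h//; congr (_ + _ *m _).
by apply/matrixP => i j; rewrite !mxE (gop_ae gA (Lu i) (Lv i))//; exact: eqL2_coordf.
Qed.

(** The graphon operator is symmetric, so taking the adjoint only transposes the two matrices and
    gives an operator of the same form. *)
Lemma ipn_opn L D u v : L2n u -> L2n v ->
  ipn (opn L D A u) v = ipn u (opn L^T D^T A v).
Proof.
move=> Lu Lv.
have h L' D' (u' v' : R -> 'cV[R]_n) : L2n u' -> L2n v' -> ipn (opn L' D' A u') v' =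
    \sum_i \sum_j (L' i j * ip (coordf u' j) (coordf v' i) +
      D' i j * ip (gop A (coordf u' j)) (coordf v' i)).
  move=> Lu' Lv'; apply: eq_bigr => i _; rewrite coordf_opn.
  have Lg j : L2 (gop A (coordf u' j)) by exact: L2_gop gA _ _.
  rewrite ipDl//; [|by apply: L2_sum => j _; exact: L2Z..].
  rewrite !ip_suml//; [|by move=> j _; exact: L2Z..].
  by rewrite -big_split /=; apply: eq_bigr => j _; rewrite !ipZl.
rewrite h// ipnC h// exchange_big; apply: eq_bigr => i _; apply: eq_bigr => j _.
by rewrite !mxE (ip_gop gA (Lu i) (Lv j)) [X in _ * X + _]ipC [X in _ + _ * X]ipC.
Qed.

End VectorOperator.

(** * Bochner integrals *)

Section MonotoneIntegral.
Context {R : realType}.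
Local Notation mu := (@lebesgue_measure R).

(* No measurability is needed since the integral of a nonnegative function is a
   supremum over the simple functions below it. *)
Lemma ge0_le_integral_nonmeas (D : set R) (f g : R -> \bar R) :
  (forall x, D x -> 0 <= f x)%E -> (forall x, D x -> f x <= g x)%E ->
  (\int[mu]_(x in D) f x <= \int[mu]_(x in D) g x)%E.
Proof.
move=> f0 fg; have g0 x : D x -> (0 <= g x)%E by move=> Dx; exact: le_trans (f0 x Dx) (fg x Dx).
rewrite !ge0_integralE//; apply: le_ereal_sup => _ [h hf <-]; exists h => // x.
apply: le_trans (hf x) _; rewrite !patchE; case: ifPn => // /set_mem; exact: fg.
Qed.

End MonotoneIntegral.

Section SimpleCurve.
Context {R : realType} {n : nat}.
Local Notation mu := (@lebesgue_measure R).
Local Notation TR := (measurableTypeR R).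
Implicit Types (s : simple_curve R n) (w e : R -> 'cV[R]_n).

Lemma sc_fun_L2n s (t : R) : L2n (sc_fun s t).
Proof. by apply: L2n_sum => j _; apply: L2nZ; exact: sc_val_L2n. Qed.

Lemma sc_int_L2n (D : set R) s : L2n (sc_int D s).
Proof. by apply: L2n_sum => j _; apply: L2nZ; exact: sc_val_L2n. Qed.

(** The pieces of the two curves are listed one after the other; pieces may overlap, a simple curve
    being a sum. *)
Definition sc_lin (k : R) s1 s2 : simple_curve R n.
Proof.
refine (@SimpleCurve R n (sc_size s1 + sc_size s2)
  (fun j => match fintype.split j with inl i => sc_set (s:=s1) i | inr i => sc_set (s:=s2) i end)
  (fun j => match fintype.split j with inl i => k *: sc_val (s:=s1) i | inr i => sc_val (s:=s2) i end) _ _).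
- by move=> j; case: fintype.split => i; exact: sc_set_measurable.
- by move=> j; case: fintype.split => i; [apply: L2nZ|]; exact: sc_val_L2n.
Defined.

Lemma sc_fun_lin k s1 s2 t : sc_fun (sc_lin k s1 s2) t = k *: sc_fun s1 t + sc_fun s2 t.
Proof.
rewrite /sc_fun big_split_ord /= scaler_sumr; congr (_ + _); apply: eq_bigr => i _.
  case: split_ordP => j; last by move/eqP; rewrite eq_lrshift.
  by move/lshift_inj => ->; rewrite !scalerA mulrC.
case: split_ordP => j; first by move/eqP; rewrite eq_rlshift.
by move/rshift_inj => ->.
Qed.

Definition sc_zero : simple_curve R n.
Proof. by refine (@SimpleCurve R n 0 (fun=> set0) (fun=> 0) _ _) => -[]. Defined.

Lemma sc_fun_zero t : sc_fun sc_zero t = 0.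
Proof. by rewrite /sc_fun big_ord0. Qed.

Lemma ipn_sc_fun w s (t : R) : L2n w ->
  ipn w (sc_fun s t) = \sum_(j < sc_size s) ipn w (sc_val (s:=s) j) * \1_(sc_set (s:=s) j) t.
Proof.
move=> Lw; rewrite /sc_fun ipn_sumr//; last by move=> j _; apply: L2nZ; exact: sc_val_L2n.
apply: eq_bigr => j _; rewrite ipnZr//; last exact: sc_val_L2n.
by rewrite mulrC.
Qed.

Lemma measurable_indic_fun (D E : set TR) : measurable E -> measurable_fun D (\1_E : TR -> R).
Proof. by move=> mE; exact: measurable_indic. Qed.

Lemma measurable_sumf (I : Type) (r : seq I) (D : set TR) (f : I -> TR -> R) :
  (forall i, measurable_fun D (f i)) -> measurable_fun D (fun t => \sum_(i <- r) f i t).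
Proof.
move=> mf; elim: r => [|i r IH].
  by under eq_fun do rewrite big_nil; exact: measurable_cst.
by under eq_fun do rewrite big_cons; exact: measurable_funD.
Qed.

Lemma measurable_ipn_sc w s (D : set TR) : L2n w ->
  measurable_fun D (fun t => ipn w (sc_fun s t)).
Proof.
move=> Lw; under eq_fun do rewrite ipn_sc_fun//.
apply: measurable_sumf => j; apply: measurable_funM => //.
by apply: measurable_indic_fun; exact: sc_set_measurable.
Qed.

Lemma measurable_normn_sc s (D : set TR) : measurable_fun D (fun t => normn (sc_fun s t)).
Proof.
have mQ : measurable_fun D (fun t => ipn (sc_fun s t) (sc_fun s t)).
  have -> : (fun t => ipn (sc_fun s t) (sc_fun s t)) = fun t =>
    \sum_(j < sc_size s) \1_(sc_set (s:=s) j) t * ipn (sc_val (s:=s) j) (sc_fun s t).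
    apply/funext => t; rewrite {1}/sc_fun ipn_suml//; last 2 first.
      - by move=> j _; apply: L2nZ; exact: sc_val_L2n.
      - exact: sc_fun_L2n.
    by apply: eq_bigr => j _; rewrite ipnZl//; [exact: sc_val_L2n|exact: sc_fun_L2n].
  apply: measurable_sumf => j; apply: measurable_funM.
    by apply: measurable_indic_fun; exact: sc_set_measurable.
  by apply: measurable_ipn_sc; exact: sc_val_L2n.
have ms : measurable_fun [set: TR] (Num.sqrt : TR -> TR).
  by apply: continuous_measurable_fun; exact: sqrt_continuous.
exact: (measurableT_comp ms mQ).
Qed.

Lemma ipn_sc_bounded w s : L2n w -> exists C, forall t, `|ipn w (sc_fun s t)| <= C.
Proof.
move=> Lw; exists (\sum_(j < sc_size s) `|ipn w (sc_val (s:=s) j)|) => t.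
rewrite ipn_sc_fun// (le_trans (ler_norm_sum _ _ _))//; apply: ler_sum => j _.
rewrite normrM -[leRHS]mulr1 ler_wpM2l// indicE.
by case: (_ \in _); rewrite ?normr1 ?normr0.
Qed.

Lemma ipn_sc_integrable w s (D : set TR) : L2n w -> measurable D -> (mu D < +oo)%E ->
  mu.-integrable D (fun t => (ipn w (sc_fun s t))%:E).
Proof.
move=> Lw mD Dfin; have [C hC] := ipn_sc_bounded s Lw.
by apply: (@bounded_integrable _ _ _ C) => //; exact: measurable_ipn_sc.
Qed.

Lemma ipn_sc_int w s (D : set TR) : L2n w -> measurable D -> (mu D < +oo)%E ->
  ipn w (sc_int D s) = \int[mu]_(t in D) ipn w (sc_fun s t).
Proof.
move=> Lw mD Dfin; rewrite /sc_int ipn_sumr//; last first.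
  by move=> j _; apply: L2nZ; exact: sc_val_L2n.
rewrite /Rintegral.
under eq_integral do rewrite ipn_sc_fun// -sumEFin.
have mS j : @measurable _ TR (sc_set (s:=s) j) by exact: sc_set_measurable.
rewrite integral_sum//; last first.
  move=> j; apply: (@bounded_integrable _ _ _ `|ipn w (sc_val (s:=s) j)|) => //.
    by apply: measurable_funM => //; exact: measurable_indic_fun.
  move=> t _; rewrite normrM -[leRHS]mulr1 ler_wpM2l// indicE.
  by case: (_ \in _); rewrite ?normr1 ?normr0.
have fS j : mu (D `&` sc_set (s:=s) j) \is a fin_num.
  rewrite ge0_fin_numE//; apply: le_lt_trans Dfin.
  by apply: le_measure; rewrite ?inE//; exact: measurableI.
rewrite -[LHS]/(fine (_%:E)) -sumEFin; congr fine; apply: eq_bigr => j _.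
under eq_integral do rewrite EFinM.
rewrite integralZl//; last first.
  apply: (@bounded_integrable _ _ _ 1) => //; first exact: measurable_indic_fun.
  by move=> t _; rewrite indicE; case: (_ \in _); rewrite ?normr1 ?normr0.
have -> : (\int[mu]_(t in D) (\1_(sc_set (s:=s) j) t)%:E)%E =
    (fine (mu (D `&` sc_set (s:=s) j)))%:E.
  by rewrite integral_indic// setIC; exact: (esym (fineK (fS j))).
rewrite -EFinM; congr EFin.
by rewrite ipnZr// 1?mulrC//; exact: sc_val_L2n.
Qed.

End SimpleCurve.

Section StronglyMeasurable.
Context {R : realType} {n : nat}.
Local Notation mu := (@lebesgue_measure R).
Local Notation TR := (measurableTypeR R).
Implicit Types (w e z : R -> 'cV[R]_n) (y : R -> R -> 'cV[R]_n).

Lemma normn_cvg_ipn (I : Type) (F : set_system I) {FF : Filter F}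
    (v : I -> R -> 'cV[R]_n) z w :
  L2n w -> L2n z -> (forall i, L2n (v i)) -> (fun i => normn (z - v i)) @ F --> (0 : R) ->
  (fun i => ipn w (v i)) @ F --> ipn w z.
Proof.
move=> Lw Lz Lv h; apply/cvgrPdist_le => e e0.
(* The added 1 keeps the divisor positive when w has norm 0. *)
have C0 : 0 < normn w + 1 by rewrite ltr_wpDl ?normn_ge0.
have e1 : 0 < e / (normn w + 1) by rewrite divr_gt0.
have /cvgrPdist_le/(_ _ e1) := h.
apply: filterS => i; rewrite sub0r normrN => hi.
rewrite -ipnBr// (le_trans (cauchy_schwarz Lw (L2nB Lz (Lv i))))//.
rewrite ger0_norm ?normn_ge0// ler_pdivlMr// mulrC in hi.
by rewrite (le_trans _ hi)// ler_wpM2r ?normn_ge0// lerDl.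
Qed.

Lemma strongly_measurable_ipn (D : set TR) y w : L2n w -> strongly_measurable D y ->
  measurable_fun D (fun t => ipn w (y t)).
Proof.
move=> Lw [Ly [s hs]].
apply: (@measurable_fun_cvg _ _ _ D (fun k t => ipn w (sc_fun (s k) t))).
  by move=> k; exact: measurable_ipn_sc.
move=> t Dt; apply: normn_cvg_ipn => //; [exact: Ly|by move=> k; exact: sc_fun_L2n|exact: hs].
Qed.

Lemma strongly_measurable_normn (D : set TR) y : strongly_measurable D y ->
  measurable_fun D (fun t => normn (y t)).
Proof.
move=> [Ly [s hs]].
apply: (@measurable_fun_cvg _ _ _ D (fun k t => normn (sc_fun (s k) t))).
  by move=> k; exact: measurable_normn_sc.
move=> t Dt; apply/cvgrPdist_le => e e0.
have /cvgrPdist_le/(_ _ e0) := hs t Dt.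
apply: filterS => i; rewrite sub0r normrN; apply: le_trans.
rewrite [leRHS]ger0_norm ?normn_ge0//; apply: ler_normn_dist; [exact: Ly|exact: sc_fun_L2n].
Qed.

Lemma strongly_measurable_lin (D : set TR) (k : R) y1 y2 :
  strongly_measurable D y1 -> strongly_measurable D y2 ->
  strongly_measurable D (fun t => k *: y1 t + y2 t).
Proof.
move=> [L1 [s1 h1]] [L2 [s2 h2]]; split.
  by move=> t Dt; apply: L2n_lin; [exact: L1|exact: L2].
exists (fun m => sc_lin k (s1 m) (s2 m)) => t Dt.
apply: (@squeeze_cvgr _ _ _ _ (cst 0)
  (fun m => `|k| * normn (y1 t - sc_fun (s1 m) t) + normn (y2 t - sc_fun (s2 m) t))).
- apply: nearW => m; rewrite normn_ge0 /= sc_fun_lin opprD addrACA -scalerBr.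
  have La := L2nB (L1 _ Dt) (sc_fun_L2n (s1 m) t).
  have Lb := L2nB (L2 _ Dt) (sc_fun_L2n (s2 m) t).
  by rewrite (le_trans (normnD (L2nZ k La) Lb))// normnZ.
- exact: cvg_cst.
- rewrite -[X in _ --> X]addr0; apply: cvgD; last exact: h2.
  rewrite -(mulr0 `|k|); apply: cvgM; [exact: cvg_cst|exact: h1].
Qed.

Lemma strongly_measurable_sc (D : set TR) (s : simple_curve R n) :
  strongly_measurable D (sc_fun s).
Proof.
split; first by move=> t _; exact: sc_fun_L2n.
by exists (fun=> s) => t _; under eq_fun do rewrite subrr normn0; exact: cvg_cst.
Qed.

Lemma strongly_measurableB (D : set TR) y1 y2 :
  strongly_measurable D y1 -> strongly_measurable D y2 ->
  strongly_measurable D (fun t => y1 t - y2 t).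
Proof.
move=> h1 h2; have := strongly_measurable_lin (-1) h2 h1.
by under eq_fun do rewrite scaleN1r addrC.
Qed.

(** Tested against a fixed vector, a Bochner integral becomes a Lebesgue integral of reals; this is
    how the mild formulation is exploited. Both sides are limits of the pairings with the integrals
    of the simple curves: one by Cauchy-Schwarz in the space, the other by Cauchy-Schwarz under the
    integral. *)
Lemma bochner_pairing (D : set TR) y z w : measurable D -> (mu D < +oo)%E ->
  L2n w -> is_bochner_integral D y z ->
  mu.-integrable D (fun t => (ipn w (y t))%:E) /\
  ipn w z = \int[mu]_(t in D) ipn w (y t).
Proof.
move=> mD Dfin Lw [Lz my [s [h1 h2]]].
have Ly t : D t -> L2n (y t) by case: my => + _; exact.
have mw := strongly_measurable_ipn Lw my.
pose N k t := normn (y t - sc_fun (s k) t).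
have mN k : measurable_fun D (N k).
  apply: strongly_measurable_normn; apply: strongly_measurableB my _.
  exact: strongly_measurable_sc.
pose a k := (\int[mu]_(t in D) (N k t)%:E)%E.
have a0 k : (0 <= a k)%E by apply: integral_ge0 => t _; rewrite lee_fin normn_ge0.
have ha (e : R) : 0 < e -> \forall k \near \oo, (a k < e%:E)%E.
  move=> e0; move/fine_cvgP : h1 => [fa /cvgrPdist_lt/(_ _ e0)].
  apply: filterS2 fa => k fk; rewrite sub0r normrN => /(le_lt_trans (ler_norm _)).
  by rewrite -lte_fin /= (fineK fk).
(* One simple curve at finite L^1 distance is enough to make the pairing with [y] integrable. *)
have [k0 ak0] : exists k, (a k < +oo)%E.
  by have /filter_ex[k hk] := ha 1 ltr01; exists k; rewrite (lt_trans hk)// ltry.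
have dist k t : D t -> `|ipn w (y t) - ipn w (sc_fun (s k) t)| <= normn w * N k t.
  move=> Dt; rewrite -ipnBr//; [|exact: Ly|exact: sc_fun_L2n].
  by apply: cauchy_schwarz => //; apply: L2nB; [exact: Ly|exact: sc_fun_L2n].
have is_ k := ipn_sc_integrable (s k) Lw mD Dfin.
have iN k : (a k < +oo)%E -> mu.-integrable D (EFin \o N k).
  move=> ak; apply/integrableP; split; first exact/measurable_EFinP.
  by under eq_integral do rewrite /= ger0_norm ?normn_ge0//.
have iw : mu.-integrable D (fun t => (ipn w (y t))%:E).
  have i1 := integrableZl mD (normn w) (iN _ ak0).
  have i2 : mu.-integrable D (fun t => (ipn w (y t) - ipn w (sc_fun (s k0) t))%:E).
    refine (@le_integrable _ _ _ mu _ mD _ _ _ _ i1).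
      by apply/measurable_EFinP; apply: measurable_funB => //; exact: measurable_ipn_sc.
    by move=> t Dt /=; rewrite lee_fin (le_trans (dist _ _ Dt))// ler_norm.
  have := integrableD mD i2 (is_ k0); apply: eq_integrable => // t _.
  by rewrite /= -EFinD subrK.
split => //.
have cv1 : (fun k => ipn w (sc_int D (s k))) @ \oo --> ipn w z.
  by apply: normn_cvg_ipn => // k; exact: sc_int_L2n.
have cv2 : (fun k => ipn w (sc_int D (s k))) @ \oo --> \int[mu]_(t in D) ipn w (y t).
  apply/cvgrPdist_le => e e0.
  have C0 : 0 < normn w + 1 by rewrite ltr_wpDl ?normn_ge0.
  have e1 : 0 < e / (normn w + 1) by rewrite divr_gt0.
  apply: filterS (ha _ e1) => k ak.
  have aky : (a k < +oo)%E by rewrite (lt_trans ak)// ltry.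
  have -> : \int[mu]_(t in D) ipn w (y t) - ipn w (sc_int D (s k)) =
      \int[mu]_(t in D) (ipn w (y t) - ipn w (sc_fun (s k) t)).
    rewrite ipn_sc_int// RintegralB//; exact: is_.
  have ib := integrableB mD iw (is_ k).
  apply: (le_trans (le_normr_Rintegral mD ib)).
  apply: (@le_trans _ _ (\int[mu]_(t in D) (normn w * N k t))).
    apply: le_Rintegral => //.
    - exact: (integrable_norm ib).
    - exact: (integrableZl mD _ (iN _ aky)).
    - by move=> t Dt; exact: dist.
  rewrite RintegralZl//; last exact: iN.
  have : fine (a k) <= e / (normn w + 1).
    rewrite -lee_fin fineK; last by rewrite ge0_fin_numE.
    exact: ltW.
  rewrite ler_pdivlMr// => /(le_trans _); apply.
  by rewrite mulrC; apply: ler_wpM2l; [exact: fine_ge0 (a0 k)|rewrite lerDl].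
exact: cvgn_unique cv1 cv2.
Qed.

(** Both integrals have the same pairing with z - z', so this vector is orthogonal to itself. *)
Lemma bochner_unique (D : set TR) y z z' : measurable D -> (mu D < +oo)%E ->
  is_bochner_integral D y z -> is_bochner_integral D y z' -> eqL2 z z'.
Proof.
move=> mD Dfin bz bz'.
have [Lz _ _] := bz; have [Lz' _ _] := bz'; have Lzz := L2nB Lz Lz'.
have [_ e] := bochner_pairing mD Dfin Lzz bz.
have [_ e'] := bochner_pairing mD Dfin Lzz bz'.
have : ipn (z - z') (z - z') = 0 by rewrite ipnBr// e e' subrr.
move=> /(ipn_eq0 Lzz); apply: filterS => x h Ix; apply/eqP; rewrite -subr_eq0.
by apply/eqP; exact: (h Ix).
Qed.

End StronglyMeasurable.

(** * Curves with values in the span of a finite family *)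

Section FiniteRankCurve.
Context {R : realType} {n : nat}.
Local Notation mu := (@lebesgue_measure R).
Local Notation TR := (measurableTypeR R).

(** The range of phi is cut into cells of length eps / (|e| + 1), and phi is replaced by the left
    end of its cell. *)
Lemma simple_curve_approx1 (phi : TR -> R) (D : set TR) (C eps : R) (e : R -> 'cV[R]_n) :
  measurable_fun setT phi -> (forall t, D t -> `|phi t| <= C) -> L2n e -> 0 < eps ->
  exists s : simple_curve R n,
    forall t, D t -> normn (phi t *: e - sc_fun s t) <= eps.
Proof.
move=> mphi phiC Le eps0.
have ne0 : 0 < normn e + 1 by rewrite ltr_wpDl ?normn_ge0.
pose dl := eps / (normn e + 1); have dl0 : 0 < dl by rewrite divr_gt0.
have [N N_gt] : exists N : nat, `|C| / dl < N%:R.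
  by exists (Num.truncn (`|C| / dl)).+1; rewrite truncnS_gt.
(* Measured in cells and shifted by N, the values on D lie in [0, 2N), so the truncation of [x t] is
   the index of a cell. *)
pose x t := phi t / dl + N%:R.
have mx : measurable_fun setT x.
  apply: measurable_funD => //; apply: measurable_funM => //; exact: measurable_cst.
pose S (i : 'I_(2 * N)) := x @^-1` `[i%:R, i.+1%:R[%classic.
have mS i : measurable (S i) by rewrite -[S i]setTI; exact: mx.
exists (@SimpleCurve R n (2 * N) S (fun i => ((i%:R - N%:R) * dl) *: e) mS
  (fun i => L2nZ _ Le)) => t Dt.
have xN : 0 <= x t < (2 * N)%:R.
  have h : `|phi t / dl| < N%:R.
    rewrite normrM normfV (gtr0_norm dl0); apply: le_lt_trans N_gt.
    by rewrite ler_wpM2r ?invr_ge0 ?(ltW dl0)// (le_trans (phiC _ Dt))// ler_norm.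
  move: h; rewrite ltr_norml => /andP[h1 h2].
  by rewrite /x mul2n -addnn natrD; apply/andP; split; lra.
have /andP[x0 x2N] := xN.
have /andP[i1 i2] := truncn_itv x0.
have iN : (Num.truncn (x t) < 2 * N)%N by rewrite -(ltr_nat R); exact: le_lt_trans x2N.
pose i0 := Ordinal iN.
rewrite /sc_fun /= (bigD1 i0)//= big1 ?addr0; last first.
  move=> i ii0; rewrite indicE memNset ?scale0r// /S /= in_itv /= => /andP[h1 h2].
  move/negP: ii0; apply; apply/eqP/val_inj/anti_leq/andP => /=.
  by split; rewrite -ltnS -(ltr_nat R); [exact: le_lt_trans i2|exact: le_lt_trans h2].
rewrite indicE mem_set ?scale1r; last by rewrite /S /= in_itv /= i1 i2.
rewrite -scalerBl normnZ//.
have -> : phi t - ((Num.truncn (x t))%:R - N%:R) * dl = (x t - (Num.truncn (x t))%:R) * dl.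
  by rewrite /x !mulrBl mulrDl divfK ?lt0r_neq0// opprB addrA.
have h : `|x t - (Num.truncn (x t))%:R| <= 1.
  rewrite ger0_norm ?subr_ge0// lerBlDr.
  by move: i2; rewrite -natr1 => /ltW; rewrite addrC.
rewrite normrM (gtr0_norm dl0) (@le_trans _ _ (dl * normn e))//.
  by rewrite ler_wpM2r ?normn_ge0// -[leRHS]mul1r ler_wpM2r// ltW.
by rewrite /dl mulrAC ler_pdivrMr// ler_wpM2l ?lerDl// ltW.
Qed.

Lemma simple_curve_approx (I : finType) (phi : I -> TR -> R) (D : set TR)
    (e : I -> R -> 'cV[R]_n) (eps : R) :
  (forall j, measurable_fun setT (phi j)) ->
  (forall j, exists C, forall t, D t -> `|phi j t| <= C) ->
  (forall j, L2n (e j)) -> 0 < eps ->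
  exists s : simple_curve R n,
    forall t, D t -> normn (\sum_j phi j t *: e j - sc_fun s t) <= eps.
Proof.
move=> mphi bphi Le; rewrite /index_enum; elim: (Finite.enum I) eps => [|j r IH] eps eps0.
  exists (sc_zero) => t _; rewrite big_nil sc_fun_zero subrr normn0; exact: ltW.
have e2 : 0 < eps / 2 by rewrite divr_gt0.
have [C hC] := bphi j.
have [s1 h1] := simple_curve_approx1 (mphi j) hC (Le j) e2.
have [s2 h2] := IH _ e2.
exists (sc_lin 1 s1 s2) => t Dt; rewrite big_cons sc_fun_lin scale1r opprD addrACA.
have L1 : L2n (phi j t *: e j - sc_fun s1 t) by apply: L2nB (sc_fun_L2n _ _); exact: L2nZ.
have L2 : L2n (\sum_(i <- r) phi i t *: e i - sc_fun s2 t).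
  by apply: L2nB (sc_fun_L2n _ _); apply: L2n_sum => i _; exact: L2nZ.
rewrite (le_trans (normnD L1 L2))// (splitr eps).
by apply: lerD; [exact: h1|exact: h2].
Qed.

Lemma integrable_sumf (I : Type) (r : seq I) (D : set TR) (f : I -> TR -> R) :
  measurable D -> (forall i, mu.-integrable D (EFin \o f i)) ->
  mu.-integrable D (EFin \o (fun t => \sum_(i <- r) f i t)).
Proof.
move=> mD fi; elim: r => [|i r ir].
  rewrite (_ : _ \o _ = cst 0%E); first exact: integrable0.
  by apply/funext => t; rewrite /= big_nil.
rewrite (_ : _ \o _ = ((EFin \o f i) \+ (EFin \o (fun t => (\sum_(i <- r) f i t)%R)))%E).
  exact: integrableD.
by apply/funext => t; rewrite /= big_cons EFinD.
Qed.

Lemma Rintegral_sumf (I : Type) (r : seq I) (D : set TR) (f : I -> TR -> R) :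
  measurable D -> (forall i, mu.-integrable D (EFin \o f i)) ->
  \int[mu]_(t in D) (\sum_(i <- r) f i t) = \sum_(i <- r) \int[mu]_(t in D) f i t.
Proof.
move=> mD fi; elim: r => [|i r IH].
  under eq_Rintegral do rewrite big_nil.
  by rewrite big_nil /Rintegral integral0.
under eq_Rintegral do rewrite big_cons.
by rewrite RintegralD// ?IH ?big_cons//; exact: integrable_sumf.
Qed.

Section Integral.
Variables (I : finType) (phi : I -> TR -> R) (D : set TR) (e : I -> R -> 'cV[R]_n).
Variable y : R -> R -> 'cV[R]_n.
Hypotheses (mD : measurable D) (Dfin : (mu D < +oo)%E).
Hypothesis mphi : forall j, measurable_fun setT (phi j).
Hypothesis bphi : forall j, exists C, forall t, D t -> `|phi j t| <= C.
Hypothesis Le : forall j, L2n (e j).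
Hypothesis Ly : forall t, D t -> L2n (y t).
Hypothesis yE : forall t, D t -> eqL2 (y t) (\sum_j phi j t *: e j).

(** The error is uniform in t, which serves pointwise convergence as well as convergence of
    integrals over a set of finite measure. [y] is tied to the finite sum only almost everywhere
    because the integrands of interest contain [expop], a chosen representative. *)
Let approx : exists s : nat -> simple_curve R n,
  forall k t, D t -> normn (y t - sc_fun (s k) t) <= k.+1%:R^-1.
Proof.
suff H (k : nat) : exists s : simple_curve R n,
    forall t, D t -> normn (y t - sc_fun s t) <= k.+1%:R^-1.
  by exists (fun k => projT1 (cid (H k))) => k; exact: projT2 (cid (H k)).
have k0 : 0 < k.+1%:R^-1 :> R by [].
have [s hs] := simple_curve_approx mphi bphi Le k0.
exists s => t Dt; rewrite (le_trans _ (hs t Dt))// le_eqVlt; apply/orP; left; apply/eqP.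
apply: normn_ae.
- by apply: L2nB (sc_fun_L2n _ _); exact: Ly.
- by apply: L2nB (sc_fun_L2n _ _); apply: L2n_sum => j _; exact: L2nZ.
- apply: filterS (yE Dt) => x h Ix; rewrite /= -[LHS]/(_ - _) -[RHS]/(_ - _).
  by congr (_ - _); exact: h.
Qed.

Let inv_cvg0 : (fun k : nat => (k.+1%:R^-1 : R)) @ \oo --> (0 : R).
Proof. exact: cvg_harmonic. Qed.

Lemma finite_rank_strongly_measurable : strongly_measurable D y.
Proof.
split=> //; have [s hs] := approx; exists s => t Dt.
apply: (@squeeze_cvgr _ _ _ _ (cst 0) (fun k : nat => (k.+1%:R^-1 : R))).
- by apply: nearW => k; rewrite normn_ge0 hs.
- exact: cvg_cst.
- exact: inv_cvg0.
Qed.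

Lemma finite_rank_bochner :
  is_bochner_integral D y (\sum_j (\int[mu]_(t in D) phi j t) *: e j).
Proof.
have Lz : L2n (\sum_j (\int[mu]_(t in D) phi j t) *: e j).
  by apply: L2n_sum => j _; exact: L2nZ.
have iphi j : mu.-integrable D (EFin \o phi j).
  have [C hC] := bphi j; apply: (@bounded_integrable _ _ _ C) => //.
  exact: (measurable_funTS (mphi j)).
split => //; first exact: finite_rank_strongly_measurable.
have [s hs] := approx; exists s; split.
  apply: (@squeeze_cvge _ _ _ _ (cst 0%E) _
    (fun k : nat => (k.+1%:R^-1 * fine (mu D))%:E)).
  - apply: nearW => k; apply/andP; split.
      by apply: integral_ge0 => t _; rewrite lee_fin normn_ge0.
    apply: (@le_trans _ _ (\int[mu]_(t in D) (cst k.+1%:R^-1%:E t))%E).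
      apply: ge0_le_integral_nonmeas => t Dt; rewrite lee_fin ?normn_ge0//.
      exact: hs.
    by rewrite integral_cst// EFinM fineK// ge0_fin_numE.
  - exact: cvg_cst.
  - apply: cvg_EFin; first exact: nearW.
    rewrite -(mul0r (fine (mu D))); apply: cvgM; last exact: cvg_cst.
    exact: inv_cvg0.
apply: (@squeeze_cvgr _ _ _ _ (cst 0) (fun k : nat => (k.+1%:R^-1 * fine (mu D)))).
- apply: nearW => k; rewrite normn_ge0 /=.
  set z := (\sum_j _); set w := z - sc_int D (s k).
  have Lw : L2n w by apply: L2nB => //; exact: sc_int_L2n.
  have [->|w0] := eqVneq (normn w) 0; first by rewrite mulr_ge0 ?fine_ge0.
  (* |w|^2 = <w, z - sc_int> is the integral of <w, y - sc_fun>, at most |w| mu(D) / (k + 1); the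
     positive factor |w| is then cancelled. *)
  rewrite -(ler_pM2l (_ : 0 < normn w)); last by rewrite lt_def w0 normn_ge0.
  rewrite -expr2 sqr_normn {2}/w ipnBr//; last exact: sc_int_L2n.
  rewrite ipn_sc_int//.
  have is_ := ipn_sc_integrable (s k) Lw mD Dfin.
  have iyj j : mu.-integrable D (EFin \o (fun t => ipn w (e j) * phi j t)).
    exact: (integrableZl mD _ (iphi j)).
  have iy := integrable_sumf (index_enum I) mD iyj.
  have -> : ipn w z = \int[mu]_(t in D) (\sum_j ipn w (e j) * phi j t).
    rewrite /z ipn_sumr//; last by move=> j _; exact: L2nZ.
    rewrite Rintegral_sumf//; apply: eq_bigr => j _.
    by rewrite ipnZr// mulrC RintegralZl.
  have yE' t : D t -> \sum_j ipn w (e j) * phi j t = ipn w (y t).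
    move=> Dt; have Ls : L2n (\sum_j phi j t *: e j) by apply: L2n_sum => j _; exact: L2nZ.
    rewrite (ipn_ae Lw Lw (Ly Dt) Ls (eqL2_refl _) (yE Dt)) ipn_sumr//; last by move=> j _; exact: L2nZ.
    by apply: eq_bigr => j _; rewrite ipnZr// mulrC.
  rewrite -RintegralB//.
  have ib := integrableB mD iy is_.
  apply: le_trans (ler_norm _) _; apply: (le_trans (le_normr_Rintegral mD ib)).
  have ic : mu.-integrable D (EFin \o cst (normn w * k.+1%:R^-1)).
    by apply: (@bounded_integrable _ _ _ `|normn w * k.+1%:R^-1|).
  apply: (@le_trans _ _ (\int[mu]_(t in D) (normn w * k.+1%:R^-1))).
    apply: le_Rintegral => //; first exact: (integrable_norm ib).
    move=> t Dt; rewrite yE'// -ipnBr//; [|exact: Ly|exact: sc_fun_L2n].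
    have Lys : L2n (y t - sc_fun (s k) t) by apply: L2nB; [exact: Ly|exact: sc_fun_L2n].
    rewrite (le_trans (cauchy_schwarz Lw Lys))// ler_wpM2l ?normn_ge0//; exact: hs.
  by rewrite Rintegral_cst// mulrA.
- exact: cvg_cst.
- rewrite -(mul0r (fine (mu D))); apply: cvgM; last exact: cvg_cst.
  exact: inv_cvg0.
Qed.

End Integral.
End FiniteRankCurve.

(** * Exponentials and mild solutions *)

Section ExponentialCurve.
Context {R : realType} {n : nat}.
Implicit Types (u v w : R -> 'cV[R]_n).

Section Operator.
Variables (c : R) (A : R * R -> R) (L D : 'M[R]_n).
Hypothesis gA : graphon c A.
Local Notation F := (opn L D A).

Definition expop_partial (t : R) v (m : nat) : R -> 'cV[R]_n :=
  \sum_(k < m) (t ^+ k / k`!%:R) *: iter k F v.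

(** The specification from which [expop] chooses. As a relation it lets limits be exhibited, added
    and compared before any choice is made. *)
Definition is_expop (t : R) v w :=
  L2n w /\ (fun m => normn (w - expop_partial t v m)) @ \oo --> (0 : R).

Lemma iter_opn_L2n v k : L2n v -> L2n (iter k F v).
Proof. by move=> Lv; elim: k => //= k IH; exact: L2n_opn gA _ _ _ IH. Qed.

Lemma expop_partial_L2n t v m : L2n v -> L2n (expop_partial t v m).
Proof. by move=> Lv; apply: L2n_sum => k _; apply: L2nZ; exact: iter_opn_L2n. Qed.

Lemma iter_opn_ae u v k : L2n u -> L2n v -> eqL2 u v -> eqL2 (iter k F u) (iter k F v).
Proof.
move=> Lu Lv e; elim: k => //= k IH.
by apply: (opn_ae gA) => //; exact: iter_opn_L2n.
Qed.

Lemma eqL2D u u' v v' : eqL2 u u' -> eqL2 v v' -> eqL2 (u + v) (u' + v').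
Proof. exact: (eqL2_comp2 (fun _ (a b : 'cV[R]_n) => a + b)). Qed.

Lemma eqL2Z (k : R) u u' : eqL2 u u' -> eqL2 (k *: u) (k *: u').
Proof. exact: (eqL2_comp (fun _ (a : 'cV[R]_n) => k *: a)). Qed.

Lemma eqL2B u u' v v' : eqL2 u u' -> eqL2 v v' -> eqL2 (u - v) (u' - v').
Proof. exact: (eqL2_comp2 (fun _ (a b : 'cV[R]_n) => a - b)). Qed.

Lemma eqL2_sum (I : Type) (r : seq I) (f g : I -> R -> 'cV[R]_n) :
  (forall i, eqL2 (f i) (g i)) -> eqL2 (\sum_(i <- r) f i) (\sum_(i <- r) g i).
Proof.
move=> h; elim: r => [|i r IH]; first by rewrite !big_nil; exact: eqL2_refl.
by rewrite !big_cons; exact: eqL2D.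
Qed.

(** With k = 1 this is also how additivity of a single operator is obtained later. *)
Lemma iter_opnD u v k : L2n u -> L2n v ->
  eqL2 (iter k F (u + v)) (iter k F u + iter k F v).
Proof.
move=> Lu Lv; elim: k => [|k IH] /=; first exact: eqL2_refl.
apply: (eqL2_trans (v := F (iter k F u + iter k F v))).
  by apply: (opn_ae gA) => //; [apply: iter_opn_L2n|apply: L2nD; apply: iter_opn_L2n] => //; exact: L2nD.
apply: eqL2_pt => a Ia.
rewrite -[in LHS](scale1r (iter k F u)) (opn_lin gA) ?scale1r//; exact: iter_opn_L2n.
Qed.

Lemma is_expop_ae t v v' w : L2n v -> L2n v' -> eqL2 v v' -> is_expop t v w ->
  is_expop t v' w.
Proof.
move=> Lv Lv' e [Lw h]; split; first exact: Lw.
suff -> : (fun m => normn (w - expop_partial t v' m)) =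
    (fun m => normn (w - expop_partial t v m)) by exact: h.
apply/funext => m; apply: normn_ae.
- exact: L2nB Lw (expop_partial_L2n _ _ Lv').
- exact: L2nB Lw (expop_partial_L2n _ _ Lv).
apply: eqL2B; first exact: eqL2_refl.
by apply: eqL2_sum => k; apply: eqL2Z; apply: eqL2_sym; exact: iter_opn_ae.
Qed.

Lemma is_expop_add t v v' w w' : L2n v -> L2n v' -> is_expop t v w -> is_expop t v' w' ->
  is_expop t (v + v') (w + w').
Proof.
move=> Lv Lv' [Lw h] [Lw' h']; split; first exact: L2nD.
have Lp m : L2n (w - expop_partial t v m) by exact: L2nB Lw (expop_partial_L2n _ _ Lv).
have Lp' m : L2n (w' - expop_partial t v' m) by exact: L2nB Lw' (expop_partial_L2n _ _ Lv').
apply: (@squeeze_cvgr _ _ _ _ (cst 0)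
  (fun m => normn (w - expop_partial t v m) + normn (w' - expop_partial t v' m))).
- apply: nearW => m; apply/andP; split; first exact: normn_ge0.
  apply: (le_trans _ (normnD (Lp m) (Lp' m))).
  rewrite le_eqVlt; apply/orP; left; apply/eqP; apply: normn_ae; last 1 first.
  + rewrite addrACA -opprD; apply: eqL2B; first exact: eqL2_refl.
    rewrite /expop_partial -big_split /=; apply: eqL2_sum => k.
    by rewrite -scalerDr; apply: eqL2Z; exact: iter_opnD.
  + exact: L2nB (L2nD Lw Lw') (expop_partial_L2n _ _ (L2nD Lv Lv')).
  + exact: L2nD (Lp m) (Lp' m).
- exact: cvg_cst.
- by rewrite -[X in _ --> X]addr0; apply: cvgD; [exact: h|exact: h'].
Qed.

Lemma is_expop_uniq t v w w' : L2n v -> is_expop t v w -> is_expop t v w' -> eqL2 w w'.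
Proof.
move=> Lv [Lw h] [Lw' h'].
have h0 : normn (w - w') = 0.
  apply: (@cvgn_unique _ (fun=> normn (w - w'))); first exact: cvg_cst.
  apply: (@squeeze_cvgr _ _ _ _ (cst 0)
    (fun m => normn (w - expop_partial t v m) + normn (w' - expop_partial t v m))).
  - apply: nearW => m; apply/andP; split; first exact: normn_ge0.
    have Lp := expop_partial_L2n t m Lv.
    have -> : w - w' = (w - expop_partial t v m) - (w' - expop_partial t v m).
      by rewrite opprB addrA subrK.
    exact: normnB (L2nB Lw Lp) (L2nB Lw' Lp).
  - exact: cvg_cst.
  - by rewrite -[X in _ --> X]addr0; apply: cvgD; [exact: h|exact: h'].
have := normn_eq0 (L2nB Lw Lw') h0.
by apply: filterS => x e Ix; apply/eqP; rewrite -subr_eq0; apply/eqP; exact: (e Ix).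
Qed.

(** [expop] has the default value 0 when the series has no limit, so any one limit must be supplied
    before the chosen one can be trusted. *)
Lemma expopP t v w : is_expop t v w -> is_expop t v (expop F t v).
Proof.
move=> h; have : exists w, is_expop t v w by exists w.
by rewrite /expop => H; exact: xgetPex H.
Qed.

Lemma expopE t v w : L2n v -> is_expop t v w -> eqL2 (expop F t v) w.
Proof. by move=> Lv h; exact: is_expop_uniq Lv (expopP h) h. Qed.

End Operator.

Section Lift.
Context {p q : nat}.
Variable E : 'I_p -> 'I_q -> R -> 'cV[R]_n.
Hypothesis LE : forall i j, L2n (E i j).
Implicit Types (N M : 'M[R]_(p, q)).

(** Operators act by left multiplication on the first index of the coefficients; the second is a
    spectator. It has one value for the family along S and n values for the family along S^perp, so
    that both share the same development. *)
Definition lift N : R -> 'cV[R]_n := \sum_i \sum_j N i j *: E i j.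

Definition mxip N M : R := \sum_i \sum_j N i j * M i j.

(** Pairings rather than coefficients: for a general family [coord (lift N)] differs from N. *)
Definition coord w : 'M[R]_(p, q) := \matrix_(i, j) ipn (E i j) w.

Lemma mxip_tr N M : mxip N M = \tr (N^T *m M).
Proof.
rewrite /mxip exchange_big; apply: eq_bigr => j _; rewrite mxE.
by apply: eq_bigr => i _; rewrite mxE.
Qed.

Lemma mxip_mull (K : 'M[R]_p) N M : mxip (K *m N) M = mxip N (K^T *m M).
Proof. by rewrite !mxip_tr trmx_mul mulmxA. Qed.

Lemma L2n_lift N : L2n (lift N).
Proof. by apply: L2n_sum => i _; apply: L2n_sum => j _; exact: L2nZ. Qed.

Lemma lift_lin (k : R) N M : lift (k *: N + M) = k *: lift N + lift M.
Proof.
rewrite /lift scaler_sumr -big_split; apply: eq_bigr => i _ /=.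
rewrite scaler_sumr -big_split; apply: eq_bigr => j _ /=.
by rewrite !mxE scalerDl scalerA.
Qed.

Lemma lift0 : lift 0 = 0.
Proof. by rewrite /lift big1// => i _; rewrite big1// => j _; rewrite mxE scale0r. Qed.

Lemma liftD N M : lift (N + M) = lift N + lift M.
Proof. by rewrite -[N]scale1r lift_lin !scale1r. Qed.

Lemma liftZ (k : R) N : lift (k *: N) = k *: lift N.
Proof. by rewrite -[k *: N]addr0 lift_lin lift0 addr0. Qed.

Lemma liftN N : lift (- N) = - lift N.
Proof. by rewrite -scaleN1r liftZ scaleN1r. Qed.

Lemma lift_sum (I : Type) (r : seq I) (f : I -> 'M[R]_(p, q)) :
  lift (\sum_(i <- r) f i) = \sum_(i <- r) lift (f i).
Proof.
by elim: r => [|i r IH]; rewrite ?big_nil ?lift0// !big_cons liftD IH.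
Qed.

Lemma ipn_lift N w : L2n w -> ipn (lift N) w = mxip N (coord w).
Proof.
move=> Lw; rewrite /lift ipn_suml//; last by move=> i _; apply: L2n_sum => j _; exact: L2nZ.
apply: eq_bigr => i _; rewrite ipn_suml//; last by move=> j _; exact: L2nZ.
by apply: eq_bigr => j _; rewrite ipnZl// mxE.
Qed.

Lemma normn_lift N : normn (lift N) <= \sum_i \sum_j `|N i j| * normn (E i j).
Proof.
have Lij i j : L2n (N i j *: E i j) by exact: L2nZ.
apply: (@le_trans _ _ (\sum_i normn (\sum_j N i j *: E i j))).
  by apply: normn_sum => i _; exact: L2n_sum.
apply: ler_sum => i _; apply: (@le_trans _ _ (\sum_j normn (N i j *: E i j))).
  exact: normn_sum.
by apply: ler_sum => j _; rewrite normnZ.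
Qed.

(* [K] represents the operator [F] on the span of the [E i j]; the second
   clause says that [K^T] represents its adjoint. *)
Definition intertwines (F : (R -> 'cV[R]_n) -> R -> 'cV[R]_n) (K : 'M[R]_p) :=
  (forall N, eqL2 (F (lift N)) (lift (K *m N))) /\
  (forall N u, L2n u -> ipn (lift N) (F u) = ipn (lift (K^T *m N)) u).

Variables (c : R) (A : R * R -> R) (L D : 'M[R]_n) (K : 'M[R]_p).
Hypothesis gA : graphon c A.
Local Notation F := (opn L D A).
Hypothesis FK : intertwines F K.

Lemma iter_opn_lift k N : eqL2 (iter k F (lift N)) (lift (K ^+ k *m N)).
Proof.
elim: k => [|k IH] /=; first by rewrite expr0 mul1mx; exact: eqL2_refl.
apply: (eqL2_trans (v := F (lift (K ^+ k *m N)))).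
  apply: (opn_ae gA) => //; [|exact: L2n_lift].
  apply: (iter_opn_L2n _ _ gA); exact: L2n_lift.
by rewrite exprS -mulmxA; exact: FK.1.
Qed.

(** On a lift the partial sums are lifts of matrix partial sums, and [normn_lift] reduces the error
    to finitely many scalar limits. *)
Lemma is_expop_lift t N : is_expop A L D t (lift N) (lift (mexp K t *m N)).
Proof.
split; first exact: L2n_lift.
pose P m := \sum_(k < m) (t ^+ k / k`!%:R) *: K ^+ k.
apply: (@squeeze_cvgr _ _ _ _ (cst 0) (fun m =>
  \sum_i \sum_j `|((mexp K t - P m) *m N) i j| * normn (E i j))).
- apply: nearW => m; rewrite normn_ge0 /= (le_trans _ (normn_lift _))//.
  rewrite le_eqVlt; apply/orP; left; apply/eqP; apply: normn_ae.
  + apply: L2nB; first exact: L2n_lift.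
    by apply: (expop_partial_L2n _ _ gA); exact: L2n_lift.
  + exact: L2n_lift.
  rewrite mulmxBl liftD liftN; apply: eqL2B; first exact: eqL2_refl.
  rewrite mulmx_suml lift_sum; apply: eqL2_sum => k.
  by rewrite -scalemxAl liftZ; apply: eqL2Z; exact: iter_opn_lift.
- exact: cvg_cst.
- rewrite -[X in _ --> X](_ : \sum_(i < p) \sum_(j < q) `|0 : R| * normn (E i j) = 0); last first.
    by rewrite big1// => i _; rewrite big1// => j _; rewrite normr0 mul0r.
  apply: cvg_sumf => i _; apply: cvg_sumf => j _; apply: cvgM; last exact: cvg_cst.
  apply: cvg_norm.
  have -> : (fun m => ((mexp K t - P m) *m N) i j) =
      (fun m => \sum_l (mexp K t i l - P m i l) * N l j).
    by apply/funext => m; rewrite mxE; apply: eq_bigr => l _; rewrite !mxE.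
  rewrite -[X in _ --> X](_ : \sum_(l < p) (mexp K t i l - mexp K t i l) * N l j = 0); last first.
    by rewrite big1// => l _; rewrite subrr mul0r.
  apply: cvg_sumf => l _; apply: cvgM; last exact: cvg_cst.
  apply: cvgB; first exact: cvg_cst.
  exact: mexp_cvg.
Qed.

(** Here v is arbitrary, outside the span of the family. The adjoint clause of [intertwines] moves
    each power of the operator to the test vector, where the series is one of matrices. *)
Lemma ipn_lift_expop t N v w : L2n v -> is_expop A L D t v w ->
  ipn (lift N) w = ipn (lift (mexp K^T t *m N)) v.
Proof.
move=> Lv [Lw h].
have c1 : (fun m => ipn (lift N) (expop_partial A L D t v m)) @ \oo --> ipn (lift N) w.
  apply: normn_cvg_ipn => //; first exact: L2n_lift.
  by move=> m; exact: (expop_partial_L2n _ _ gA).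
pose P m := \sum_(k < m) (t ^+ k / k`!%:R) *: K^T ^+ k.
have e k M : ipn (lift M) (iter k F v) = ipn (lift (K^T ^+ k *m M)) v.
  elim: k M => [|k IH] M; first by rewrite expr0 mul1mx.
  rewrite iterS FK.2; last exact: (iter_opn_L2n _ _ gA).
  by rewrite IH mulmxA exprSr.
have e2 m : ipn (lift N) (expop_partial A L D t v m) = ipn (lift (P m *m N)) v.
  rewrite /expop_partial ipn_sumr; last 2 first.
  - by move=> k _; apply: L2nZ; exact: (iter_opn_L2n _ _ gA).
  - exact: L2n_lift.
  rewrite mulmx_suml lift_sum ipn_suml//; last by move=> k _; exact: L2n_lift.
  apply: eq_bigr => k _; rewrite ipnZr; [|exact: (iter_opn_L2n _ _ gA)|exact: L2n_lift].
  by rewrite e -scalemxAl liftZ ipnZl//; exact: L2n_lift.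
refine (cvgn_unique c1 _).
rewrite (funext e2) ipn_lift//.
have -> : (fun m => ipn (lift (P m *m N)) v) =
    fun m => \sum_i \sum_j (\sum_l P m i l * N l j) * coord v i j.
  apply/funext => m; rewrite ipn_lift//; apply: eq_bigr => i _; apply: eq_bigr => j _.
  by rewrite mxE.
have -> : mxip (mexp K^T t *m N) (coord v) =
    \sum_i \sum_j (\sum_l mexp K^T t i l * N l j) * coord v i j.
  by apply: eq_bigr => i _; apply: eq_bigr => j _; rewrite mxE.
apply: cvg_sumf => i _; apply: cvg_sumf => j _; apply: cvgM; last exact: cvg_cst.
apply: cvg_sumf => l _; apply: cvgM; last exact: cvg_cst.
exact: mexp_cvg.
Qed.

End Lift.
End ExponentialCurve.

(** * Integration by parts against the primitive of an integrable function *)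

Section IntegrationByParts.
Context {R : realType}.
Local Notation mu := (@lebesgue_measure R).
Local Notation TR := (measurableTypeR R).
Implicit Types (a b t T : R).

Lemma measurable_itvR a b : @measurable _ TR `[a, b]%classic.
Proof. exact: measurable_itv. Qed.

Lemma mu_itv_lty a b : (mu `[a, b]%classic < +oo)%E.
Proof. by rewrite lebesgue_measure_itv /=; case: ifP => _; rewrite ?ltry// -EFinB ltry. Qed.

Lemma continuous_integrable (f : R -> R) a b :
  (forall t, {for t, continuous f}) -> mu.-integrable `[a, b]%classic (EFin \o f).
Proof.
move=> cf; apply: continuous_compact_integrable; first exact: segment_compact.
exact: continuous_subspaceT.
Qed.

Lemma continuous_measurable (f : TR -> R) :
  (forall t : R, {for t, continuous f}) -> measurable_fun setT f.
Proof. by move=> cf; apply: continuous_measurable_fun. Qed.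

Lemma continuous_bounded (f : R -> R) a b : (forall t, {for t, continuous f}) ->
  exists C, forall t, `[a, b]%classic t -> `|f t| <= C.
Proof.
move=> cf; have [k _ hk] := continuous_itv_bounded (continuous_subspaceT (A := `[a, b]%classic) cf).
by exists k => t; rewrite /= in_itv /=; exact: hk.
Qed.

Lemma bounded_mul_integrable (f g : TR -> R) a b :
  (forall t : R, {for t, continuous f}) -> mu.-integrable `[a, b]%classic (EFin \o g) ->
  mu.-integrable `[a, b]%classic (EFin \o (fun t => f t * g t)).
Proof.
move=> cf gi; have [C hC] := continuous_bounded a b cf.
have mg : measurable_fun (`[a, b]%classic : set TR) g.
  by apply/measurable_EFinP; exact: measurable_int gi.
have mI := measurable_itvR a b.
have ci := integrableZl mI C gi.
refine (@le_integrable _ _ _ mu _ mI _ _ _ _ ci).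
  apply/measurable_EFinP; apply: measurable_funM => //.
  exact: (measurable_funTS (continuous_measurable cf)).
move=> t It /=; rewrite lee_fin !normrM ler_wpM2r//.
by rewrite (le_trans (hC t It))// ler_norm.
Qed.

Lemma ftc_itv (F f : R -> R) a b : a <= b ->
  (forall t, is_derive t 1 F (f t)) -> (forall t, {for t, continuous f}) ->
  \int[mu]_(t in `[a, b]) f t = F b - F a.
Proof.
rewrite le_eqVlt => /predU1P[->|ab] dF cf.
  by rewrite set_itv1 Rintegral_set1 subrr.
have cF t : {for t, continuous F} by exact: is_derive_continuous (dF t).
rewrite /Rintegral (continuous_FTC2 (F := F) ab)//.
- exact: continuous_subspaceT.
- split.
  + by move=> t _; have [] := dF t.
  + by apply: cvg_at_right_filter; exact: cF.
  + by apply: cvg_at_left_filter; exact: cF.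
- by move=> t _; rewrite derive1E; have [_ ->] := dF t.
Qed.

Section ByParts.
Variables (T : R) (psi alpha g : TR -> R).
Hypothesis dpsi : forall t : R, is_derive t 1 psi (- alpha t).
Hypothesis calpha : forall t : R, {for t, continuous alpha}.
Hypothesis gi : mu.-integrable `[0, T]%classic (EFin \o g).

Let r t : R := \int[mu]_(s in `[0, t]) g s.

Let S : set (TR * TR) := [set z | z.2 <= z.1].

Let mS : measurable S.
Proof.
have -> : S = (fun z : TR * TR => z.1 - z.2 : TR) @^-1` `[0, +oo[%classic.
  by apply/seteqP; split => z /=; rewrite in_itv /= andbT subr_ge0.
rewrite -[X in measurable X]setTI.
have mf : measurable_fun [set: TR * TR] (fun z : TR * TR => z.1 - z.2 : TR).
  by apply: measurable_funB; [exact: measurable_fst|exact: measurable_snd].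
apply: mf => //; exact: measurable_itv.
Qed.

Let k (z : TR * TR) : R := \1_S z.

Let mk : measurable_fun setT k.
Proof. exact: measurable_indic. Qed.

Let kE (t s : R) : k (t, s) = if s <= t then 1 else 0.
Proof.
rewrite /k indicE; case: ifPn => st; first by rewrite mem_set.
by rewrite memNset//= => /negP; rewrite (negbTE st).
Qed.

Let k_le z : `|k z| <= 1.
Proof. by case: z => t s; rewrite kE; case: ifP => _; rewrite ?normr1 ?normr0. Qed.

Let rE t : 0 <= t <= T -> r t = \int[mu]_(s in `[0, T]) (k (t, s) * g s).
Proof.
move=> /andP[t0 tT]; rewrite /r Rintegral_mkcond [RHS]Rintegral_mkcond.
apply: eq_Rintegral => s _; rewrite !patchE !mem_setE !in_itv /= kE.
case: (leP 0 s) => s0 //=; case: (leP s t) => st /=.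
  by rewrite (le_trans st tT) mul1r.
by rewrite mul0r; case: ifP.
Qed.

Let int_k_alpha s : 0 <= s <= T ->
  \int[mu]_(t in `[0, T]) (k (t, s) * alpha t) = psi s - psi T.
Proof.
move=> /andP[s0 sT].
transitivity (\int[mu]_(t in `[s, T]) alpha t).
  rewrite Rintegral_mkcond [RHS]Rintegral_mkcond.
  apply: eq_Rintegral => t _; rewrite !patchE !mem_setE !in_itv /= kE.
  case: (leP s t) => st /=; last by rewrite mul0r; case: ifP.
  by rewrite (le_trans s0 st) /= mul1r.
have dN (t : R) : is_derive t 1 (fun t => - psi t) (alpha t).
  by have := is_deriveN (dpsi t); rewrite opprK.
by rewrite (ftc_itv sT dN calpha) opprK addrC.
Qed.

Let mI : @measurable _ TR `[0, T]%classic.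
Proof. exact: measurable_itvR. Qed.

Let mg : measurable_fun (`[0, T]%classic : set TR) g.
Proof. by apply/measurable_EFinP; exact: measurable_int gi. Qed.

(** The primitive of g is bounded by the L^1 norm of g and measurable as a kernel integral. *)
Lemma by_parts_integrable : mu.-integrable `[0, T]%classic (EFin \o (fun t => alpha t * r t)).
Proof.
apply: (eq_integrable mI (EFin \o (fun t => alpha t * \int[mu]_(s in `[0, T]) (k (t, s) * g s)))).
  move=> t; rewrite inE /= in_itv /= => tT; congr EFin; congr (_ * _).
  by rewrite rE.
apply: bounded_mul_integrable => //.
apply: (@bounded_integrable _ _ _ (\int[mu]_(s in `[0, T]) `|g s|)) => //.
- exact: mu_itv_lty.
- apply: measurable_funTS; exact: measurable_kernel_int.
move=> t _.
have ikg : mu.-integrable `[0, T]%classic (EFin \o (fun s => k (t, s) * g s)).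
  refine (@le_integrable _ _ _ mu _ mI _ _ _ _ gi).
    apply/measurable_EFinP; apply: measurable_funM => //.
    exact: (measurable_funTS (measurable_fun_pair2 (t : TR) mk)).
  by move=> s _ /=; rewrite lee_fin normrM -[leRHS]mul1r ler_wpM2r.
apply: (le_trans (le_normr_Rintegral mI ikg)).
apply: le_Rintegral => //; [exact: (integrable_norm ikg)|exact: (integrable_norm gi)|].
by move=> s _; rewrite normrM -[leRHS]mul1r ler_wpM2r.
Qed.

(** g is merely integrable, so its primitive r cannot be differentiated everywhere. The order of
    integration over the triangle s <= t is exchanged instead, and the integral of alpha over [s, T]
    is psi s - psi T. *)
Lemma by_parts :
  \int[mu]_(t in `[0, T]) (alpha t * r t) =
  \int[mu]_(t in `[0, T]) (psi t * g t) - psi T * r T.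
Proof.
transitivity (\int[mu]_(t in `[0, T]) (alpha t * \int[mu]_(s in `[0, T]) (k (t, s) * g s))).
  by apply: eq_Rintegral => t; rewrite inE /= in_itv /= => tT; rewrite rE.
have ia : mu.-integrable `[0, T]%classic (EFin \o alpha) by exact: continuous_integrable.
rewrite (kernel_fubini (c := 1) mI mI mk k_le ia gi).
transitivity (\int[mu]_(s in `[0, T]) (psi s * g s - psi T * g s)).
  apply: eq_Rintegral => s; rewrite inE /= in_itv /= => sT.
  by rewrite int_k_alpha// mulrBr ![g s * _]mulrC.
have cpsi t : {for t, continuous psi} by exact: is_derive_continuous (dpsi t).
have i1 := bounded_mul_integrable cpsi gi.
have i2 := integrableZl mI (psi T) gi.
rewrite RintegralB; [|exact: mI|exact: i1|exact: i2].
by congr (_ - _); exact: (RintegralZl _ mI gi).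
Qed.

End ByParts.
End IntegrationByParts.

Section Admissible.
Context {R : realType} {n : nat}.
Local Notation mu := (@lebesgue_measure R).
Local Notation TR := (measurableTypeR R).
Implicit Types (u v : R -> R -> 'cV[R]_n) (T : R).

Lemma admissible_L2n T u t : admissible T u -> 0 <= t <= T -> L2n (u t).
Proof. by move=> [[Lu _] _] tT; apply: Lu; rewrite /= in_itv. Qed.

Lemma admissible_normn_integrable T u : admissible T u ->
  mu.-integrable `[0, T]%classic (EFin \o (fun t => normn (u t) ^+ 2)).
Proof.
move=> [mu_ fu]; apply/integrableP; split.
  apply/measurable_EFinP; apply: measurable_funX; exact: strongly_measurable_normn.
by under eq_integral do rewrite /= ger0_norm ?sqr_ge0//.
Qed.

(** On a bounded interval square integrability suffices: |<w, u>| is dominated by |w| (1 +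
    |u|^2). *)
Lemma admissible_ipn_integrable T u w : L2n w -> admissible T u ->
  mu.-integrable `[0, T]%classic (EFin \o (fun t => ipn w (u t))).
Proof.
move=> Lw au; have mI := measurable_itvR 0 T.
have i1 : mu.-integrable `[0, T]%classic (EFin \o cst 1).
  by apply: (@bounded_integrable _ _ _ 1) => //; [exact: mu_itv_lty|move=> x _; rewrite normr1].
have i2 := integrableZl mI (normn w) (integrableD mI i1 (admissible_normn_integrable au)).
refine (@le_integrable _ _ _ mu _ mI _ _ _ _ i2).
  by apply/measurable_EFinP; apply: strongly_measurable_ipn => //; case: au.
move=> t It /=; rewrite lee_fin (le_trans (cauchy_schwarz Lw (admissible_L2n au _)))//.
rewrite [leRHS]ger0_norm; last by rewrite mulr_ge0 ?addr_ge0 ?sqr_ge0 ?normn_ge0.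
rewrite ler_wpM2l ?normn_ge0//.
have := sqr_ge0 (normn (u t) - 1); have := normn_ge0 (u t); nra.
Qed.

Lemma admissibleB T u v : admissible T u -> admissible T v ->
  admissible T (fun t => v t - u t).
Proof.
move=> au av; split; first by apply: strongly_measurableB; [case: av|case: au].
have mI := measurable_itvR 0 T.
have i2 := integrableZl mI 2 (integrableD mI (admissible_normn_integrable au)
  (admissible_normn_integrable av)).
have le1 : (\int[mu]_(t in `[0%R, T]) (normn (v t - u t) ^+ 2)%:E <=
    \int[mu]_(t in `[0%R, T]) (2 * (normn (u t) ^+ 2 + normn (v t) ^+ 2))%:E)%E.
  apply: ge0_le_integral_nonmeas => t It; first by rewrite lee_fin sqr_ge0.
  have tT : 0 <= t <= T by move: It; rewrite /= in_itv.
  have Lu := admissible_L2n au tT; have Lv := admissible_L2n av tT.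
  rewrite lee_fin; have h1 := normnB Lv Lu; have h2 := normn_ge0 (v t - u t).
  have h3 : normn (v t - u t) ^+ 2 <= (normn (v t) + normn (u t)) ^+ 2.
    by rewrite lerXn2r ?nnegrE//; exact: le_trans h1.
  by have := sqr_ge0 (normn (u t) - normn (v t)); nra.
apply: (le_lt_trans le1); have /integrableP[_] := i2; apply: le_lt_trans.
by apply: ge0_le_integral_nonmeas => t _; rewrite ?lee_fin ?mulr_ge0 ?addr_ge0 ?sqr_ge0//= ler_norm.
Qed.

End Admissible.

(** * First variation of the cost along a finite family *)

Section FirstVariation.
Context {R : realType} {n p q : nat}.
Local Notation mu := (@lebesgue_measure R).
Local Notation TR := (measurableTypeR R).
Variable E : 'I_p -> 'I_q -> R -> 'cV[R]_n.
Hypothesis LE : forall i j, L2n (E i j).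
Variables (T : R) (T0 : 0 <= T) (KA KB KQ : 'M[R]_p).

Lemma continuous_mexp (K : 'M[R]_p) i j (t : R) :
  {for t, continuous (fun s => mexp K s i j)}.
Proof. by have /is_derive_mxP/(_ i j) := is_derive_mexp K t; exact: is_derive_continuous. Qed.

Section Weak.
Variables (h w : R -> R -> 'cV[R]_n).
Hypothesis ah : admissible T h.
Hypothesis wh : forall N t, 0 <= t <= T -> ipn (lift E N) (w t) =
  \int[mu]_(s in `[0, t]) ipn (lift E (KB^T *m (mexp KA^T (t - s) *m N))) (h s).

(** Hypothesis [wh] is the Duhamel formula with zero initial state, tested on lifts. The group law
    splits exp((t - s) KA) so that t leaves the integral, and [G] collects all that depends on s. *)
Let G s := mexp (- KA) s *m (KB *m coord E (h s)).

Let G_integrable i j : mu.-integrable `[0, T]%classic (EFin \o (fun s => G s i j)).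
Proof.
have -> : (fun s => G s i j) = fun s => \sum_k mexp (- KA) s i k * (\sum_l KB k l * ipn (E l j) (h s)).
  apply/funext => s; rewrite /G mxE; apply: eq_bigr => k _; congr (_ * _).
  by rewrite mxE; apply: eq_bigr => l _; rewrite mxE.
apply: integrable_sumf => [|k]; first exact: measurable_itvR.
apply: bounded_mul_integrable; first exact: continuous_mexp.
apply: integrable_sumf => [|l]; first exact: measurable_itvR.
exact: (integrableZl (measurable_itvR 0 T) (KB k l) (admissible_ipn_integrable (LE l j) ah)).
Qed.

Let pairG N t s : 0 <= s <= T ->
  ipn (lift E (KB^T *m (mexp KA^T (t - s) *m N))) (h s) = mxip (mexp KA^T t *m N) (G s).
Proof.
move=> sT; rewrite ipn_lift//; last exact: admissible_L2n ah sT.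
have -> : mexp KA^T (t - s) = mexp (- KA^T) s *m mexp KA^T t.
  apply: trmx_inj; rewrite trmx_mul !mexp_tr trmxK raddfN /= trmxK.
  exact: mexpB.
rewrite mxip_mull trmxK -mulmxA mxip_mull mexp_tr raddfN /= trmxK.
by [].
Qed.

Let r i j t : R := \int[mu]_(s in `[0, t]) G s i j.

Let ipn_w N t : 0 <= t <= T ->
  ipn (lift E N) (w t) = \sum_i \sum_j (mexp KA^T t *m N) i j * r i j t.
Proof.
move=> /[dup] tT /andP[t0 tT']; rewrite wh//.
have mI := measurable_itvR 0 t.
have Gt i j : mu.-integrable `[0, t]%classic (EFin \o (fun s => G s i j)).
  apply: (integrableS (measurable_itvR 0 T) mI _ (G_integrable i j)).
  by move=> s; rewrite /= !in_itv /= => /andP[-> st]; exact: le_trans st tT'.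
transitivity (\int[mu]_(s in `[0, t]) (\sum_i \sum_j (mexp KA^T t *m N) i j * G s i j)).
  apply: eq_Rintegral => s; rewrite inE /= in_itv /= => /andP[s0 st].
  by rewrite pairG// s0 (le_trans st).
have iG i j : mu.-integrable `[0, t]%classic
    (EFin \o (fun s => (mexp KA^T t *m N) i j * G s i j)).
  exact: (integrableZl mI ((mexp KA^T t *m N) i j) (Gt i j)).
rewrite Rintegral_sumf//; last by move=> i; exact: integrable_sumf.
apply: eq_bigr => i _; rewrite Rintegral_sumf//; apply: eq_bigr => j _.
by rewrite (RintegralZl _ mI (Gt i j)).
Qed.

Variables (X Y : R -> 'M[R]_(p, q)).
Hypothesis cX : forall i j (t : R), {for t, continuous (fun s => X s i j)}.
Hypothesis dY : forall t : R, is_derive t 1 Y (- (KQ *m X t) - KA^T *m Y t).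

Let psi t := mexp KA^T t *m Y t.
Let alpha t := mexp KA^T t *m (KQ *m X t).

Let dpsi (t : R) : is_derive t 1 psi (- alpha t).
Proof.
have e := is_derive_mulmx (is_derive_mexp KA^T t) (dY t).
apply: is_derive_eq e _.
rewrite mexp_comm -mulmxA -mulmxDr addrC subrK.
by rewrite mulmxN.
Qed.

Let dpsi_ij i j (t : R) : is_derive t 1 (fun s => psi s i j) (- alpha t i j).
Proof. by have /is_derive_mxP/(_ i j) := dpsi t; rewrite mxE. Qed.

Let calpha i j (t : R) : {for t, continuous (fun s => alpha s i j)}.
Proof.
have -> : (fun s => alpha s i j) =
    fun s => \sum_k mexp KA^T s i k * (\sum_l KQ k l * X s l j).
  apply/funext => s; rewrite mxE; apply: eq_bigr => k _; congr (_ * _).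
  by rewrite mxE.
apply: cvg_sumf => k _; apply: cvgM; first exact: continuous_mexp.
by apply: cvg_sumf => l _; apply: cvgM; [exact: cvg_cst|exact: cX].
Qed.

Let ipn_Xw t : 0 <= t <= T -> ipn (lift E (KQ *m X t)) (w t) =
  \sum_i \sum_j alpha t i j * r i j t.
Proof. exact: ipn_w. Qed.

Let ipn_Yh t : 0 <= t <= T -> ipn (lift E (KB^T *m Y t)) (h t) =
  \sum_i \sum_j psi t i j * G t i j.
Proof.
by move=> tT; have := pairG (Y t) t tT; rewrite subrr mexp0 mul1mx.
Qed.

Lemma variation_state_integrable :
  mu.-integrable `[0, T]%classic (EFin \o (fun t => ipn (lift E (KQ *m X t)) (w t))).
Proof.
have mI := measurable_itvR 0 T.
apply: (eq_integrable mI (EFin \o (fun t => \sum_i \sum_j alpha t i j * r i j t))).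
  by move=> t; rewrite inE /= in_itv /= => tT; rewrite ipn_Xw.
apply: integrable_sumf => // i; apply: integrable_sumf => // j.
exact: by_parts_integrable (@calpha i j) (G_integrable i j).
Qed.

Lemma variation_control_integrable :
  mu.-integrable `[0, T]%classic (EFin \o (fun t => ipn (lift E (KB^T *m Y t)) (h t))).
Proof.
have mI := measurable_itvR 0 T.
apply: (eq_integrable mI (EFin \o (fun t => \sum_i \sum_j psi t i j * G t i j))).
  by move=> t; rewrite inE /= in_itv /= => tT; rewrite ipn_Yh.
apply: integrable_sumf => // i; apply: integrable_sumf => // j.
apply: bounded_mul_integrable (G_integrable i j) => t.
exact: is_derive_continuous (dpsi_ij i j t).
Qed.

(* [w] is only a mild solution, so [<Y, w>] cannot be differentiated directly.
   Its coordinates are those of [e^{t KA^T} Y], which is smooth, paired with those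
   of the integral of [e^{-s KA} KB h], to which integration by parts applies. *)
Lemma first_variation :
  \int[mu]_(t in `[0, T]) ipn (lift E (KQ *m X t)) (w t)
  - \int[mu]_(t in `[0, T]) ipn (lift E (KB^T *m Y t)) (h t)
  + ipn (lift E (Y T)) (w T) = 0.
Proof.
have mI := measurable_itvR 0 T.
have i1 i j := by_parts_integrable (@calpha i j) (G_integrable i j).
have i2 i j : mu.-integrable `[0, T]%classic (EFin \o (fun t => psi t i j * G t i j)).
  apply: bounded_mul_integrable (G_integrable i j) => t.
  exact: is_derive_continuous (dpsi_ij i j t).
have -> : \int[mu]_(t in `[0, T]) ipn (lift E (KQ *m X t)) (w t) =
    \sum_i \sum_j \int[mu]_(t in `[0, T]) (alpha t i j * r i j t).
  transitivity (\int[mu]_(t in `[0, T]) (\sum_i \sum_j alpha t i j * r i j t)).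
    by apply: eq_Rintegral => t; rewrite inE /= in_itv /= => tT; rewrite ipn_Xw.
  rewrite Rintegral_sumf//; last by move=> i; exact: (integrable_sumf _ mI (i1 i)).
  by apply: eq_bigr => i _; exact: (Rintegral_sumf _ mI (i1 i)).
have -> : \int[mu]_(t in `[0, T]) ipn (lift E (KB^T *m Y t)) (h t) =
    \sum_i \sum_j \int[mu]_(t in `[0, T]) (psi t i j * G t i j).
  transitivity (\int[mu]_(t in `[0, T]) (\sum_i \sum_j psi t i j * G t i j)).
    by apply: eq_Rintegral => t; rewrite inE /= in_itv /= => tT; rewrite ipn_Yh.
  rewrite Rintegral_sumf//; last by move=> i; exact: (integrable_sumf _ mI (i2 i)).
  by apply: eq_bigr => i _; exact: (Rintegral_sumf _ mI (i2 i)).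
(* The terminal pairing is the sum of the terms psi(T) r(T), so integration by parts gives the
   identity separately for each pair of indices. *)
rewrite ipn_w ?T0 ?lexx// -sumrB -big_split big1// => i _.
rewrite -sumrB -big_split big1// => j _ /=.
rewrite (by_parts (dpsi_ij i j) (@calpha i j) (G_integrable i j)) -/(psi T).
rewrite -[\int[mu]_(s in `[0, T]) G s i j]/(r i j T).
by rewrite addrAC subrK subrr.
Qed.

End Weak.
End FirstVariation.

(** * Mild solutions: uniqueness, pairing with lifts, explicit solutions *)

Section MildSolutions.
Context {R : realType} {n : nat}.
Local Notation mu := (@lebesgue_measure R).
Local Notation TR := (measurableTypeR R).
Variables (c : R) (A B : R * R -> R) (La Da Lb Db : 'M[R]_n) (T : R).
Hypotheses (gA : graphon c A) (gB : graphon c B).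
Local Notation FA := (opn La Da A).
Local Notation FB := (opn Lb Db B).
Hypothesis expop_exists : forall t v, L2n v -> exists w, is_expop A La Da t v w.
Implicit Types (u v x y : R -> R -> 'cV[R]_n).

Lemma expop_is t (v : R -> 'cV[R]_n) : L2n v -> is_expop A La Da t v (expop FA t v).
Proof. by move=> Lv; have [w] := expop_exists t Lv; exact: expopP. Qed.

(** The formula started at time 0 is explicit in the control: the initial states agree almost
    everywhere and the Bochner integral is unique. *)
Lemma mild_unique (x0 : R -> 'cV[R]_n) u y y' : L2n x0 ->
  mild_solution T FA FB x0 u y -> mild_solution T FA FB x0 u y' ->
  forall t, 0 <= t <= T -> eqL2 (y t) (y' t).
Proof.
move=> Lx0 [Ly y0 ym] [Ly' y0' ym'] t /andP[t0 tT].
have [z bz ez] := ym 0 t (lexx _) t0 tT; have [z' bz' ez'] := ym' 0 t (lexx _) t0 tT.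
apply: (eqL2_trans ez); apply: eqL2_sym; apply: (eqL2_trans ez'); apply: eqL2_sym.
have T0 : 0 <= (0 : R) <= T by apply/andP; split; [exact: lexx|exact: le_trans tT].
apply: eqL2D; last exact: bochner_unique (measurable_itvR 0 t) (mu_itv_lty 0 t) bz bz'.
apply: (expopE gA); first exact: Ly.
apply: (is_expop_ae gA (Ly' 0 T0) (Ly 0 T0) _ (expop_is (t - 0) (Ly' 0 T0))).
by apply: (eqL2_trans y0'); exact: eqL2_sym.
Qed.

Section Pairing.
Context {p q : nat}.
Variable E : 'I_p -> 'I_q -> R -> 'cV[R]_n.
Hypothesis LE : forall i j, L2n (E i j).
Variables KA KB : 'M[R]_p.
Hypotheses (iA : intertwines E FA KA) (iB : intertwines E FB KB).

(** The form in which an arbitrary trajectory enters the optimality argument: both the exponential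
    and the control operator have been moved onto the test vector. *)
Lemma mild_pairing (x0 : R -> 'cV[R]_n) v y : L2n x0 -> admissible T v -> mild_solution T FA FB x0 v y ->
  forall N t, 0 <= t <= T ->
  mu.-integrable `[0, t]%classic
    (EFin \o (fun s => ipn (lift E (KB^T *m (mexp KA^T (t - s) *m N))) (v s))) /\
  ipn (lift E N) (y t) = ipn (lift E (mexp KA^T t *m N)) x0 +
    \int[mu]_(s in `[0, t]) ipn (lift E (KB^T *m (mexp KA^T (t - s) *m N))) (v s).
Proof.
move=> Lx0 av [Ly y0 ym] N t /andP[t0 tT].
have [z bz ez] := ym 0 t (lexx _) t0 tT.
have T0 : 0 <= (0 : R) <= T by apply/andP; split; [exact: lexx|exact: le_trans tT].
have mI := measurable_itvR 0 t.
have [ib eb] := bochner_pairing mI (mu_itv_lty 0 t) (L2n_lift LE N) bz.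
have es s : `[0, t]%classic s -> ipn (lift E N) (expop FA (t - s) (FB (v s))) =
    ipn (lift E (KB^T *m (mexp KA^T (t - s) *m N))) (v s).
  rewrite /= in_itv /= => /andP[s0 st].
  have Lv : L2n (v s) by apply: admissible_L2n av _; rewrite s0 (le_trans st).
  have LFB : L2n (FB (v s)) by exact: L2n_opn gB _ _ _ Lv.
  by rewrite (ipn_lift_expop LE gA iA N LFB (expop_is _ LFB)) iB.2.
split.
  by apply: (eq_integrable mI) ib => s; rewrite inE => Is /=; rewrite es.
have [Lz _ _] := bz; have L0 := Ly 0 T0.
have [Le _] := expop_is (t - 0) L0.
have Lyt : L2n (y t) by apply: Ly; rewrite t0.
have LN := L2n_lift LE N.
rewrite (ipn_ae LN LN Lyt (L2nD Le Lz) (eqL2_refl _) ez) ipnDr//; congr (_ + _).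
  rewrite (ipn_lift_expop LE gA iA N L0 (expop_is _ L0)) subr0.
  by apply: ipn_ae => //; [exact: L2n_lift|exact: L2n_lift|exact: eqL2_refl].
by rewrite eb; apply: eq_Rintegral => s; rewrite inE; exact: es.
Qed.

(** The initial state is common, so the free evolutions cancel; this is the hypothesis [wh] of the
    first variation. *)
Lemma mild_pairingB (x0 : R -> 'cV[R]_n) u v x y : L2n x0 -> admissible T u -> admissible T v ->
  mild_solution T FA FB x0 u x -> mild_solution T FA FB x0 v y ->
  forall N t, 0 <= t <= T -> ipn (lift E N) (y t - x t) =
  \int[mu]_(s in `[0, t]) ipn (lift E (KB^T *m (mexp KA^T (t - s) *m N))) (v s - u s).
Proof.
move=> Lx0 au av mx my N t tT; have /andP[t0 tT'] := tT.
have [iv ev] := mild_pairing Lx0 av my N tT.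
have [iu eu] := mild_pairing Lx0 au mx N tT.
have LN := L2n_lift LE N.
rewrite ipnBr//; [|by case: my => + _ _; exact|by case: mx => + _ _; exact].
rewrite ev eu opprD addrACA subrr add0r.
rewrite -(RintegralB (measurable_itvR 0 t) iv iu).
apply: eq_Rintegral => s; rewrite inE /= in_itv /= => /andP[s0 st].
have sT : 0 <= s <= T by rewrite s0 (le_trans st).
by rewrite ipnBr//; [exact: admissible_L2n av sT|exact: admissible_L2n au sT|exact: L2n_lift].
Qed.

End Pairing.

Lemma finite_rank_admissible (I : finType) (phi : I -> TR -> R) (e : I -> R -> 'cV[R]_n) y :
  (forall j (t : R), {for t, continuous (phi j)}) -> (forall j, L2n (e j)) ->
  (forall t, y t = \sum_j phi j t *: e j) -> admissible T y.
Proof.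
move=> cphi Le yE; have Ly t : L2n (y t).
  by rewrite yE; apply: L2n_sum => j _; exact: L2nZ.
have bphi j := continuous_bounded 0 T (cphi j).
have mphi j := continuous_measurable (cphi j).
split.
  apply: (finite_rank_strongly_measurable (phi := phi) (e := e)) => // t _.
  by rewrite yE; exact: eqL2_refl.
pose C := \sum_j projT1 (cid (bphi j)) * normn (e j).
have le1 : (\int[mu]_(t in `[0%R, T]) (normn (y t) ^+ 2)%:E <=
    \int[mu]_(t in `[0%R, T]) (cst (C ^+ 2)%:E t))%E.
  apply: ge0_le_integral_nonmeas => t It; first by rewrite lee_fin sqr_ge0.
  have h : normn (y t) <= C.
    rewrite yE; apply: (@le_trans _ _ (\sum_j normn (phi j t *: e j))).
      by apply: normn_sum => j _; exact: L2nZ.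
    apply: ler_sum => j _; rewrite normnZ// ler_wpM2r ?normn_ge0//.
    exact: (projT2 (cid (bphi j))).
  by rewrite lee_fin lerXn2r ?nnegrE ?normn_ge0// (le_trans _ h) ?normn_ge0.
apply: (le_lt_trans le1); rewrite integral_cst; last exact: measurable_itvR.
apply: lte_mul_pinfty => //; [by rewrite lee_fin sqr_ge0|exact: mu_itv_lty].
Qed.

Section TwoLifts.
Context {p1 q1 p2 q2 : nat}.
Variables (E1 : 'I_p1 -> 'I_q1 -> R -> 'cV[R]_n) (E2 : 'I_p2 -> 'I_q2 -> R -> 'cV[R]_n).
Hypotheses (LE1 : forall i j, L2n (E1 i j)) (LE2 : forall i j, L2n (E2 i j)).

(** Indexing both families by one sum type makes a sum of two lifts a single finite-rank curve, to
    which the Bochner lemmas apply. *)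
Definition phi2 (N1 : R -> 'M[R]_(p1, q1)) (N2 : R -> 'M[R]_(p2, q2))
    (j : ('I_p1 * 'I_q1) + ('I_p2 * 'I_q2)) (t : R) : R :=
  match j with inl ij => N1 t ij.1 ij.2 | inr ij => N2 t ij.1 ij.2 end.

Definition E12 (j : ('I_p1 * 'I_q1) + ('I_p2 * 'I_q2)) : R -> 'cV[R]_n :=
  match j with inl ij => E1 ij.1 ij.2 | inr ij => E2 ij.1 ij.2 end.

Lemma L2n_E12 j : L2n (E12 j).
Proof. by case: j => ij; [exact: LE1|exact: LE2]. Qed.

Lemma lift2E (M1 : 'M[R]_(p1, q1)) (M2 : 'M[R]_(p2, q2)) (g : _ -> R) :
  (forall i j, g (inl (i, j)) = M1 i j) -> (forall i j, g (inr (i, j)) = M2 i j) ->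
  \sum_j g j *: E12 j = lift E1 M1 + lift E2 M2.
Proof.
move=> g1 g2; rewrite big_sumType /= /lift !pair_big /=.
by congr (_ + _); apply: eq_bigr => -[i j] _ /=; rewrite ?g1 ?g2.
Qed.

Variables (KA1 KB1 : 'M[R]_p1) (KA2 KB2 : 'M[R]_p2).
Hypotheses (iA1 : intertwines E1 FA KA1) (iB1 : intertwines E1 FB KB1).
Hypotheses (iA2 : intertwines E2 FA KA2) (iB2 : intertwines E2 FB KB2).
Variables (X1 Y1 : R -> 'M[R]_(p1, q1)) (X2 Y2 : R -> 'M[R]_(p2, q2)).
Hypothesis dX1 : forall t : R, is_derive t 1 X1 (KA1 *m X1 t - KB1 *m (KB1^T *m Y1 t)).
Hypothesis dX2 : forall t : R, is_derive t 1 X2 (KA2 *m X2 t - KB2 *m (KB2^T *m Y2 t)).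
Hypothesis cY1 : forall i j (t : R), {for t, continuous (fun s => Y1 s i j)}.
Hypothesis cY2 : forall i j (t : R), {for t, continuous (fun s => Y2 s i j)}.

Let x t := lift E1 (X1 t) + lift E2 (X2 t).
Let u t := - (lift E1 (KB1^T *m Y1 t) + lift E2 (KB2^T *m Y2 t)).

Lemma continuous_cst_mulmx p q r (K : 'M[R]_(r, p)) (Y : R -> 'M[R]_(p, q)) i j (t : R) :
  (forall i j (t : R), {for t, continuous (fun s => Y s i j)}) ->
  {for t, continuous (fun s => (K *m Y s) i j)}.
Proof.
move=> cY; have -> : (fun s => (K *m Y s) i j) = fun s => \sum_k K i k * Y s k j.
  by apply/funext => s; rewrite mxE.
by apply: cvg_sumf => k _; apply: cvgM; [exact: cvg_cst|exact: cY].
Qed.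

Lemma mild_lifts_admissible : admissible T u.
Proof.
apply: (finite_rank_admissible (phi := phi2 (fun t => - KB1^T *m Y1 t) (fun t => - KB2^T *m Y2 t))
  (e := E12)) => [[] ij t| |t].
- exact: continuous_cst_mulmx.
- exact: continuous_cst_mulmx.
- exact: L2n_E12.
by rewrite (@lift2E (- KB1^T *m Y1 t) (- KB2^T *m Y2 t))// !mulNmx !liftN -opprD.
Qed.

(** exp((t - s) KA) X(s), with t fixed, has derivative [G] in s; the formula is the fundamental
    theorem of calculus on [a, t]. *)
Lemma variation_of_constants p q (KA KB : 'M[R]_p) (X Y : R -> 'M[R]_(p, q)) (a t : R) :
  (forall t : R, is_derive t 1 X (KA *m X t - KB *m (KB^T *m Y t))) ->
  (forall i j (t : R), {for t, continuous (fun s => Y s i j)}) -> a <= t ->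
  let G s := mexp KA (t - s) *m (- (KB *m (KB^T *m Y s))) in
  (forall i j (s : R), {for s, continuous (fun s => G s i j)}) /\
  X t = mexp KA (t - a) *m X a + \matrix_(i, j) \int[mu]_(s in `[a, t]) G s i j.
Proof.
move=> dX cY at_ G.
pose F s := mexp KA t *m (mexp (- KA) s *m X s).
have dF (s : R) : is_derive s 1 F (G s).
  have h := is_derive_cst_mulmx (mexp KA t) (is_derive_mulmx (is_derive_mexp (- KA) s) (dX s)).
  apply: is_derive_eq h _.
  rewrite /G mexpB -mulmxA; congr (_ *m _).
  rewrite mexp_comm -(mulmxA _ (- KA)) -mulmxDr; congr (_ *m _).
  by rewrite mulNmx addKr.
have cG i j (s : R) : {for s, continuous (fun s => G s i j)}.
  have -> : (fun s => G s i j) =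
      fun s => \sum_k (mexp KA t *m mexp (- KA) s) i k * ((- (KB *m KB^T)) *m Y s) k j.
    apply/funext => r; rewrite /G mexpB mxE; apply: eq_bigr => k _.
    by rewrite mulNmx mulmxA.
  apply: cvg_sumf => k _; apply: cvgM; apply: continuous_cst_mulmx => //.
  by move=> ? ? ?; exact: continuous_mexp.
split=> //.
have -> : \matrix_(i, j) \int[mu]_(s in `[a, t]) G s i j = F t - F a.
  apply/matrixP => i j; rewrite mxE (ftc_itv (F := fun s => F s i j) at_ _ (cG i j)).
    by rewrite !mxE.
  by move=> s; have /is_derive_mxP/(_ i j) := dF s.
by rewrite /F !mulmxA mexpVK mul1mx -mexpB addrC subrK.
Qed.

Lemma mild_lifts : mild_solution T FA FB (x 0) u x.
Proof.
have Lx t : L2n (x t) by apply: L2nD; exact: L2n_lift.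
split; first by move=> t _; exact: Lx.
  exact: eqL2_refl.
move=> a t a0 at_ tT.
pose G1 s := mexp KA1 (t - s) *m (- (KB1 *m (KB1^T *m Y1 s))).
have [cG1 e1] : (forall i j (s : R), {for s, continuous (fun s => G1 s i j)}) /\
  X1 t = mexp KA1 (t - a) *m X1 a + \matrix_(i, j) \int[mu]_(s in `[a, t]) G1 s i j.
  exact: variation_of_constants.
pose G2 s := mexp KA2 (t - s) *m (- (KB2 *m (KB2^T *m Y2 s))).
have [cG2 e2] : (forall i j (s : R), {for s, continuous (fun s => G2 s i j)}) /\
  X2 t = mexp KA2 (t - a) *m X2 a + \matrix_(i, j) \int[mu]_(s in `[a, t]) G2 s i j.
  exact: variation_of_constants.
have LFBu s : L2n (FB (u s)).
  by apply: L2n_opn gB _ _ _ _; apply: L2nN; apply: L2nD; exact: L2n_lift.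
have FBu s : eqL2 (FB (u s)) (lift E1 (- (KB1 *m (KB1^T *m Y1 s))) + lift E2 (- (KB2 *m (KB2^T *m Y2 s)))).
  rewrite /u opprD -!liftN -!mulmxN.
  apply: (eqL2_trans (v := FB (lift E1 (KB1^T *m - Y1 s)) + FB (lift E2 (KB2^T *m - Y2 s)))).
    exact: (@iter_opnD R n c B Lb Db gB _ _ 1%N (L2n_lift LE1 _) (L2n_lift LE2 _)).
  by apply: eqL2D; [exact: iB1.1|exact: iB2.1].
(* Stated for any vector almost everywhere equal to a sum of lifts, because [FB (u s)] is such a sum
   only modulo a null set. *)
have ex r M1 M2 (v : R -> 'cV[R]_n) : L2n v -> eqL2 v (lift E1 M1 + lift E2 M2) ->
    eqL2 (expop FA r v) (lift E1 (mexp KA1 r *m M1) + lift E2 (mexp KA2 r *m M2)).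
  move=> Lv ev; apply: (expopE gA) => //.
  have Ll : L2n (lift E1 M1 + lift E2 M2) by apply: L2nD; exact: L2n_lift.
  apply: (is_expop_ae gA Ll Lv (eqL2_sym ev)).
  apply: (is_expop_add gA (L2n_lift LE1 _) (L2n_lift LE2 _)).
    exact: (is_expop_lift LE1 gA iA1).
  exact: (is_expop_lift LE2 gA iA2).
exists (\sum_j (\int[mu]_(s in `[a, t]) phi2 G1 G2 j s) *: E12 j).
  apply: (finite_rank_bochner (D := `[a, t]%classic)).
  - exact: measurable_itvR.
  - exact: mu_itv_lty.
  - by case=> ij; apply: continuous_measurable; [exact: cG1|exact: cG2].
  - by case=> ij; apply: continuous_bounded; [exact: cG1|exact: cG2].
  - exact: L2n_E12.
  - by move=> s _; have [] := expop_is (t - s) (LFBu s).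
  - move=> s _; rewrite (@lift2E (G1 s) (G2 s))//.
    exact: ex (LFBu s) (FBu s).
rewrite (@lift2E (\matrix_(i, j) \int[mu]_(s in `[a, t]) G1 s i j)
  (\matrix_(i, j) \int[mu]_(s in `[a, t]) G2 s i j)); last 2 first.
- by move=> i j; rewrite mxE.
- by move=> i j; rewrite mxE.
rewrite /x e1 e2 !liftD addrACA; refine (eqL2D _ (eqL2_refl _)).
apply: eqL2_sym; apply: ex; [exact: Lx|exact: eqL2_refl].
Qed.

End TwoLifts.
End MildSolutions.

(** * The components along S and its orthogonal *)

Section FamilyLifts.
Context {R : realType} {n : nat}.

Lemma sum_tens (V : nmodType) d (F : 'I_(d * n) -> V) :
  \sum_k F k = \sum_l \sum_i F (mxtens_index (l, i)).
Proof.
rewrite pair_big /=.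
rewrite (reindex (@mxtens_index d n)) /=; last first.
  by exists (@mxtens_unindex d n) => k _; [exact: mxtens_indexK|exact: mxtens_unindexK].
by apply: eq_bigr => -[l i] _.
Qed.

Section GopSum.
Variables (c : R) (A : R * R -> R).
Hypothesis gA : graphon c A.

Lemma gop_sum (I : Type) (r : seq I) (k : I -> R) (g : I -> R -> R) a :
  (forall i, L2 (g i)) -> I01 a ->
  gop A (fun x => \sum_(i <- r) k i * g i x) a = \sum_(i <- r) k i * gop A (g i) a.
Proof.
move=> Lg Ia; elim: r => [|i r IH].
  rewrite big_nil /gop; under eq_Rintegral do rewrite big_nil mulr0.
  by rewrite /Rintegral integral0.
rewrite big_cons -IH -(gop_lin gA)//; last by apply: L2_sum => j _; exact: L2Z.
by apply: eq_Rintegral => b _; rewrite big_cons.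
Qed.

End GopSum.

Section FamilyTensor.
Context {d : nat}.
Variable f : 'I_d -> R -> R.
Hypothesis Lf : forall l, L2 (f l).

(** The vectors f_l e_i in the order of the Kronecker product; the second index has a single value,
    so coefficients are columns of R^{nd}. *)
Definition tensor_family (k : 'I_(d * n)) (_ : 'I_1) : R -> 'cV[R]_n :=
  fun a => f (mxtens_unindex k).1 a *: delta_mx (mxtens_unindex k).2 0.

Lemma lift_tensorE (N : 'cV[R]_(d * n)) :
  lift tensor_family N = fun a => \sum_(l < d) f l a *: block N l.
Proof.
apply/funext => a; rewrite /lift fct_sumE sum_tens; apply: eq_bigr => l _.
rewrite (_ : block N l = \sum_i (block N l) i 0 *: delta_mx i 0); last first.
  by rewrite [LHS]matrix_sum_delta; apply: eq_bigr => i _; rewrite big_ord1.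
rewrite scaler_sumr; apply: eq_bigr => i _.
rewrite big_ord1 /tensor_family mxtens_indexK /= mxE.
by rewrite -[LHS]/(_ *: (_ *: _)) !scalerA mulrC.
Qed.

Lemma coordf_lift_tensor N i :
  coordf (lift tensor_family N) i = fun a => \sum_l N (mxtens_index (l, i)) 0 * f l a.
Proof.
apply/funext => a; rewrite /coordf lift_tensorE summxE; apply: eq_bigr => l _.
by rewrite !mxE mulrC.
Qed.

Lemma L2n_tensor k j : L2n (tensor_family k j).
Proof.
move=> i; apply: L2_ext (L2Z (delta_mx (mxtens_unindex k).2 (0 : 'I_1) i 0) (Lf (mxtens_unindex k).1)) => a _.
by rewrite /coordf /tensor_family !mxE mulrC.
Qed.

Lemma coord_tensor w : L2n w -> coord tensor_family w = Projf f w.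
Proof.
move=> Lw; apply/matrixP => k j; rewrite !mxE /ipn (bigD1 (mxtens_unindex k).2)//=.
rewrite big1 ?addr0.
  by rewrite ipC; apply: ip_ext => // a _; rewrite /coordf /tensor_family !mxE !eqxx mulr1.
move=> i ik; rewrite -[RHS](ip0l (coordf w i)); apply: ip_ext => // a _.
by rewrite /coordf /tensor_family !mxE (negbTE ik) mulr0.
Qed.

Variables (c : R) (A : R * R -> R) (gm : 'M[R]_d).
Hypothesis gA : graphon c A.
Hypothesis gm_sym : gm^T = gm.
Hypothesis Af : forall l, eqL2 (gop A (f l)) (fun a => \sum_k gm l k * f k a).

Lemma kron_opE (L D : 'M[R]_n) (N : 'cV[R]_(d * n)) l i :
  (kron_op L D gm *m N) (mxtens_index (l, i)) 0 =
  \sum_j L i j * N (mxtens_index (l, j)) 0 +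
  \sum_j D i j * \sum_k gm l k * N (mxtens_index (k, j)) 0.
Proof.
rewrite /kron_op mulmxDl mxE; congr (_ + _).
  rewrite mxE sum_tens (bigD1 l)//= [X in _ + X]big1 ?addr0; last first.
    move=> k kl; rewrite big1// => j _.
    by rewrite tensmxE mxE eq_sym (negbTE kl) mulr0n !mul0r.
  by apply: eq_bigr => j _; rewrite tensmxE mxE eqxx mul1r.
rewrite mxE sum_tens exchange_big; apply: eq_bigr => j _; rewrite mulr_sumr.
by apply: eq_bigr => k _; rewrite tensmxE; ring.
Qed.

(** Expanding A f_l along row l of [gm] acts on coefficients through the transpose of [gm]; its
    symmetry gives [gm] itself. *)
Lemma opn_lift_tensor (L D : 'M[R]_n) N :
  eqL2 (opn L D A (lift tensor_family N)) (lift tensor_family (kron_op L D gm *m N)).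
Proof.
have H := eqL2_all Af.
apply: coordf_eqL2 => i; apply: filterS H => a Ha Ia.
rewrite coordf_opn !coordf_lift_tensor.
under [RHS]eq_bigr do rewrite kron_opE mulrDl.
rewrite big_split /=; congr (_ + _).
  rewrite (eq_bigr (fun j => \sum_l L i j * N (mxtens_index (l, j)) 0 * f l a)).
    by rewrite exchange_big; apply: eq_bigr => l _; rewrite mulr_suml.
  move=> j _; rewrite coordf_lift_tensor mulr_sumr.
  by apply: eq_bigr => l _; rewrite mulrA.
under [RHS]eq_bigr do rewrite mulr_suml.
rewrite exchange_big; apply: eq_bigr => j _.
rewrite coordf_lift_tensor (gop_sum gA _ (fun l => N (mxtens_index (l, j)) 0))//.
have -> : \sum_l N (mxtens_index (l, j)) 0 * gop A (f l) a =
    \sum_l \sum_k N (mxtens_index (l, j)) 0 * (gm l k * f k a).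
  by apply: eq_bigr => l _; rewrite Ha// mulr_sumr.
rewrite exchange_big mulr_sumr; apply: eq_bigr => k _.
rewrite !mulr_sumr mulr_suml; apply: eq_bigr => l _.
by rewrite -{1}gm_sym mxE; ring.
Qed.

Lemma kron_op_tr (L D : 'M[R]_n) : (kron_op L D gm)^T = kron_op L^T D^T gm.
Proof. by rewrite /kron_op linearD /= !trmx_tens trmx1 gm_sym. Qed.

Lemma intertwines_tensor (L D : 'M[R]_n) :
  intertwines tensor_family (opn L D A) (kron_op L D gm).
Proof.
split; first exact: opn_lift_tensor.
move=> N u Lu; have LN := L2n_lift L2n_tensor N.
rewrite ipnC (ipn_opn gA)// ipnC; apply: ipn_ae => //.
- exact: L2n_opn gA _ _ _ LN.
- exact: L2n_lift L2n_tensor _.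
- by rewrite kron_op_tr; exact: opn_lift_tensor.
- exact: eqL2_refl.
Qed.

End FamilyTensor.

Section OrthogonalLift.
Variable v : R -> 'cV[R]_n.
Hypothesis Lv : L2n v.

(* Its lifts are the curves [N v]: with [v] the component of the initial state in
   (S^perp)^n, the corresponding component of the state at time t is [X(t) v] for
   an n x n matrix [X(t)]. *)
Definition mulmx_family (i j : 'I_n) : R -> 'cV[R]_n := fun a => v a j 0 *: delta_mx i 0.

Lemma lift_mulmxE (N : 'M[R]_n) : lift mulmx_family N = fun a => N *m v a.
Proof.
apply/funext => a; apply/matrixP => i j; rewrite ord1 mxE.
rewrite /lift fct_sumE summxE (bigD1 i)//= [X in _ + X]big1 ?addr0; last first.
  move=> k ki; rewrite fct_sumE summxE big1// => l _.
  by rewrite !mxE eq_sym (negbTE ki) !mulr0.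
rewrite fct_sumE summxE; apply: eq_bigr => l _.
by rewrite !mxE !eqxx mulr1.
Qed.

Lemma coordf_lift_mulmx N i :
  coordf (lift mulmx_family N) i = fun a => \sum_l N i l * coordf v l a.
Proof. by apply/funext => a; rewrite /coordf lift_mulmxE mxE. Qed.

Lemma L2n_mulmx_family i j : L2n (mulmx_family i j).
Proof.
move=> k; apply: L2_ext (L2Z (delta_mx i (0 : 'I_1) k 0) (Lv j)) => a _.
by rewrite /coordf /mulmx_family !mxE mulrC.
Qed.

Variables (c : R) (A : R * R -> R).
Hypothesis gA : graphon c A.
Hypothesis Av : forall l, eqL2 (gop A (coordf v l)) (fun=> 0).

Lemma opn_lift_mulmx (L D : 'M[R]_n) N :
  eqL2 (opn L D A (lift mulmx_family N)) (lift mulmx_family (L *m N)).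
Proof.
have H := eqL2_all Av.
apply: coordf_eqL2 => i; apply: filterS H => a Ha Ia.
rewrite coordf_opn coordf_lift_mulmx [X in _ + X]big1 ?addr0.
  under eq_bigr do rewrite coordf_lift_mulmx mulr_sumr.
  rewrite exchange_big; apply: eq_bigr => l _; rewrite mxE mulr_suml.
  by apply: eq_bigr => j _; rewrite mulrA.
move=> j _; rewrite coordf_lift_mulmx (gop_sum gA _ (N j))// big1 ?mulr0// => l _.
by rewrite Ha// mulr0.
Qed.

Lemma intertwines_mulmx (L D : 'M[R]_n) :
  intertwines mulmx_family (opn L D A) L.
Proof.
split; first exact: opn_lift_mulmx.
move=> N u Lu; have LN := L2n_lift L2n_mulmx_family N.
rewrite ipnC (ipn_opn gA)// ipnC; apply: ipn_ae => //.
- exact: L2n_opn gA _ _ _ LN.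
- exact: L2n_lift L2n_mulmx_family _.
- exact: opn_lift_mulmx.
- exact: eqL2_refl.
Qed.

End OrthogonalLift.
End FamilyLifts.

(** * Optimality *)

Section Optimality.
Context {R : realType} {n : nat}.
Local Notation mu := (@lebesgue_measure R).
Local Notation TR := (measurableTypeR R).
Variables (c : R) (A B Q QT : R * R -> R) (La Da Lb Db Lq Dq LqT DqT : 'M[R]_n) (T : R).
Hypotheses (gA : graphon c A) (gB : graphon c B) (gQ : graphon c Q) (gQT : graphon c QT).
Hypothesis T0 : 0 <= T.
Local Notation FA := (opn La Da A).
Local Notation FB := (opn Lb Db B).
Local Notation FQ := (opn Lq Dq Q).
Local Notation FQT := (opn LqT DqT QT).
Hypothesis expop_exists : forall t v, L2n v -> exists w, is_expop A La Da t v w.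
Hypotheses (Q_sa : self_adjoint FQ) (Q_ge0 : nonnegative FQ).
Hypotheses (QT_sa : self_adjoint FQT) (QT_ge0 : nonnegative FQT).

(** The gradient inequality of a convex quadratic form: self-adjointness merges the two cross terms
    of the expansion at x, and the nonnegative term in w is dropped. *)
Lemma quadratic_lower_bound (L D : 'M[R]_n) (K : R * R -> R) (x w y : R -> 'cV[R]_n) :
  graphon c K -> self_adjoint (opn L D K) -> nonnegative (opn L D K) ->
  L2n x -> L2n y -> w = y - x ->
  ipn x (opn L D K x) + 2 * ipn (opn L D K x) w <= ipn y (opn L D K y).
Proof.
move=> gK sa ge0 Lx Ly ->; have Lw := L2nB Ly Lx; set w' := y - x in Lw *.
have LFx : L2n (opn L D K x) by exact: L2n_opn gK _ _ _ Lx.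
have LFw : L2n (opn L D K w') by exact: L2n_opn gK _ _ _ Lw.
have LFy : L2n (opn L D K y) by exact: L2n_opn gK _ _ _ Ly.
have yE : y = x + w' by rewrite /w' addrC subrK.
have e : eqL2 (opn L D K y) (opn L D K x + opn L D K w').
  by rewrite {1}yE; exact: (@iter_opnD R n c K L D gK _ _ 1%N Lx Lw).
have e0 : eqL2 y (x + w') by rewrite -yE; exact: eqL2_refl.
rewrite (ipn_ae Ly (L2nD Lx Lw) LFy (L2nD LFx LFw) e0 e) ipnDl//; last exact: L2nD.
rewrite (ipnDr LFx LFw Lx) (ipnDr LFx LFw Lw) -(sa _ _ Lx Lw) (ipnC w' (opn L D K x)) -/w'.
have := ge0 _ Lw; set a := ipn _ _; set b := ipn _ _; set d := ipn _ _; lra.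
Qed.

(** a and u are the state and control costs of the candidate, y the state cost of the competitor, s
    and d the pairings with the variations of state and control, and m the squared distance of the
    controls. *)
Let integrand_arith (a y u s d m : R) : a + 2 * s <= y ->
  a + u + (2 * (s - d) + m) <= y + (u - 2 * d + m).
Proof. lra. Qed.

(** The two equations are the first variations along S and S^perp; together they cancel every term
    linear in the variation. *)
Let cost_arith (b m s1 s2 d1 d2 e1 e2 xT yT : R) :
  s1 - d1 + e1 = 0 -> s2 - d2 + e2 = 0 -> xT + 2 * (e1 + e2) <= yT ->
  b + xT + m <= b + (2 * (s1 + s2 - (d1 + d2)) + m) + yT.
Proof. lra. Qed.

Section TwoLiftsOptimality.
Context {p1 q1 p2 q2 : nat}.
Variables (E1 : 'I_p1 -> 'I_q1 -> R -> 'cV[R]_n) (E2 : 'I_p2 -> 'I_q2 -> R -> 'cV[R]_n).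
Hypotheses (LE1 : forall i j, L2n (E1 i j)) (LE2 : forall i j, L2n (E2 i j)).
Variables (KA1 KB1 KQ1 KT1 : 'M[R]_p1) (KA2 KB2 KQ2 KT2 : 'M[R]_p2).
Hypotheses (iA1 : intertwines E1 FA KA1) (iB1 : intertwines E1 FB KB1).
Hypotheses (iQ1 : intertwines E1 FQ KQ1) (iT1 : intertwines E1 FQT KT1).
Hypotheses (iA2 : intertwines E2 FA KA2) (iB2 : intertwines E2 FB KB2).
Hypotheses (iQ2 : intertwines E2 FQ KQ2) (iT2 : intertwines E2 FQT KT2).
Variables (X1 Y1 : R -> 'M[R]_(p1, q1)) (X2 Y2 : R -> 'M[R]_(p2, q2)).
Hypothesis dX1 : forall t : R, is_derive t 1 X1 (KA1 *m X1 t - KB1 *m (KB1^T *m Y1 t)).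
Hypothesis dX2 : forall t : R, is_derive t 1 X2 (KA2 *m X2 t - KB2 *m (KB2^T *m Y2 t)).
Hypothesis dY1 : forall t : R, is_derive t 1 Y1 (- (KQ1 *m X1 t) - KA1^T *m Y1 t).
Hypothesis dY2 : forall t : R, is_derive t 1 Y2 (- (KQ2 *m X2 t) - KA2^T *m Y2 t).
Hypotheses (YT1 : Y1 T = KT1 *m X1 T) (YT2 : Y2 T = KT2 *m X2 T).
Variable x0 : R -> 'cV[R]_n.
Hypothesis Lx0 : L2n x0.

Definition opt_state t := lift E1 (X1 t) + lift E2 (X2 t).
Definition opt_control t := - (lift E1 (KB1^T *m Y1 t) + lift E2 (KB2^T *m Y2 t)).
Hypothesis x0E : eqL2 (opt_state 0) x0.

Local Notation x := opt_state.
Local Notation u := opt_control.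

Let cmx p q (Z dZ : R -> 'M[R]_(p, q)) i j (t : R) :
  (forall t : R, is_derive t 1 Z (dZ t)) -> {for t, continuous (fun s => Z s i j)}.
Proof. by move=> h; have /is_derive_mxP/(_ i j) := h t; exact: is_derive_continuous. Qed.

Let cX1 i j (t : R) : {for t, continuous (fun s => X1 s i j)}.
Proof. exact: cmx dX1. Qed.
Let cX2 i j (t : R) : {for t, continuous (fun s => X2 s i j)}.
Proof. exact: cmx dX2. Qed.
Let cY1 i j (t : R) : {for t, continuous (fun s => Y1 s i j)}.
Proof. exact: cmx dY1. Qed.
Let cY2 i j (t : R) : {for t, continuous (fun s => Y2 s i j)}.
Proof. exact: cmx dY2. Qed.

Lemma opt_control_admissible : admissible T u.
Proof. exact: mild_lifts_admissible LE1 LE2 _ _ _ _ cY1 cY2. Qed.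

Lemma opt_state_mild : mild_solution T FA FB x0 u x.
Proof.
have [h1 h2 h3] := mild_lifts T gA gB expop_exists LE1 LE2 iA1 iB1 iA2 iB2 dX1 dX2 cY1 cY2.
by split; [exact: h1|exact: x0E|exact: h3].
Qed.

Let Lx t : L2n (x t).
Proof. by apply: L2nD; exact: L2n_lift. Qed.

Let Lu t : L2n (u t).
Proof. by apply: L2nN; apply: L2nD; exact: L2n_lift. Qed.

Let opn_x (L D : 'M[R]_n) (K : R * R -> R) K1 K2 t : graphon c K ->
  intertwines E1 (opn L D K) K1 -> intertwines E2 (opn L D K) K2 ->
  eqL2 (opn L D K (x t)) (lift E1 (K1 *m X1 t) + lift E2 (K2 *m X2 t)).
Proof.
move=> gK i1 i2.
apply: (eqL2_trans (v := opn L D K (lift E1 (X1 t)) + opn L D K (lift E2 (X2 t)))).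
  exact: (@iter_opnD R n c K L D gK _ _ 1%N (L2n_lift LE1 _) (L2n_lift LE2 _)).
by apply: eqL2D; [exact: i1.1|exact: i2.1].
Qed.

Let base t := ipn (x t) (FQ (x t)) + ipn (u t) (u t).

(** Over the merged family the pairing is a finite double sum of continuous coefficients times
    constants, cross terms between the two families included. *)
Let continuous_ipn (M1 N1 : R -> 'M[R]_(p1, q1)) (M2 N2 : R -> 'M[R]_(p2, q2)) (t : R) :
  (forall i j (t : R), {for t, continuous (fun s => M1 s i j)}) ->
  (forall i j (t : R), {for t, continuous (fun s => N1 s i j)}) ->
  (forall i j (t : R), {for t, continuous (fun s => M2 s i j)}) ->
  (forall i j (t : R), {for t, continuous (fun s => N2 s i j)}) ->
  {for t, continuous (fun s =>
    ipn (lift E1 (M1 s) + lift E2 (M2 s)) (lift E1 (N1 s) + lift E2 (N2 s)))}.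
Proof.
move=> cM1 cN1 cM2 cN2.
have LE12 := L2n_E12 LE1 LE2.
have -> : (fun s => ipn (lift E1 (M1 s) + lift E2 (M2 s)) (lift E1 (N1 s) + lift E2 (N2 s))) =
    fun s => \sum_j \sum_k (phi2 M1 M2 j s * phi2 N1 N2 k s) * ipn (E12 E1 E2 j) (E12 E1 E2 k).
  apply/funext => s.
  rewrite -(@lift2E _ _ _ _ _ _ E1 E2 (M1 s) (M2 s) (phi2 M1 M2 ^~ s))//.
  rewrite -(@lift2E _ _ _ _ _ _ E1 E2 (N1 s) (N2 s) (phi2 N1 N2 ^~ s))//.
  have LN : L2n (\sum_j phi2 N1 N2 j s *: E12 E1 E2 j) by apply: L2n_sum => j _; exact: L2nZ.
  rewrite ipn_suml//; last by move=> j _; exact: L2nZ.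
  apply: eq_bigr => j _; rewrite ipnZl// ipn_sumr//; last by move=> k _; exact: L2nZ.
  by rewrite mulr_sumr; apply: eq_bigr => k _; rewrite ipnZr// mulrA.
apply: cvg_sumf => j _; apply: cvg_sumf => k _; apply: cvgM; last exact: cvg_cst.
apply: cvgM.
  by case: j => ij; [exact: cM1|exact: cM2].
by case: k => ij; [exact: cN1|exact: cN2].
Qed.

Let base_integrable : mu.-integrable `[0, T]%classic (EFin \o base).
Proof.
have mI := measurable_itvR 0 T.
pose b1 t := ipn (lift E1 (X1 t) + lift E2 (X2 t)) (lift E1 (KQ1 *m X1 t) + lift E2 (KQ2 *m X2 t)).
pose b2 t := ipn (lift E1 (KB1^T *m Y1 t) + lift E2 (KB2^T *m Y2 t))
   (lift E1 (KB1^T *m Y1 t) + lift E2 (KB2^T *m Y2 t)).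
have -> : EFin \o base = ((EFin \o b1) \+ (EFin \o b2))%E.
  apply/funext => t; rewrite /= -EFinD; congr EFin; rewrite /base; congr (_ + _).
    have LF : L2n (FQ (x t)) by exact: L2n_opn gQ _ _ _ (Lx t).
    have Ll := L2nD (L2n_lift LE1 (KQ1 *m X1 t)) (L2n_lift LE2 (KQ2 *m X2 t)).
    exact: (ipn_ae (Lx t) (Lx t) LF Ll (eqL2_refl _) (opn_x t gQ iQ1 iQ2)).
  have Ll : L2n (lift E1 (KB1^T *m Y1 t) + lift E2 (KB2^T *m Y2 t)).
    by apply: L2nD; exact: L2n_lift.
  by rewrite /u /opt_control ipnNl ?ipnNr ?opprK//; exact: L2nN.
apply: (integrableD mI); apply: continuous_integrable => t.
  by apply: continuous_ipn => // i j s; exact: continuous_cst_mulmx.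
by apply: continuous_ipn => i j s; exact: continuous_cst_mulmx.
Qed.

(** Costs are extended reals; finiteness of this one is what allows it to be subtracted in the
    uniqueness argument. *)
Lemma opt_cost_fin : cost T FQ FQT x u =
  (\int[mu]_(t in `[0, T]) base t + ipn (x T) (FQT (x T)))%:E.
Proof.
rewrite EFinD /Rintegral fineK//.
exact: (integrable_fin_num (measurable_itvR 0 T) base_integrable).
Qed.

Lemma opt_cost_le v y : admissible T v -> mild_solution T FA FB x0 v y ->
  (cost T FQ FQT x u + (\int[mu]_(t in `[0, T]) (normn (v t - u t) ^+ 2))%:E <=
   cost T FQ FQT y v)%E.
Proof.
move=> av my; have mI := measurable_itvR 0 T.
have au := opt_control_admissible; have ah := admissibleB au av.
have mx := opt_state_mild.
pose w t := y t - x t; pose h t := v t - u t.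
have TT : 0 <= T <= T by rewrite T0 lexx.
have Ly t : 0 <= t <= T -> L2n (y t) by case: my => + _ _; exact.
have Lw t : 0 <= t <= T -> L2n (w t) by move=> tT; apply: L2nB => //; exact: Ly.
have Lh t : 0 <= t <= T -> L2n (h t) by move=> tT; exact: admissible_L2n ah tT.
have wh1 := mild_pairingB gA gB expop_exists LE1 iA1 iB1 Lx0 au av mx my.
have wh2 := mild_pairingB gA gB expop_exists LE2 iA2 iB2 Lx0 au av mx my.
have s1 := variation_state_integrable LE1 KQ1 ah wh1 (@cX1).
have s2 := variation_state_integrable LE2 KQ2 ah wh2 (@cX2).
have k1 := variation_control_integrable LE1 KB1 ah dY1.
have k2 := variation_control_integrable LE2 KB2 ah dY2.
have V1 := first_variation LE1 T0 ah wh1 (@cX1) dY1.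
have V2 := first_variation LE2 T0 ah wh2 (@cX2) dY2.
pose S1 t := ipn (lift E1 (KQ1 *m X1 t)) (w t); pose S2 t := ipn (lift E2 (KQ2 *m X2 t)) (w t).
pose C1 t := ipn (lift E1 (KB1^T *m Y1 t)) (h t); pose C2 t := ipn (lift E2 (KB2^T *m Y2 t)) (h t).
rewrite -/(w T) in V1 V2.
have {}V1 : \int[mu]_(t in `[0, T]) S1 t - \int[mu]_(t in `[0, T]) C1 t
  + ipn (lift E1 (Y1 T)) (w T) = 0 by exact: V1.
have {}V2 : \int[mu]_(t in `[0, T]) S2 t - \int[mu]_(t in `[0, T]) C2 t
  + ipn (lift E2 (Y2 T)) (w T) = 0 by exact: V2.
have {}s1 : mu.-integrable `[0, T]%classic (EFin \o S1) by exact: s1.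
have {}s2 : mu.-integrable `[0, T]%classic (EFin \o S2) by exact: s2.
have {}k1 : mu.-integrable `[0, T]%classic (EFin \o C1) by exact: k1.
have {}k2 : mu.-integrable `[0, T]%classic (EFin \o C2) by exact: k2.
(* Half of the first-order part of the running cost. Its integral cancels against the terminal
   pairings by [V1] and [V2]. *)
pose lin t := (S1 t + S2 t) - (C1 t + C2 t).
pose N t := normn (h t) ^+ 2.
have iN : mu.-integrable `[0, T]%classic (EFin \o N) by exact: admissible_normn_integrable ah.
have iS : mu.-integrable `[0, T]%classic (EFin \o (fun t => S1 t + S2 t)) by exact: (integrableD mI s1 s2).
have iC : mu.-integrable `[0, T]%classic (EFin \o (fun t => C1 t + C2 t)) by exact: (integrableD mI k1 k2).
have ilin : mu.-integrable `[0, T]%classic (EFin \o lin) by exact: (integrableB mI iS iC).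
have i2lin : mu.-integrable `[0, T]%classic (EFin \o (fun t => 2 * lin t)) by exact: (integrableZl mI 2 ilin).
have i2N : mu.-integrable `[0, T]%classic (EFin \o (fun t => 2 * lin t + N t)) by exact: (integrableD mI i2lin iN).
pose low t := base t + (2 * lin t + N t).
have ilow : mu.-integrable `[0, T]%classic (EFin \o low) by exact: (integrableD mI base_integrable i2N).
have low_int : \int[mu]_(t in `[0, T]) low t = \int[mu]_(t in `[0, T]) base t +
    (2 * (\int[mu]_(t in `[0, T]) S1 t + \int[mu]_(t in `[0, T]) S2 t
     - (\int[mu]_(t in `[0, T]) C1 t + \int[mu]_(t in `[0, T]) C2 t)) + \int[mu]_(t in `[0, T]) N t).
  rewrite (RintegralD mI base_integrable i2N); congr (_ + _).
  rewrite (RintegralD mI i2lin iN); congr (_ + _).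
  rewrite (RintegralZl _ mI ilin); congr (_ * _).
  by rewrite (RintegralB mI iS iC) (RintegralD mI s1 s2) (RintegralD mI k1 k2).
pose J t := ipn (y t) (FQ (y t)) + ipn (v t) (v t).
have J0 t : 0 <= t <= T -> 0 <= J t.
  by move=> tT; rewrite addr_ge0 ?ipn_ge0//; apply: Q_ge0; exact: Ly.
have lowJ t : 0 <= t <= T -> low t <= J t.
  move=> tT; have Lyt := Ly _ tT; have Lwt := Lw _ tT; have Lht := Lh _ tT.
  have Lvt := admissible_L2n av tT.
  have h1 := quadratic_lower_bound gQ Q_sa Q_ge0 (Lx t) Lyt (erefl (w t)).
  have h2 : ipn (FQ (x t)) (w t) = S1 t + S2 t.
    have LF : L2n (FQ (x t)) by exact: L2n_opn gQ _ _ _ (Lx t).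
    have La1 := L2n_lift LE1 (KQ1 *m X1 t); have La2 := L2n_lift LE2 (KQ2 *m X2 t).
    rewrite (ipn_ae LF (L2nD La1 La2) Lwt Lwt (opn_x t gQ iQ1 iQ2) (eqL2_refl _)).
    exact: ipnDl.
  (* The control cost is expanded exactly; its quadratic remainder becomes the |v - u|^2 of the
     conclusion. *)
  have h3 : ipn (v t) (v t) = ipn (u t) (u t) - 2 * (C1 t + C2 t) + N t.
    have e : v t = u t + h t by rewrite /h addrC subrK.
    have L1 := L2n_lift LE1 (KB1^T *m Y1 t); have L2 := L2n_lift LE2 (KB2^T *m Y2 t).
    have e2 : ipn (u t) (h t) = - (C1 t + C2 t).
      by rewrite /opt_control (ipnNl (L2nD L1 L2) Lht) (ipnDl L1 L2 Lht).
    rewrite {1 2}e (ipnDl (Lu t) Lht (L2nD (Lu t) Lht)) (ipnDr (Lu t) Lht (Lu t)).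
    rewrite (ipnDr (Lu t) Lht Lht) (ipnC (h t) (u t)) e2 /N sqr_normn; ring.
  by rewrite h2 in h1; rewrite /low /base /lin /J h3; exact: integrand_arith h1.
(* [J] is not known to be measurable, so the comparison uses monotonicity for nonnegative functions;
   [low] may be negative and is first replaced by its positive part. *)
have lowp t : low t <= Num.max (low t) 0 by rewrite le_max lexx.
have mlow : measurable_fun (`[0, T]%classic : set TR) low.
  by apply/measurable_EFinP; exact: measurable_int ilow.
have ilowp : mu.-integrable `[0, T]%classic (EFin \o (fun t => Num.max (low t) 0)).
  refine (@le_integrable _ _ _ mu _ mI _ _ _ _ ilow).
    by apply/measurable_EFinP; apply: measurable_maxr => //; exact: measurable_cst.
  by move=> t _ /=; rewrite lee_fin maxEle; case: ifP => _; rewrite ?normr0 ?normr_ge0 ?lexx.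
have hJ : ((\int[mu]_(t in `[0, T]) low t)%:E <= \int[mu]_(t in `[0%R, T]) (J t)%:E)%E.
  rewrite -[leLHS]/((fine _)%:E) fineK; last exact: (integrable_fin_num mI ilow).
  apply: (@le_trans _ _ (\int[mu]_(t in `[0%R, T]) (Num.max (low t) 0)%:E)%E).
    by apply: le_integral => // t _ /=; rewrite lee_fin.
  apply: ge0_le_integral_nonmeas => t; rewrite /= in_itv /= => tT.
    by rewrite lee_fin le_max lexx orbT.
  by rewrite lee_fin ge_max lowJ// J0.
have hT : ipn (x T) (FQT (x T)) + 2 * (ipn (lift E1 (Y1 T)) (w T) + ipn (lift E2 (Y2 T)) (w T))
    <= ipn (y T) (FQT (y T)).
  have Lyt := Ly _ TT; have Lwt := Lw _ TT.
  have h1 := quadratic_lower_bound gQT QT_sa QT_ge0 (Lx T) Lyt (erefl (w T)).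
  (* The final condition Y(T) = K_T X(T) makes the adjoint state at T equal to the terminal operator
     applied to the final state. *)
  have h2 : ipn (FQT (x T)) (w T) = ipn (lift E1 (Y1 T)) (w T) + ipn (lift E2 (Y2 T)) (w T).
    have LF : L2n (FQT (x T)) by exact: L2n_opn gQT _ _ _ (Lx T).
    have La1 := L2n_lift LE1 (Y1 T); have La2 := L2n_lift LE2 (Y2 T).
    rewrite (ipn_ae LF (L2nD La1 La2) Lwt Lwt _ (eqL2_refl _)); first exact: ipnDl.
    by rewrite YT1 YT2; exact: opn_x T gQT iT1 iT2.
  by rewrite -h2.
rewrite opt_cost_fin /cost -/(J _).
apply: (@le_trans _ _ ((\int[mu]_(t in `[0, T]) low t)%:E + (ipn (y T) (FQT (y T)))%:E)%E); last first.
  exact: leeD hJ (lexx _).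
rewrite -!EFinD lee_fin low_int; exact: (cost_arith _ _ V1 V2 hT).
Qed.

End TwoLiftsOptimality.
End Optimality.

(** * Splitting along S and S^perp, and positivity of the reduced matrices *)

Section Subspace.
Context {R : realType} {d : nat} (S : set (R -> R)) (f : 'I_d -> R -> R).
Local Notation mu := (@lebesgue_measure R).
Hypotheses (S_sub : linear_subspace S) (f_onb : orthonormal_basis S f).

Lemma subspace_sum (I : Type) (r : seq I) (k : I -> R) (g : I -> R -> R) :
  (forall i, S (g i)) -> S (fun a => \sum_(i <- r) k i * g i a).
Proof.
case: S_sub => _ S0 Slin _ Sg; elim: r => [|i r IH].
  by rewrite (_ : (fun a => _) = fun=> 0)//; apply/funext => a; rewrite big_nil.
rewrite (_ : (fun a => _) = fun a => k i * g i a + \sum_(j <- r) k j * g j a).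
  exact: Slin.
by apply/funext => a; rewrite big_cons.
Qed.

Lemma basis_L2 l : L2 (f l).
Proof. by case: S_sub => SL _ _ _; apply: SL; case: f_onb. Qed.

Lemma ip_basis_sum (k : 'I_d -> R) l : ip (fun a => \sum_m k m * f m a) (f l) = k l.
Proof.
have [_ fo _] := f_onb.
rewrite ip_suml; [|by move=> m _; apply: L2Z; exact: basis_L2|exact: basis_L2].
rewrite (bigD1 l)//= big1 ?addr0.
  by rewrite ipZl ?fo ?eqxx ?mulr1//; exact: basis_L2.
move=> m ml; rewrite ipZl; [|exact: basis_L2|exact: basis_L2].
by rewrite fo (negbTE ml) mulr0.
Qed.

Lemma basis_expansion v : S v -> eqL2 v (fun a => \sum_l ip v (f l) * f l a).
Proof.
move=> Sv; have [_ _ fS] := f_onb; have [k hk] := fS v Sv.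
suff -> : (fun a => \sum_l ip v (f l) * f l a) = (fun a => \sum_l k l * f l a) by [].
have Lk : L2 (fun a => \sum_l k l * f l a).
  by apply: L2_sum => m _; apply: L2Z; exact: basis_L2.
have Lv : L2 v by case: S_sub => SL _ _ _; exact: SL.
apply/funext => a; apply: eq_bigr => l _; congr (_ * _).
by rewrite (ip_ae Lv Lk (basis_L2 l) hk) ip_basis_sum.
Qed.

Lemma orth_basis g : L2 g -> (forall l, ip g (f l) = 0) -> orth S g.
Proof.
move=> Lg gf; split=> // s Ss.
have Ls : L2 s by case: S_sub => SL _ _ _; exact: SL.
have Lk : L2 (fun a => \sum_l ip s (f l) * f l a).
  by apply: L2_sum => m _; apply: L2Z; exact: basis_L2.
rewrite ipC (ip_ae Ls Lk Lg (basis_expansion Ss)) ip_suml//; last first.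
  by move=> l _; apply: L2Z; exact: basis_L2.
by rewrite big1// => l _; rewrite ipZl ?(ipC _ g) ?gf ?mulr0//; exact: basis_L2.
Qed.

Lemma orth_sum (I : Type) (r : seq I) (k : I -> R) (g : I -> R -> R) :
  (forall i, orth S (g i)) -> orth S (fun a => \sum_(i <- r) k i * g i a).
Proof.
move=> og; split.
  by apply: L2_sum => i _; apply: L2Z; case: (og i).
move=> s Ss; have Ls : L2 s by case: S_sub => SL _ _ _; exact: SL.
have Lg i : L2 (g i) by case: (og i).
rewrite ip_suml//; last by move=> i _; exact: L2Z.
by rewrite big1// => i _; rewrite ipZl//; have [_ ->] := og i; rewrite ?mulr0.
Qed.

Lemma gmatrix_sym c A : graphon c A -> (gmatrix f A)^T = gmatrix f A.
Proof.
move=> gA; apply/matrixP => l k; rewrite !mxE.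
by rewrite (ip_gop gA (basis_L2 k) (basis_L2 l)) ipC.
Qed.

Lemma gop_basis A l : invariant_under S A ->
  eqL2 (gop A (f l)) (fun a => \sum_k gmatrix f A l k * f k a).
Proof.
move=> Ainv; have [fS _ _] := f_onb.
rewrite (_ : (fun a => _) = fun a => \sum_k ip (gop A (f l)) (f k) * f k a).
  by apply: basis_expansion; apply: Ainv; exact: fS.
by apply/funext => a; apply: eq_bigr => k _; rewrite mxE.
Qed.

(* [d + 1] disjoint indicators are linearly independent, and [d] linear
   conditions on their combinations leave a nonzero one in [S^perp]. *)
Lemma orth_nontrivial : exists2 e, orth S e & 0 < ip e e.
Proof.
pose N : R := d.+1%:R; have N0 : 0 < N by rewrite ltr0n.
(* Half-open intervals of equal length 1 / (d + 1): disjoint, inside [0,1], with indicators of equal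
   norm. *)
pose J (k : 'I_d.+1) : set R := `[k%:R / N, k.+1%:R / N[%classic.
pose g (k : 'I_d.+1) : R -> R := \1_(J k).
have mJ k : measurable (J k) by exact: measurable_itv.
have JI k : J k `<=` I01.
  move=> x; rewrite /J /I01 /= !in_itv /= => /andP[h1 h2]; apply/andP; split.
    by apply: le_trans h1; rewrite divr_ge0// ltW.
  by rewrite (le_trans (ltW h2))// ler_pdivrMr// mul1r ler_nat.
have Lg k : L2 (g k).
  apply: (@L2_bounded _ _ 1); first exact: measurable_indic.
  by move=> x _; rewrite /g indicE; case: (_ \in _); rewrite ?normr1 ?normr0.
have gg0 k m : k != m -> ip (g k) (g m) = 0.
  move=> km; rewrite -[RHS](ip0l (fun=> 1)); apply: eq_Rintegral => x _.
  rewrite mul0r /g !indicE; apply/eqP; rewrite mulf_eq0 !pnatr_eq0 !eqb0.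
  apply/negPn/negP => /norP[/negPn/set_mem Jk /negPn/set_mem Jm].
  move: Jk Jm; rewrite /J /= !in_itv /= => /andP[a1 a2] /andP[b1 b2].
  have := le_lt_trans a1 b2; have := le_lt_trans b1 a2.
  rewrite !ltr_pM2r ?invr_gt0// !ltr_nat !ltnS => h1 h2.
  by move/negP: km; apply; rewrite -val_eqE eqn_leq h1 h2.
have ggN k : ip (g k) (g k) = N^-1.
  transitivity (\int[mu]_(x in I01) (\1_(J k) x : R)).
    apply: eq_Rintegral => x _; rewrite /g indicE.
    by case: (_ \in _); rewrite ?mulr1 ?mulr0.
  rewrite /Rintegral (integral_indic _ measurable_I01 (mJ k)) setIidl//.
  have e : mu (J k) = (k.+1%:R / N - k%:R / N)%:E.
    apply: etrans (lebesgue_measure_itv `[k%:R / N, k.+1%:R / N[) _.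
    by rewrite /= lte_fin ltr_pM2r ?invr_gt0// ltr_nat ltnSn EFinB.
  by apply: etrans (congr1 fine e) _; rewrite /= -mulrBl -natrB// subSnn mul1r.
pose M : 'M[R]_(d.+1, d) := \matrix_(k, l) ip (g k) (f l).
have : kermx M != 0.
  rewrite kermx_eq0 /row_free; apply/eqP => rM.
  by have := rank_leq_col M; rewrite rM ltnn.
move=> /rowV0Pn[k kM k0].
have {}kM : k *m M = 0 by exact/sub_kermxP.
pose e x := \sum_m k 0 m * g m x.
have Le : L2 e by apply: L2_sum => m _; exact: L2Z.
exists e.
  apply: orth_basis => // l.
  rewrite /e ip_suml; [|by move=> m _; exact: L2Z|exact: basis_L2].
  have /matrixP/(_ 0 l) := kM; rewrite !mxE => kMl; apply: etrans kMl.
  by apply: eq_bigr => m _; rewrite ipZl ?mxE//; exact: basis_L2.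
have ge m : ip (g m) e = k 0 m * N^-1.
  rewrite ipC /e ip_suml//; last by move=> j _; exact: L2Z.
  rewrite (bigD1 m)//= big1 ?addr0; first by rewrite ipZl// ggN.
  by move=> j jm; rewrite ipZl// gg0// mulr0.
have -> : ip e e = (\sum_m k 0 m ^+ 2) * N^-1.
  rewrite {1}/e ip_suml//; last by move=> j _; exact: L2Z.
  by rewrite mulr_suml; apply: eq_bigr => m _; rewrite ipZl// ge mulrA.
rewrite divr_gt0// lt_def sumr_ge0 ?andbT; last by move=> m _; exact: sqr_ge0.
apply: contra k0; rewrite psumr_eq0; last by move=> m _; exact: sqr_ge0.
move=> /allP h; apply/eqP/matrixP => i j; rewrite ord1 mxE.
by have := h j (mem_index_enum j); rewrite /= sqrf_eq0 => /eqP.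
Qed.

Section Vector.
Context {n : nat}.
Implicit Types (v : R -> 'cV[R]_n).

Lemma Projf_lift (N : 'cV[R]_(d * n)) : Projf f (lift (tensor_family f) N) = N.
Proof.
apply/matrixP => k j; rewrite ord1 mxE coordf_lift_tensor.
rewrite (ip_basis_sum (fun l => N (mxtens_index (l, (mxtens_unindex k).2)) 0)).
by rewrite -surjective_pairing mxtens_unindexK.
Qed.

Definition orth_part v : R -> 'cV[R]_n := v - lift (tensor_family f) (Projf f v).

Lemma orth_part_orth v i : L2n v -> orth S (coordf (orth_part v) i).
Proof.
move=> Lv; have Ll := L2n_lift (L2n_tensor basis_L2) (Projf f v).
apply: orth_basis; first exact: (L2nB Lv Ll i).
move=> l.
have -> : coordf (orth_part v) i =
    fun a => (-1) * coordf (lift (tensor_family f) (Projf f v)) i a + coordf v i a.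
  by apply/funext => a; rewrite /coordf /orth_part !mxE mulN1r addrC.
rewrite ip_linl; [|exact: Ll|exact: Lv|exact: basis_L2].
rewrite coordf_lift_tensor.
rewrite (ip_basis_sum (fun l => Projf f v (mxtens_index (l, i)) 0)).
by rewrite mxE mxtens_indexK mulN1r addNr.
Qed.

Lemma L2n_orth_part v : L2n v -> L2n (orth_part v).
Proof. by move=> Lv i; case: (orth_part_orth i Lv). Qed.

(** The coefficient matrix 1 of the second lift is the initial value of the n x n trajectory, so the
    constructed state starts at x0. *)
Lemma orth_part_split v :
  v = lift (tensor_family f) (Projf f v) + lift (mulmx_family (orth_part v)) 1%:M.
Proof.
rewrite lift_mulmxE; apply/funext => a; apply/matrixP => i j.
by rewrite mxE mul1mx /orth_part !mxE addrC subrK.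
Qed.

Section Intertwine.
Variables (c : R) (A : R * R -> R).
Hypotheses (gA : graphon c A) (Ainv : invariant_under S A) (Aorth : vanishes_on_orth S A).

Lemma intertwines_basis (L D : 'M[R]_n) :
  intertwines (tensor_family f) (opn L D A) (kron_op L D (gmatrix f A)).
Proof.
apply: (intertwines_tensor basis_L2 gA); first exact: gmatrix_sym gA.
by move=> l; exact: gop_basis.
Qed.

Lemma intertwines_orth_part v (L D : 'M[R]_n) : L2n v ->
  intertwines (mulmx_family (orth_part v)) (opn L D A) L.
Proof.
move=> Lv; apply: (intertwines_mulmx (L2n_orth_part Lv) gA) => l.
by apply: Aorth; exact: orth_part_orth.
Qed.

(** The limit is explicit: v is split along S and S^perp, and each part is a lift with a matrix
    exponential. The second family is built from v itself, which covers the infinite-dimensional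
    S^perp. *)
Lemma is_expop_exists (L D : 'M[R]_n) t v : L2n v -> exists w, is_expop A L D t v w.
Proof.
move=> Lv; have Lb := L2n_orth_part Lv.
have LE1 := L2n_tensor basis_L2 (n := n); have LE2 := L2n_mulmx_family Lb.
have i1 := is_expop_lift LE1 gA (intertwines_basis L D) t (Projf f v).
have i2 := is_expop_lift LE2 gA (intertwines_orth_part L D Lv) t 1%:M.
have := is_expop_add gA (L2n_lift LE1 _) (L2n_lift LE2 _) i1 i2.
rewrite -(orth_part_split v) => h; eexists; exact: h.
Qed.

(** By orthonormality, v^T K v is the quadratic form of the operator at the lift of v. *)
Lemma kron_op_psd (L D : 'M[R]_n) : nonnegative (opn L D A) ->
  psdmx (kron_op L D (gmatrix f A)).
Proof.
move=> ge0 v; have LE1 := L2n_tensor basis_L2 (n := n).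
have Lv := L2n_lift LE1 v; set K := kron_op _ _ _.
have := ge0 _ Lv; rewrite (ipn_ae Lv Lv _ _ (eqL2_refl _) ((intertwines_basis L D).1 v)).
- rewrite ipn_lift//; last exact: L2n_lift.
  rewrite coord_tensor; last exact: L2n_lift.
  by rewrite Projf_lift mxip_tr mulmxA /mxtrace big_ord1.
- exact: L2n_opn gA _ _ _ Lv.
- exact: L2n_lift.
Qed.

(** On e(.)x with e in S^perp the graphon part vanishes and the form is (x^T L x) |e|^2; a nonzero e
    lets the positive factor be divided out. *)
Lemma orth_psd (L D : 'M[R]_n) : nonnegative (opn L D A) -> psdmx L.
Proof.
move=> ge0 x; have [e oe e0] := orth_nontrivial; have [Le _] := oe.
pose g (y : 'cV[R]_n) : R -> 'cV[R]_n := fun a => e a *: y.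
have cg y i : coordf (g y) i = fun a => y i 0 * e a.
  by apply/funext => a; rewrite /coordf /g mxE mulrC.
have Lg y : L2n (g y) by move=> i; rewrite cg; exact: L2Z.
have Fg : eqL2 (opn L D A (g x)) (g (L *m x)).
  apply: coordf_eqL2 => i; apply: filterS (Aorth oe) => a h Ia.
  rewrite coordf_opn cg [X in _ + X]big1 ?addr0.
    by rewrite mxE mulr_suml; apply: eq_bigr => j _; rewrite cg mulrA.
  move=> j _; rewrite cg.
  (* Written as a one-term sum, so that linearity of the graphon operator over sums gives
     homogeneity. *)
  have -> : (fun b => x j 0 * e b) = (fun b => \sum_(i <- [:: j]) x i 0 * e b).
    by apply/funext => b; rewrite big_seq1.
  by rewrite (gop_sum gA _ (fun i => x i 0) (fun=> Le) Ia) big_seq1 h// !mulr0.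
have := ge0 _ (Lg x); rewrite (ipn_ae (Lg x) (Lg x) _ (Lg _) (eqL2_refl _) Fg); last first.
  exact: L2n_opn gA _ _ _ (Lg x).
have -> : ipn (g x) (g (L *m x)) = (x^T *m L *m x) 0 0 * ip e e.
  rewrite -mulmxA mxE mulr_suml; apply: eq_bigr => i _.
  by rewrite !cg ipZl ?(ipC e) ?ipZl// ?mxE ?mulrA//; exact: L2Z.
by rewrite pmulr_lge0.
Qed.

End Intertwine.
End Vector.
End Subspace.

(** The flow is normalized at T; right multiplication by X(0)^-1 N moves the normalization to time 0
    and preserves the linear system, the final condition and Y = P X. *)
Lemma riccati_trajectory (R : realType) (p q : nat) (A B Q QT : 'M[R]_p) (T : R)
    (P : R -> 'M[R]_p) (N : 'M[R]_(p, q)) :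
  0 <= T -> psdmx Q -> psdmx QT -> riccati_solution T A B Q QT P ->
  exists X Y : R -> 'M[R]_(p, q),
    [/\ forall t : R, is_derive t 1 X (A *m X t - B *m (B^T *m Y t)),
        forall t : R, is_derive t 1 Y (- (Q *m X t) - A^T *m Y t),
        X 0 = N, Y T = QT *m X T
      & forall t : R, 0 <= t <= T -> Y t = P t *m X t].
Proof.
move=> T0 Q0 QT0 hP; have [X [Y h]] := hamiltonian_flow_exists A B Q QT T.
have X0 := hamiltonian_flow_unit Q0 QT0 h T0.
have YP := riccati_hamiltonian h hP; have [dX dY XT YT] := h.
exists (fun t => X t *m (invmx (X 0) *m N)), (fun t => Y t *m (invmx (X 0) *m N)).
split=> [t|t|||t tT].
- have := is_derive_mulmx_cst (invmx (X 0) *m N) (dX t).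
  by rewrite mulmxBl !mulmxA.
- have := is_derive_mulmx_cst (invmx (X 0) *m N) (dY t).
  by rewrite mulmxBl mulNmx !mulmxA.
- by rewrite mulmxA mulmxV// mul1mx.
- by rewrite XT YT mul1mx.
- by rewrite YP// mulmxA.
Qed.

Lemma ae_eq_of_integral_normn (R : realType) (n : nat) (T : R) (u v : R -> R -> 'cV[R]_n) :
  admissible T u -> admissible T v ->
  \int[@lebesgue_measure R]_(t in `[0, T]) (normn (v t - u t) ^+ 2) <= 0 ->
  {ae @lebesgue_measure R, forall t, 0 <= t <= T -> eqL2 (v t) (u t)}.
Proof.
move=> au av h0; have mI := measurable_itvR 0 T; have ah := admissibleB au av.
have iN := admissible_normn_integrable ah.
have e : (\int[@lebesgue_measure R]_(t in `[0%R, T])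
    `|(normn (v t - u t) ^+ 2)%:E|)%E = 0%E.
  have -> : (\int[@lebesgue_measure R]_(t in `[0%R, T]) `|(normn (v t - u t) ^+ 2)%:E|)%E
      = (\int[@lebesgue_measure R]_(t in `[0%R, T]) (normn (v t - u t) ^+ 2)%:E)%E.
    by apply: eq_integral => t _; rewrite gee0_abs// lee_fin sqr_ge0.
  apply/eqP; rewrite eq_le integral_ge0 ?andbT; last first.
    by move=> t _; rewrite lee_fin sqr_ge0.
  by rewrite -[leLHS]fineK ?lee_fin//; exact: (integrable_fin_num mI iN).
have /(ae_eq_integral_abs _ mI (measurable_int _ iN)) := e.
apply: filterS => t h tT.
have Lh : L2n (v t - u t) by exact: admissible_L2n ah tT.
have /= := h _; rewrite in_itv /= => /(_ tT) [] /eqP; rewrite sqrf_eq0 => /eqP.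
move=> /(normn_eq0 Lh); apply: filterS => a hh Ia.
by apply/eqP; rewrite -subr_eq0; apply/eqP; exact: hh Ia.
Qed.

Section Projection.
Context {R : realType} {d n : nat} (S : set (R -> R)) (f : 'I_d -> R -> R).
Hypotheses (S_sub : linear_subspace S) (f_onb : orthonormal_basis S f).
Implicit Types (v w : R -> 'cV[R]_n).

Lemma lift_tensor_subspace (N : 'cV[R]_(d * n)) i :
  S (coordf (lift (tensor_family f) N) i).
Proof.
by rewrite coordf_lift_tensor; apply: (subspace_sum S_sub); case: f_onb.
Qed.

Lemma lift_orth_part v (N : 'M[R]_n) i : L2n v ->
  orth S (coordf (lift (mulmx_family (orth_part f v)) N) i).
Proof.
move=> Lv; rewrite coordf_lift_mulmx; apply: (orth_sum S_sub) => j.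
exact: orth_part_orth.
Qed.

Lemma Projf_decomposition (N : 'cV[R]_(d * n)) v w : L2n v ->
  (forall i, orth S (coordf w i)) ->
  eqL2 v (lift (tensor_family f) N + w) -> Projf f v = N.
Proof.
move=> Lv ow e; have Lf := basis_L2 S_sub f_onb.
have Ll := L2n_lift (L2n_tensor Lf) N; have Lw i : L2 (coordf w i) by case: (ow i).
rewrite -[RHS](Projf_lift S_sub f_onb); apply/matrixP => k j; rewrite !mxE.
set i := (mxtens_unindex k).2; set l := (mxtens_unindex k).1.
have Ls : L2 (coordf (lift (tensor_family f) N + w) i) by exact: (L2nD Ll Lw).
rewrite (ip_ae (Lv i) Ls (Lf l)); last first.
  exact: eqL2_comp (fun (_ : R) (y : 'cV[R]_n) => y i 0) _ _ e.
have -> : coordf (lift (tensor_family f) N + w) i =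
    fun a => 1 * coordf (lift (tensor_family f) N) i a + coordf w i a.
  by apply/funext => a; rewrite /coordf !mxE mul1r.
rewrite ip_linl; [|exact: Ll|exact: Lw|exact: Lf].
by have [_ ->] := ow i; rewrite ?mul1r ?addr0//; case: f_onb.
Qed.

End Projection.

Theorem theorem1 (R : realType) (T c : R) (n : nat)
    (La Da Lb Db Lq Dq LqT DqT : 'M[R]_n) (A B Q QT : R * R -> R)
    (S : set (R -> R)) (d : nat) (f : 'I_d -> R -> R)
    (T_gt0 : 0 < T) (c_gt0 : 0 < c) (n_gt0 : (0 < n)%N)
    (gA : graphon c A) (gB : graphon c B) (gQ : graphon c Q)
    (gQT : graphon c QT)
    (Q_sa : self_adjoint (opn Lq Dq Q)) (Q_ge0 : nonnegative (opn Lq Dq Q))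
    (QT_sa : self_adjoint (opn LqT DqT QT))
    (QT_ge0 : nonnegative (opn LqT DqT QT))
    (S_sub : linear_subspace S) (f_onb : orthonormal_basis S f)
    (A_inv : invariant_under S A) (B_inv : invariant_under S B)
    (Q_inv : invariant_under S Q) (QT_inv : invariant_under S QT)
    (A_orth : vanishes_on_orth S A) (B_orth : vanishes_on_orth S B)
    (Q_orth : vanishes_on_orth S Q) (QT_orth : vanishes_on_orth S QT) :
  let FA := opn La Da A in
  let FB := opn Lb Db B in
  let FQ := opn Lq Dq Q in
  let FQT := opn LqT DqT QT in
  let KA := kron_op La Da (gmatrix f A) in
  let KB := kron_op Lb Db (gmatrix f B) in
  let KQ := kron_op Lq Dq (gmatrix f Q) in
  let KQT := kron_op LqT DqT (gmatrix f QT) in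
  (exists Pi, riccati_solution T KA KB KQ KQT Pi) /\
  (exists pi, riccati_solution T La Lb Lq LqT pi) /\
  forall Pi pi,
    riccati_solution T KA KB KQ KQT Pi ->
    riccati_solution T La Lb Lq LqT pi ->
  forall x0, L2n x0 ->
  exists u,
    [/\ optimal_control T FA FB FQ FQT x0 u,
        forall v, optimal_control T FA FB FQ FQT x0 v ->
          {ae lebesgue_measure, forall t, 0 <= t <= T -> eqL2 (v t) (u t)}
      & forall x, mild_solution T FA FB x0 u x ->
        forall t : R, 0 <= t <= T ->
        let up := - (KB^T *m Pi t *m Projf f (x t)) in
        exists xf xb ub,
          [/\ decomposition S (x t) xf xb,
              decomposition S (u t)
                (fun a => \sum_(l < d) f l a *: block up l) ub
            & {ae lebesgue_measure, forall g, I01 g ->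
                ub g = - (Lb^T *m pi t *m xb g)}]].
Proof.
move=> FA FB FQ FQT KA KB KQ KQT.
have KQ0 : psdmx KQ := kron_op_psd S_sub f_onb gQ Q_inv Q_ge0.
have KQT0 : psdmx KQT := kron_op_psd S_sub f_onb gQT QT_inv QT_ge0.
have Lq0 : psdmx Lq := orth_psd S_sub f_onb gQ Q_orth Q_ge0.
have LqT0 : psdmx LqT := orth_psd S_sub f_onb gQT QT_orth QT_ge0.
split; first exact: riccati_exists.
split; first exact: riccati_exists.
move=> Pi pi hPi hpi x0 Lx0.
have T0 := ltW T_gt0.
(* Along S the trajectory starts at the coordinates of x0; along S^perp it starts at the identity
   matrix, acting on the orthogonal part of x0. *)
have [X1 [Y1 [dX1 dY1 X10 YT1 YX1]]] := riccati_trajectory (Projf f x0) T0 KQ0 KQT0 hPi.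
have [X2 [Y2 [dX2 dY2 X20 YT2 YX2]]] := riccati_trajectory 1%:M T0 Lq0 LqT0 hpi.
pose E1 := tensor_family f (n := n); pose E2 := mulmx_family (orth_part f x0).
have Lf := basis_L2 S_sub f_onb.
have LE1 : forall i j, L2n (E1 i j) by exact: L2n_tensor.
have LE2 : forall i j, L2n (E2 i j).
  exact: L2n_mulmx_family (L2n_orth_part S_sub f_onb Lx0).
have i1 K (gK : graphon c K) (K_inv : invariant_under S K) L D :
    intertwines E1 (opn L D K) (kron_op L D (gmatrix f K)).
  exact (intertwines_basis S_sub f_onb gK K_inv L D).
have i2 K (gK : graphon c K) (K_orth : vanishes_on_orth S K) L D :
    intertwines E2 (opn L D K) L.
  exact (intertwines_orth_part S_sub f_onb gK K_orth L D Lx0).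
have ex t v : L2n v -> exists w, is_expop A La Da t v w.
  exact (is_expop_exists S_sub f_onb gA A_inv A_orth La Da t (v := v)).
pose x : R -> R -> 'cV[R]_n := opt_state E1 E2 X1 X2; pose u : R -> R -> 'cV[R]_n := opt_control E1 E2 KB Lb Y1 Y2.
have x0E : eqL2 (x 0) x0.
  rewrite /x /opt_state X10 X20 -orth_part_split; exact: eqL2_refl.
have au : admissible T u := opt_control_admissible T LE1 LE2 _ _ dY1 dY2.
have mx : mild_solution T FA FB x0 u x.
  exact: (opt_state_mild T gA gB ex LE1 LE2 (i1 _ gA A_inv La Da) (i1 _ gB B_inv Lb Db)
    (i2 _ gA A_orth La Da) (i2 _ gB B_orth Lb Db) dX1 dX2 dY1 dY2 x0E).
have cost_le v y (av : admissible T v) (my : mild_solution T FA FB x0 v y) :=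
  opt_cost_le gA gB gQ gQT T0 ex Q_sa Q_ge0 QT_sa QT_ge0 LE1 LE2
    (i1 _ gA A_inv La Da) (i1 _ gB B_inv Lb Db) (i1 _ gQ Q_inv Lq Dq)
    (i1 _ gQT QT_inv LqT DqT) (i2 _ gA A_orth La Da) (i2 _ gB B_orth Lb Db)
    (i2 _ gQ Q_orth Lq Dq) (i2 _ gQT QT_orth LqT DqT)
    dX1 dX2 dY1 dY2 YT1 YT2 Lx0 x0E av my.
have cost_fin := opt_cost_fin QT LqT DqT T gQ LE1 LE2
  (i1 _ gQ Q_inv Lq Dq) (i2 _ gQ Q_orth Lq Dq) dX1 dX2 dY1 dY2.
have [r er] : exists r : R, cost T FQ FQT x u = r%:E by eexists; exact: cost_fin.
exists u; split.
- split; [exact: au|exists x; [exact: mx|move=> v y av my]].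
  apply: le_trans (cost_le v y av my); apply: leeDl; rewrite lee_fin.
  by apply: Rintegral_ge0 => t _; exact: sqr_ge0.
- move=> v [av [y my opt]]; apply: (ae_eq_of_integral_normn au av).
  (* Optimality of v gives J(u) + |v - u|^2 <= J(v) <= J(u), and J(u) is a real number. *)
  have := le_trans (cost_le v y av my) (opt u x au mx).
  by rewrite -/x -/u er -EFinD lee_fin gerDl.
move=> z mz t tT up.
(* The formulas concern any mild solution; at each time it agrees almost everywhere with the
   explicit state. *)
have zx : eqL2 (z t) (x t) := mild_unique gA ex Lx0 mz mx tT.
have Lz : L2n (z t) by case: mz => + _ _; exact.
have ob i : orth S (coordf (lift E2 (X2 t)) i) by exact: lift_orth_part.
have upE : up = - (KB^T *m Y1 t).
  by rewrite /up (Projf_decomposition S_sub f_onb Lz ob zx) YX1// mulmxA.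
exists (lift E1 (X1 t)), (lift E2 (X2 t)), (lift E2 (- (Lb^T *m Y2 t))); split.
- by split=> [i|i|]; [exact: lift_tensor_subspace|exact: ob|exact: zx].
- rewrite -lift_tensorE; split=> [i|i|].
  + exact: lift_tensor_subspace.
  + exact: lift_orth_part.
  + by rewrite /u /opt_control upE !liftN opprD; exact: eqL2_refl.
- by apply: aeW => g _; rewrite !lift_mulmxE YX2// mulNmx !mulmxA.
Qed.
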